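(* Let $p$ be a prime, $s\in\mathbb{N}$, $\alpha\in\mathbb{N}$ with $\alpha\ge2$, $1\le q,r\le\infty$, and let $\boldsymbol{\gamma}=(\gamma_u)_{u\subseteq\{1,\ldots,s\}}$ be non-negative weights. Let $m\in\mathbb{N}$ and let $P_{m,\alpha m}$ be an order $\alpha$ digital $(t,m,s)$-net over $\mathbb{F}_p$ with generating matrices $C_1,\ldots,C_s\in\mathbb{F}_p^{\alpha m\times m}$. For $0\le i<\alpha$ let $P^{[(m+i)\times m]}_{m,\alpha m}$ be the digital net generated by the upper $(m+i)\times m$ submatrices of $C_1,\ldots,C_s$. For $f\in W_{s,\alpha,q,r}$ put $$J^{(1)}_{m+i}(f)=I\bigl(f;P^{[(m+i)\times m]}_{m,\alpha m}\bigr)\quad(0\le i<\alpha),$$ and recursively, for $1\le\tau<\alpha$, $$J^{(\tau+1)}_{m+i}(f)=\frac{p^\tau J^{(\tau)}_{m+i+1}(f)-J^{(\tau)}_{m+i}(f)}{p^\tau-1}\quad(0\le i<\alpha-\tau).$$ Then, with $N=\alpha p^m$, $$\sup_{\substack{f\in W_{s,\alpha,q,r}\\ \|f\|_{s,\alpha,q,r}\le1}}\left|I(f)-J^{(\alpha)}_m(f)\right|\le\sum_{\emptyset\ne u\subseteq\{1,\ldots,s\}}\gamma_u\,V_{|u|,\alpha,t}\,\frac{(\log_pN)^{\alpha|u|}}{N^\alpha},$$ where for all $\emptyset\ne u\subseteq\{1,\ldots,s\}$ $$V_{|u|,\alpha,t}=\left(\frac{\alpha}{\log_p2}\right)^{\alpha|u|}\left(p^tA_\alpha^{|u|}C_\alpha^{|u|}E_{|u|,\alpha}+(\alpha+1)^{|u|}D_\alpha^{|u|}\right)\sum_{i=0}^{\alpha-1}|w_i|,$$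 with the constants $A_\alpha,C_\alpha,D_\alpha,E_{|u|,\alpha},w_i$ given in the context.
   Context: Constants (depending on $p$): $$A_\alpha=1+\sum_{w=1}^{\alpha-1}\prod_{i=1}^{w}\frac{p-1}{p^i-1}+\frac{p^\alpha-1}{p^\alpha-p}\prod_{i=1}^{\alpha}\frac{p-1}{p^i-1},$$ $$C_\alpha=\Bigl(1+\frac1p+\frac1{p(p+1)}\Bigr)^{\alpha-2}\Bigl(3+\frac2p+\frac{2p+1}{p-1}\Bigr)\max\Bigl(\frac{2}{(2\sin(\pi/p))^\alpha},\max_{1\le z<\alpha}\frac1{(2\sin(\pi/p))^z}\Bigr),$$ $$D_\alpha=\max\Bigl\{|b_1|,\ldots,|b_{\alpha-1}|,\sup_{x\in[0,1)}|\tilde b_\alpha(x)|\Bigr\},\qquad E_{|u|,\alpha}=p^{\alpha|u|}\Bigl(\frac1p+\Bigl(\frac p{p-1}\Bigr)^{\alpha|u|}\Bigr),$$ $$w_i=\prod_{j=1}^{\alpha-i-1}\Bigl(\frac{-1}{p^j-1}\Bigr)\prod_{j=1}^{i}\Bigl(\frac{p^j}{p^j-1}\Bigr)\quad(0\le i\le\alpha-1),$$ empty products being $1$. Here $b_\tau(x)=B_\tau(x)/\tau!$ with $B_\tau$ the Bernoulli polynomial of degree $\tau$, $b_\tau=b_\tau(0)$, and $\tilde b_\alpha$ is the one-periodic extension of $b_\alpha|_{[0,1)}$. Notation: $\mathbb{N}$ is the set of positive integers, $\mathbb{N}_0=\mathbb{N}\cup\{0\}$; $\mathbb{F}_p$ is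 the field with $p$ elements, identified with $\{0,\ldots,p-1\}$. For $\boldsymbol{x}\in\mathbb{R}^s$ and $u\subseteq\{1,\ldots,s\}$, $\boldsymbol{x}_u=(x_j)_{j\in u}$ and $-u=\{1,\ldots,s\}\setminus u$. $I(f)=\int_{[0,1)^s}f(\boldsymbol{x})\,d\boldsymbol{x}$. For a family $P$ of $M$ points (with multiplicity), $I(f;P)=\frac1M\sum_{\boldsymbol{x}\in P}f(\boldsymbol{x})$. Function space. For $f:[0,1)^s\to\mathbb{R}$ having partial mixed derivatives up to order $\alpha$ in each variable, define $$\|f\|^r_{s,\alpha,q,r}=\sum_{u\subseteq\{1,\ldots,s\}}\Bigl(\gamma_u^{-q}\sum_{v\subseteq u}\sum_{\boldsymbol{\tau}_{u\setminus v}\in\{1,\ldots,\alpha\}^{|u\setminus v|}}\int_{[0,1)^{|v|}}\Bigl|\int_{[0,1)^{s-|v|}}f^{(\boldsymbol{\tau}_{u\setminus v},\boldsymbol{\alpha}_v,\boldsymbol{0})}(\boldsymbol{x})\,d\boldsymbol{x}_{-v}\Bigr|^q d\boldsymbol{x}_v\Bigr)^{r/q},$$ with the obvious modification if $q$ or $r$ is infinite. Here $f^{(\boldsymbol{\tau}_{u\setminus v},\boldsymbol{\alpha}_v,\boldsymbol{0})}$ is the partial mixed derivative of order $\beta_j=\tau_j$ in $x_j$ for $j\in u\setminus v$, $\beta_j=\alpha$ for $j\in v$, $\beta_j=0$ otherwise. If $\gamma_u=0$, the corresponding inner double sum is assumed to be $0$ and $0/0=0$. $W_{s,\alpha,q,r}=\{f:\|f\|_{s,\alpha,q,r}<\infty\}$.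 Functions in this space are identified with their pointwise representation $f(\boldsymbol{x})=\sum_{u}f_u(\boldsymbol{x}_u)$, where $$f_u(\boldsymbol{x}_u)=\sum_{v\subseteq u}(-1)^{(\alpha+1)|v|}\sum_{\boldsymbol{\tau}_{u\setminus v}\in\{1,\ldots,\alpha\}^{|u\setminus v|}}\prod_{j\in u\setminus v}b_{\tau_j}(x_j)\int_{[0,1)^s}f^{(\boldsymbol{\tau}_{u\setminus v},\boldsymbol{\alpha}_v,\boldsymbol{0})}(\boldsymbol{y})\prod_{j\in v}\tilde b_\alpha(y_j-x_j)\,d\boldsymbol{y}.$$ Digital nets. For $m,n\in\mathbb{N}$ and $C_1,\ldots,C_s\in\mathbb{F}_p^{n\times m}$, the digital net with these generating matrices is the family $\{\boldsymbol{x}_h:0\le h<p^m\}\subset[0,1)^s$ (counted with multiplicity): if $h=\eta_0+\eta_1p+\cdots+\eta_{m-1}p^{m-1}$ in base $p$, then $x_{h,j}=\sum_{i=1}^n\xi_{h,j,i}p^{-i}$ with $(\xi_{h,j,1},\ldots,\xi_{h,j,n})=(\eta_0,\ldots,\eta_{m-1})C_j^\top$ over $\mathbb{F}_p$. Its dual net is $$P^\perp=\{\boldsymbol{k}\in\mathbb{N}_0^s: C_1^\top\nu_n(k_1)+\cdots+C_s^\top\nu_n(k_s)=\boldsymbol{0}\in\mathbb{F}_p^m\},$$ where $\nu_n(k)=(\kappa_0,\ldots,\kappa_{n-1})^\top$ for $k=\kappa_0+\kappa_1p+\cdots$ in base $p$. Weight function. For $k=\kappa_1p^{c_1-1}+\cdots+\kappa_vp^{c_v-1}$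 with $\kappa_i\in\{1,\ldots,p-1\}$, $c_1>\cdots>c_v>0$, set $\mu_\alpha(k)=\sum_{i=1}^{\min(\alpha,v)}c_i$, $\mu_\alpha(0)=0$, and $\mu_\alpha(k_1,\ldots,k_s)=\sum_j\mu_\alpha(k_j)$. An order $\alpha$ digital $(t,m,s)$-net over $\mathbb{F}_p$, with integer $0\le t\le\alpha m$, is a digital net $P$ over $\mathbb{F}_p$ with $p^m$ points in $[0,1)^s$ satisfying $\min_{\boldsymbol{k}\in P^\perp\setminus\{\boldsymbol{0}\}}\mu_\alpha(\boldsymbol{k})>\alpha m-t$. *)

(* Defs.v *)
From HB Require Import structures.
From mathcomp Require Import all_boot all_order all_algebra.
From mathcomp Require Import all_classical all_reals all_analysis.

Set Implicit Arguments.
Unset Strict Implicit.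
Unset Printing Implicit Defensive.

Import Order.TTheory GRing.Theory Num.Theory.
Import numFieldNormedType.Exports.

Local Open Scope classical_set_scope.
Local Open Scope ring_scope.

(** * Bernoulli polynomials *)

Section Bernoulli.
Variable R : realType.

(* The list [B_0; ...; B_(n-1)], obtained by solving
   \sum_(k <= n) 'C(n+1, k) B_k = (n+1) X^n for B_n. *)
Fixpoint bernoulli_seq (n : nat) : seq {poly R} :=
  if n is n'.+1 then
    let B := bernoulli_seq n' in
    rcons B ('X^n' - n'.+1%:R^-1 *: \sum_(k < n') 'C(n'.+1, k)%:R *: B`_k)
  else [::].

Definition bernoulli_poly (n : nat) : {poly R} := (bernoulli_seq n.+1)`_n.

Definition bern (tau : nat) (x : R) : R := (bernoulli_poly tau).[x] / tau`!%:R.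

Definition bern_per (tau : nat) (x : R) : R :=
  bern tau (x - (Num.floor x)%:~R).

End Bernoulli.

(** * The constants *)

Section Constants.
Variable R : realType.
Implicit Types p alpha n t : nat.

Definition logb p (x : R) : R := ln x / ln p%:R.

Definition const_A p alpha : R :=
  1 + \sum_(1 <= w < alpha) \prod_(1 <= i < w.+1) ((p%:R - 1) / (p%:R ^+ i - 1))
  + (p%:R ^+ alpha - 1) / (p%:R ^+ alpha - p%:R)
    * \prod_(1 <= i < alpha.+1) ((p%:R - 1) / (p%:R ^+ i - 1)).

Definition const_C p alpha : R :=
  (1 + p%:R^-1 + (p%:R * (p%:R + 1))^-1) ^+ (alpha - 2)
  * (3 + 2 / p%:R + (2 * p%:R + 1) / (p%:R - 1))
  * Num.max (2 / (2 * sin (pi / p%:R)) ^+ alpha)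
      (\big[Num.max/0]_(1 <= z < alpha) ((2 * sin (pi / p%:R)) ^+ z)^-1).

Definition const_D alpha : R :=
  Num.max (\big[Num.max/0]_(1 <= tau < alpha) `|bern tau (0 : R)|)
    (sup [set `|bern_per alpha x| | x in `[0, 1[%classic]).

Definition const_E p n alpha : R :=
  p%:R ^+ (alpha * n) * (p%:R^-1 + (p%:R / (p%:R - 1)) ^+ (alpha * n)).

Definition richardson_weight p alpha (i : nat) : R :=
  \prod_(1 <= j < alpha - i) (- 1 / (p%:R ^+ j - 1))
  * \prod_(1 <= j < i.+1) (p%:R ^+ j / (p%:R ^+ j - 1)).

Definition const_V p n alpha t : R :=
  (alpha%:R / logb p 2) ^+ (alpha * n)
  * (p%:R ^+ t * const_A p alpha ^+ n * const_C p alpha ^+ n * const_E p n alpha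
     + (alpha%:R + 1) ^+ n * const_D alpha ^+ n)
  * \sum_(0 <= i < alpha) `|richardson_weight p alpha i|.

End Constants.

(** * Lebesgue measure on the unit cube *)

Section UnitCube.
Variable R : realType.

Definition cube_point (s : nat) := s.-tuple (measurableTypeR R).

Definition cube (s : nat) : set (cube_point s) :=
  [set x | forall j, 0 <= tnth x j < 1].

Definition cons_point (s : nat) (x : measurableTypeR R * cube_point s) : cube_point s.+1 :=
  [tuple of x.1 :: x.2].

Lemma measurable_cons_point (s : nat) : measurable_fun setT (@cons_point s).
Proof. exact: measurable_cons. Qed.

HB.instance Definition _ (s : nat) :=
  isMeasurableFun.Build _ _ _ _ (@cons_point s) (@measurable_cons_point s).

(* The s-fold product of the uniform probability on [0, 1], i.e. s-dimensional
   Lebesgue measure restricted to the unit cube. *)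
Fixpoint cube_measure (s : nat) : probability (cube_point s) R :=
  if s is s'.+1 then
    distribution (uniform_prob (@ltr01 R) \x cube_measure s')%E (@cons_point s')
  else \d_([tuple] : cube_point 0).

End UnitCube.

(** * Weak mixed derivatives on the unit cube *)

Section WeakDerivatives.
Variables (R : realType) (s : nat).
Implicit Types (f g : cube_point R s -> R) (phi : 'rV[R]_s -> R).

Definition to_row (x : cube_point R s) : 'rV[R]_s := \row_j tnth x j.

Definition partials phi (l : seq 'I_s) : 'rV[R]_s -> R :=
  foldr (fun j psi => 'D_(delta_mx 0 j) psi) phi l.

Definition mixed_partial phi (beta : 'I_s -> nat) : 'rV[R]_s -> R :=
  partials phi (flatten [seq nseq (beta j) j | j <- enum 'I_s]).

(* phi is C^oo on R^s, with compact support inside the open cube ]0, 1[^s. *)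
Definition test_function phi : Prop :=
  (forall l x, differentiable (partials phi l) x) /\
  exists2 e : R, 0 < e &
    forall x : 'rV[R]_s, (exists j, x 0 j < e \/ 1 - e < x 0 j) -> phi x = 0.

(* Only the values of f on the cube matter; g is determined almost everywhere. *)
Definition weak_derivative (beta : 'I_s -> nat) f g : Prop :=
  [/\ (cube_measure R s).-integrable (@cube R s) (EFin \o f),
      (cube_measure R s).-integrable setT (EFin \o g) &
      forall phi, test_function phi ->
        \int[cube_measure R s]_(x in @cube R s)
           (f x * mixed_partial phi beta (to_row x))
        = (- 1) ^+ (\sum_j beta j)
          * \int[cube_measure R s]_x (g x * phi (to_row x))].

(* A chosen representative of f^(beta), and 0 if there is no such derivative. *)
Definition wderiv (beta : 'I_s -> nat) f : cube_point R s -> R :=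
  xget (fun=> 0) [set g | weak_derivative beta f g].

End WeakDerivatives.

(** * The space W_(s, alpha, q, r) *)

Section FunctionSpace.
Variables (R : realType) (s alpha : nat).
Implicit Types (f g : cube_point R s -> R) (u v : {set 'I_s}).
Implicit Types (beta : {ffun 'I_s -> 'I_alpha.+1}) (q r : \bar R).

(* For v \subset u, the beta with [deriv_index u v beta] are the orders
   (tau_(u \ v), alpha_v, 0) with tau in {1, ..., alpha}^(u \ v). *)
Definition deriv_index u v beta : bool :=
  [forall j, if j \in v then beta j == alpha :> nat
             else if j \in u then (0 < beta j)%N else beta j == 0%N :> nat].

Definition splice v (x y : cube_point R s) : cube_point R s :=
  [tuple if j \in v then tnth x j else tnth y j | j < s].

(* The integral of g over the coordinates outside v, as a function of x_v: the
   integrand is constant in y_v, and the cube has measure 1. *)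
Definition integrate_out v g (x : cube_point R s) : R :=
  \int[cube_measure R s]_y g (splice v x y).

(* The l^q norm of a finite family of non-negative extended reals. *)
Definition lnorm (q : \bar R) (I : finType) (P : pred I) (F : I -> \bar R) :
    \bar R :=
  match q with
  | q'%:E => ((\sum_(i | P i) F i `^ q') `^ q'^-1)%E
  | +oo%E => \big[maxe/0%E]_(i | P i) F i
  | -oo%E => 0%E
  end.

(* c^-1 * x with the convention 0 / 0 = 0. *)
Definition ediv0 (x : \bar R) (c : R) : \bar R :=
  if c == 0 then (if x == 0%E then 0%E else +oo%E) else (x * (c^-1)%:E)%E.

(* For finite q and r this is
   (\sum_u (gamma_u^-q \sum_(v, beta) `|...|_(L^q)^q)^(r/q))^(1/r). As the
   measure is a probability, the L^q norm over the whole cube of a function of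
   x_v is its L^q norm over [0, 1)^|v|. *)
Definition Wnorm q r (gamma : {set 'I_s} -> R) f : \bar R :=
  lnorm r xpredT (fun u : {set 'I_s} =>
    ediv0
      (lnorm q
        (fun vb : {set 'I_s} * {ffun 'I_s -> 'I_alpha.+1} =>
          (vb.1 \subset u) && deriv_index u vb.1 vb.2)
        (fun vb => Lnorm (cube_measure R s) q
          (EFin \o integrate_out vb.1 (wderiv (fun j => vb.2 j) f))))
      (gamma u)).

Definition component f u (x : cube_point R s) : R :=
  \sum_(v : {set 'I_s} | v \subset u) (- 1) ^+ (alpha.+1 * #|v|) *
  \sum_(beta : {ffun 'I_s -> 'I_alpha.+1} | deriv_index u v beta)
    (\prod_(j in u :\: v) bern (beta j) (tnth x j)) *
    \int[cube_measure R s]_y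
      (wderiv (fun j => beta j) f y
       * \prod_(j in v) bern_per alpha (tnth y j - tnth x j)).

(* The last clause selects, in each class of almost everywhere equal functions,
   the one given by the pointwise representation. *)
Definition in_W q r (gamma : {set 'I_s} -> R) f : Prop :=
  [/\ forall beta, exists g, weak_derivative (fun j => beta j) f g,
      (Wnorm q r gamma f < +oo)%E &
      forall x, cube x -> f x = \sum_(u : {set 'I_s}) component f u x].

End FunctionSpace.

(** * Digital nets *)

Definition digit (p k i : nat) : nat := ((k %/ p ^ i) %% p)%N.

Section DigitalNets.
Variables (R : realType) (p s : nat).

Section FixedPrecision.
Variables (n m : nat) (C : 'I_s -> 'M['F_p]_(n, m)).

Definition net_digits (h : nat) (j : 'I_s) : 'rV['F_p]_n :=
  (\row_(l < m) (digit p h l)%:R) *m (C j)^T.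

Definition net_point (h : nat) : cube_point R s :=
  [tuple \sum_(i < n) (net_digits h j 0 i : nat)%:R / p%:R ^+ i.+1 | j < s].

Definition dual_net : set ('I_s -> nat) :=
  [set k | \sum_j (C j)^T *m (\col_(i < n) (digit p (k j) i)%:R) = 0].

Definition net_average (f : cube_point R s -> R) : R :=
  (p ^ m)%:R^-1 * \sum_(h < p ^ m) f (net_point h).

End FixedPrecision.

(* A nonzero base-p digit in position c (counted from 1) forces c <= k. *)
Definition mu (alpha k : nat) : nat :=
  (\sum_(c <- take alpha (rev [seq c <- iota 1 k | digit p k c.-1 != 0%N])) c)%N.

Definition mu_vec (alpha : nat) (k : 'I_s -> nat) : nat :=
  (\sum_j mu alpha (k j))%N.

Definition order_digital_net (alpha t n m : nat) (C : 'I_s -> 'M['F_p]_(n, m)) :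
    Prop :=
  (t <= alpha * m)%N /\
  forall k, dual_net C k -> k <> (fun=> 0%N) ->
    (alpha * m - t < mu_vec alpha k)%N.

(* The first k rows of C; only used for k <= n. *)
Definition upper_rows (n m k : nat) (C : 'M['F_p]_(n, m)) : 'M['F_p]_(k, m) :=
  \matrix_(i, l) if insub (i : nat) is Some i' then C i' l else 0.

(* [richardson C f tau i] is J^(tau+1)_(m+i)(f). *)
Fixpoint richardson (n m : nat) (C : 'I_s -> 'M['F_p]_(n, m))
    (f : cube_point R s -> R) (tau i : nat) : R :=
  if tau is tau'.+1 then
    (p%:R ^+ tau * richardson C f tau' i.+1 - richardson C f tau' i)
    / (p%:R ^+ tau - 1)
  else net_average (fun j => upper_rows (m + i) (C j)) f.

End DigitalNets.

(* Main.v *)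
Require Import Defs.
From HB Require Import structures.
From mathcomp Require Import all_boot all_order all_algebra.
From mathcomp Require Import all_classical all_reals all_analysis.
From mathcomp Require Import measurable_realfun ess_sup_inf complex ring lra zify.

(** Every f in the space is a combination of integrals of its weak derivatives
  against products of Bernoulli kernels, so the error is a combination, over the
  triples (u, v, beta) with u nonempty, of \int g(y) J(K_y) dy, where K_y is such
  a kernel and J the extrapolated rule. Only the coordinates y_v enter K_y, so each
  of these integrals is at most sup_y |J(K_y)| times gamma_u.

  To bound J(K_y), each net average is expanded over the dual net into products of
  one-dimensional Walsh coefficients. A Walsh coefficient is an iterated weighted
  mean of its function over the digits; if the function has a bounded derivative of
  order alpha, every one of the (at most alpha) most significant nonzero digits
  gains a factor p^-c, so that the coefficient is O(p^-mu_alpha(k)). Peeling off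
  digits shows that a box of digit vectors of total weight w contains at most
  p^(w - (alpha m - t)) dual vectors, and summing over the top digits yields
  p^(t - alpha m) times a power of m. The k = 0 terms are geometric in the
  precision n; Richardson extrapolation removes those decaying slower than
  p^(- alpha n). *)

Set Implicit Arguments.
Unset Strict Implicit.
Unset Printing Implicit Defensive.

Import Order.TTheory GRing.Theory Num.Theory.
Import numFieldNormedType.Exports.

Local Open Scope classical_set_scope.
Local Open Scope ring_scope.

Local Arguments Normc.normc : simpl never.
Local Arguments real_complex_def : simpl never.

(** * Bernoulli polynomials *)

(** The obstacle is the kink of the periodic kernel: x |-> [bern_per a (y - x)] has bounded iterated
    differences only up to order a - 1, while a digits have to gain a factor. Away from x = y the
    kernel is piecewise polynomial, and among the p subintervals belonging to a digit at most one
    carries the kink; the weight 1/p of that subinterval supplies the missing order. Regularity is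
    therefore measured by differences, which need no derivative at the kink.

    Everything stays finite: a net of precision n evaluates functions only on the grid of mesh p^-n,
    where the Walsh expansion is an exact sum over digit vectors of length n, so no convergence
    question arises. For k = 0 the multiplication theorem of Bernoulli polynomials gives the grid
    mean in closed form.

    The estimates produce constants of their own: p/4 per nonzero digit, 3 per coordinate, (a +
    1)^|u| for the number of kernels. They are compared with A, C, E and the logarithm only at the
    end, with L = log_2 N as the common unit. *)

Section BernoulliPolynomials.
Variable R : realType.
Implicit Types (n k M : nat) (x y : R).

(* Locked, so that no conversion test unfolds the recursion of bernoulli_poly. *)
Definition bernp n : {poly R} := locked (n`!%:R^-1 *: bernoulli_poly R n).

Lemma bernE n x : bern n x = (bernp n).[x].
Proof. by rewrite /bern /bernp -lock hornerZ mulrC. Qed.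

Lemma factR_neq0 n : n`!%:R != 0 :> R.
Proof. by rewrite pnatr_eq0 -lt0n fact_gt0. Qed.

Let fact_1 : 1`! = 1%N. Proof. by []. Qed.

Lemma size_bernoulli_seq n : size (bernoulli_seq R n) = n.
Proof. by elim: n => //= n IHn; rewrite size_rcons IHn. Qed.

Lemma nth_bernoulli_seq n k : (k < n)%N -> (bernoulli_seq R n)`_k = bernoulli_poly R k.
Proof.
elim: n => // n IHn; rewrite ltnS leq_eqVlt => /predU1P[->//|kn].
by rewrite /= nth_rcons size_bernoulli_seq kn IHn.
Qed.

Lemma bernoulli_sum n :
  \sum_(k < n.+1) 'C(n.+1, k)%:R *: bernoulli_poly R k = n.+1%:R *: 'X^n.
Proof.
rewrite big_ord_recr /= binSn [X in _ + _ *: X]/bernoulli_poly /=.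
rewrite nth_rcons size_bernoulli_seq ltnn eqxx scalerBr scalerA divff ?pnatr_eq0//.
rewrite scale1r addrCA (eq_bigr (fun k : 'I_n =>
  'C(n.+1, k)%:R *: (bernoulli_seq R n)`_k)) ?subrr ?addr0//.
by move=> i _; rewrite nth_bernoulli_seq.
Qed.

(** In generating functions: e^z - 1 times the series of all [bernp k] z^k is z e^(xz). The
    normalisation by 1/k! turns binomial coefficients into inverse factorials, the form that
    Taylor's formula produces. *)
Lemma bernp_sum n :
  \sum_(k < n.+1) (n.+1 - k)`!%:R^-1 *: bernp k = n`!%:R^-1 *: 'X^n.
Proof.
have := congr1 (fun q => (n.+1)`!%:R^-1 *: q) (bernoulli_sum n).
have -> : (n.+1)`!%:R^-1 *: (n.+1%:R *: 'X^n) = n`!%:R^-1 *: 'X^n :> {poly R}.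
  rewrite scalerA factS natrM; congr (_ *: _); have := factR_neq0 n => h.
  by field; rewrite h nat1r pnatr_eq0.
rewrite scaler_sumr => <-; apply: eq_bigr => k _; rewrite /bernp -lock !scalerA; congr (_ *: _).
rewrite -(@bin_fact n.+1 k) 1?ltnW// !natrM.
have : 'C(n.+1, k)%:R != 0 :> R by rewrite pnatr_eq0 -lt0n bin_gt0 ltnW.
have := factR_neq0 k; have := factR_neq0 (n.+1 - k) => h1 h2 h3.
by field; rewrite h1 h2 h3.
Qed.

Lemma bernp0 : bernp 0 = 1.
Proof.
by have := bernp_sum 0; rewrite big_ord1 subn0 fact0 fact_1 invr1 !scale1r expr0.
Qed.

(** The differentiated identity of order n + 1 and the identity of order n are the same triangular
    system; by induction their terms agree except the last, which is thereby determined. *)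
Lemma deriv_bernp n : (bernp n.+1)^`() = bernp n.
Proof.
elim/ltn_ind: n => n IHn.
have E1 := congr1 (@deriv R) (bernp_sum n.+1).
have F : (n.+1)`!%:R^-1 * n.+1%:R = n`!%:R^-1 :> R.
  by rewrite factS natrM; have := factR_neq0 n => h; field; rewrite h nat1r pnatr_eq0.
have E2 : ((n.+1)`!%:R^-1 *: 'X^(n.+1) : {poly R})^`() = n`!%:R^-1 *: 'X^n.
  by rewrite derivZ derivXn -[_ *+ n.+1]scaler_nat scalerA F.
rewrite E2 -bernp_sum raddf_sum/= big_ord_recl in E1.
rewrite derivZ bernp0 derivC scaler0 add0r in E1.
move: E1; rewrite !big_ord_recr /= !derivZ.
rewrite (eq_bigr (fun i : 'I_n => (n.+1 - i)`!%:R^-1 *: bernp i)); last first.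
  by move=> i _; rewrite derivZ /bump /= add1n subSS IHn.
by rewrite /bump /= add1n !subSS subSnn fact_1 invr1 !scale1r => /addrI.
Qed.

Lemma derivn_bernp n k : (bernp n)^`(k) = if (k <= n)%N then bernp (n - k) else 0.
Proof.
elim: k n => [|k IHk] n; first by rewrite subn0.
rewrite derivSn; case: n => [|n]; first by rewrite bernp0 derivC linear0.
by rewrite deriv_bernp IHk ltnS subSS.
Qed.

Lemma size_bernp n : (size (bernp n) <= n.+1)%N.
Proof.
elim/ltn_ind: n => n IHn.
have := bernp_sum n; rewrite big_ord_recr /= subSnn fact_1 invr1 scale1r addrC.
move=> /(canRL (addrK _)) ->; rewrite (leq_trans (size_polyD _ _))// geq_max.
rewrite (leq_trans (size_scale_leq _ _)) ?size_polyXn//= size_polyN.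
apply: (leq_trans (size_sum _ _ _)); apply/bigmax_leqP => i _.
apply: (leq_trans (size_scale_leq _ _)); apply: (leq_trans (IHn i _)) => //.
by rewrite ltnS ltnW.
Qed.

(** The derivatives being Bernoulli polynomials again, the Taylor expansion at x with increment 1,
    less its constant term, is the left side of [bernp_sum]. *)
Lemma bernp_diff n x : (bernp n.+1).[x + 1] - (bernp n.+1).[x] = x ^+ n / n`!%:R.
Proof.
rewrite (nderiv_taylor_wide _ (size_bernp _)); last exact: mulrC.
have T i : (bernp n.+1)^`N(i).[x] =
    (bernp n.+1)^`(i).[x] / i`!%:R.
  by rewrite nderivn_def hornerMn -mulr_natr mulfK ?factR_neq0.
rewrite big_ord_recl expr0 mulr1 T fact0 divr1 addrC addKr.
have := congr1 (fun q => q.[x]) (bernp_sum n).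
rewrite hornerZ hornerXn mulrC => <-.
rewrite horner_sum (reindex_inj rev_ord_inj) /=; apply: eq_bigr => i _.
rewrite T expr1n mulr1 hornerZ mulrC derivn_bernp /bump /= add1n.
have in1 : (i <= n)%N by rewrite -ltnS.
by rewrite (subSS i n) ltnS leq_subr -subSn// subKn// ltnW.
Qed.

Lemma bernp_periodic_end n : (2 <= n)%N -> (bernp n).[1] = (bernp n).[0].
Proof.
case: n => [|[|n]]// _; apply/eqP; rewrite -subr_eq0 -[1]add0r bernp_diff.
by rewrite expr0n mul0r.
Qed.

Lemma periodic_poly_const (q : {poly R}) :
  (forall x, q.[x + 1] = q.[x]) -> q = (q.[0])%:P.
Proof.
move=> qper; have qn k : q.[k%:R] = q.[0].
  by elim: k => [|k IHk]; rewrite ?mulr0n// -addn1 natrD qper IHk.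
pose d := q - (q.[0])%:P.
suff /eqP : d = 0 by rewrite subr_eq0 => /eqP.
pose s := [seq (k%:R : R) | k <- iota 0 (size d).+1].
apply: (@roots_geq_poly_eq0 _ _ s).
- by apply/allP => _ /mapP[k _ ->]; rewrite /root !hornerE qn subrr.
- by rewrite map_inj_uniq ?iota_uniq// => a b /eqP; rewrite eqr_nat => /eqP.
- by rewrite size_map size_iota.
Qed.

(** Raabe's multiplication theorem. [P k] and [bernp k] obey the same derivative rule, and
    [P k.+1 - bernp k.+1] is 1-periodic, hence a constant polynomial. Differentiating it gives
    equality at k, so no constant of integration has to be found. *)
Lemma bernp_mult n M x : (0 < M)%N ->
  \sum_(a < M) (bernp n).[(x + a%:R) / M%:R] = M%:R / M%:R ^+ n * (bernp n).[x].
Proof.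
move=> M0; have M0' : M%:R != 0 :> R by rewrite pnatr_eq0 -lt0n.
pose P k : {poly R} := (M%:R ^+ k / M%:R) *:
  \sum_(a < M) (bernp k \Po (M%:R^-1 *: ('X + a%:R%:P))).
have PE k y : (P k).[y] = M%:R ^+ k / M%:R * \sum_(a < M) (bernp k).[(y + a%:R) / M%:R].
  rewrite hornerZ horner_sum; congr (_ * _); apply: eq_bigr => a _.
  by rewrite horner_comp !hornerE mulrC.
have dP k : (P k.+1)^`() = P k.
  rewrite /P derivZ raddf_sum /= scaler_sumr scaler_sumr; apply: eq_bigr => a _.
  rewrite deriv_comp deriv_bernp derivZ derivD derivX derivC addr0.
  rewrite -scalerAr mulr1 scalerA; congr (_ *: _).
  by rewrite exprS; field.
have key k : P k = bernp k.
  suff per y : (P k.+1 - bernp k.+1).[y + 1] = (P k.+1 - bernp k.+1).[y].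
    have /(congr1 (@deriv R)) := periodic_poly_const per.
    by rewrite derivC derivB dP deriv_bernp => /eqP; rewrite subr_eq0 => /eqP.
  suff : (P k.+1).[y + 1] - (P k.+1).[y] = (bernp k.+1).[y + 1] - (bernp k.+1).[y].
    by rewrite !hornerE; lra.
  rewrite bernp_diff !PE -mulrBr.
  case: M M0 M0' {P PE dP} => // M _ M0.
  rewrite big_ord_recr /= [X in _ - X]big_ord_recl /=.
  rewrite (eq_bigr (fun a : 'I_M => (bernp k.+1).[(y + (bump 0 a)%:R) / M.+1%:R])).
    have e1 : (y + 1 + M%:R) / M.+1%:R = y / M.+1%:R + 1.
      by rewrite -addrA nat1r mulrDl divff.
    have e2 := bernp_diff k (y / M.+1%:R).
    rewrite addr0 e1; set S := \sum_(i < M) _; set A := _.[y / _ + 1]; set B := _.[_].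
    have -> : S + A - (B + S) = A - B by ring.
    have Mk : (M.+1%:R ^+ k : R) != 0 by rewrite expf_neq0.
    rewrite e2 expr_div_n exprS; field.
    by rewrite factR_neq0 Mk nat1r M0.
  by move=> a _; rewrite -addrA [1 + _]addrC /bump /= add1n natr1.
rewrite -{2}(key n) PE mulrA.
have -> : M%:R / M%:R ^+ n * (M%:R ^+ n / M%:R) = 1 :> R.
  by rewrite mulrA divfK ?divff// expf_neq0.
by rewrite mul1r.
Qed.

End BernoulliPolynomials.

(** * Uniform bounds for Bernoulli polynomials, and the kink function *)

Section BernoulliBounds.
Variable R : realType.
Implicit Types (n r : nat) (x y h b L : R).

Lemma is_derive_horner (P : {poly R}) x : is_derive x 1 (horner P) P^`().[x].
Proof.
apply: DeriveDef; first exact: derivable_horner.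
by rewrite -derive1E derivE.
Qed.

Lemma MVT_bound (phi dphi : R -> R) x h L : 0 <= h ->
  (forall z, is_derive z (1 : R) phi (dphi z)) ->
  (forall z, x <= z <= x + h -> `|dphi z| <= L) -> `|phi (x + h) - phi x| <= L * h.
Proof.
move=> h0 dp bd; have xh : x <= x + h by rewrite lerDl.
have cphi : {within `[x, x + h], continuous phi}.
  apply: derivable_within_continuous => z _; exact: ex_derive.
have [c cin ->] := MVT_segment xh (fun z _ => dp z) cphi.
rewrite addrAC subrr add0r normrM (ger0_norm h0) ler_wpM2r//; apply: bd.
by move: cin; rewrite in_itv.
Qed.

(** By Rolle for [bernp n.+2], whose end values agree, [bernp n.+1] has a zero in the open unit
    interval; its derivative is at most 1 by induction, and so is the distance to that zero. *)
Lemma bernp_le1 n x : 0 <= x <= 1 -> `|(bernp R n).[x]| <= 1.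
Proof.
elim: n x => [|n IHn] x /andP[x0 x1]; first by rewrite bernp0 hornerC normr1.
have [c] : exists2 c, c \in `]0, 1[%R & (bernp R n.+1).[c] = 0.
  have d1 z : z \in `](0 : R), 1[%R -> is_derive z (1 : R) (horner (bernp R n.+2)) (bernp R n.+1).[z].
    by move=> _; rewrite -[bernp R n.+1]deriv_bernp; exact: is_derive_horner.
  have [|c cin E] := MVT ltr01 d1.
    by apply: derivable_within_continuous => z _; exact: derivable_horner.
  by exists c => //; move: E; rewrite bernp_periodic_end// subrr subr0 mulr1.
rewrite in_itv /= => /andP[c0 c1] bc0.
have dB z : is_derive z (1 : R) (horner (bernp R n.+1)) (bernp R n).[z].
  by rewrite -[bernp R n]deriv_bernp; exact: is_derive_horner.
have [xc|cx] := leP x c.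
  have := @MVT_bound _ _ x (c - x) 1 _ dB; rewrite subrKC bc0 sub0r normrN subr_ge0 mul1r.
  move=> /(_ xc); have cx1 : c - x <= 1 by lra.
  move=> H; apply: le_trans cx1; apply: H => z /andP[xz zc]; apply: IHn; lra.
have := @MVT_bound _ _ c (x - c) 1 _ dB; rewrite subrKC bc0 subr0 subr_ge0 mul1r.
move=> /(_ (ltW cx)); have cx1 : x - c <= 1 by lra.
move=> H; apply: le_trans cx1; apply: H => z /andP[xz zc]; apply: IHn; lra.
Qed.

(** Meant for [|x| * x] at the origin, where the product rule fails because [|x|] is not
    differentiable. *)
Lemma is_derive_quadratic (f : R -> R) x d :
  (forall h, `|f (x + h) - f x - d * h| <= h ^+ 2) -> is_derive x 1 f d.
Proof.
move=> quad; suff cv : (fun h => h^-1 *: ((f \o shift x) h%:A - f x)) @ 0^' --> d.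
  by apply: DeriveDef; [apply/cvg_ex; exists d|exact: cvg_lim].
apply/cvgrPdist_le => /= e e0; near=> h.
have h0 : h != 0 by near: h; exact: nbhs_dnbhs_neq.
have he : `|h| <= e.
  near: h; apply: dnbhs0_le => //.
rewrite /= /shift /= [h%:A]mulr1 [h + x]addrC.
have -> : d - h^-1 *: (f (x + h) - f x) = - (h^-1 * (f (x + h) - f x - d * h)).
  by rewrite /GRing.scale /=; field.
rewrite normrN normrM normfV ler_pdivrMl ?normr_gt0//.
apply: le_trans (quad h) _; rewrite -real_normK ?num_real// expr2.
by rewrite ler_wpM2l.
Unshelve. all: by end_near. Qed.

(** Half the sign of x - y, integrated e + 1 times from y; on each side of y it is a polynomial of
    degree e + 1. *)
Definition kink (e : nat) y x : R := `|x - y| * (x - y) ^+ e / (2 * (e.+1)`!%:R).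

Lemma norm_sq_quadratic x h :
  `| `|x + h| * (x + h) - `|x| * x - 2 * `|x| * h| <= h ^+ 2.
Proof.
have [x0|x0] := ger0P x; have [xh|xh] := ger0P (x + h); rewrite ler_norml; apply/andP; split; nra.
Qed.

Lemma is_derive_kink e y x : is_derive x 1 (kink e.+1 y) (kink e y x).
Proof.
have d0 : is_derive x 1 (fun z => `|z - y| * (z - y)) (2 * `|x - y|).
  apply: is_derive_quadratic => h.
  have -> : x + h - y = x - y + h by ring.
  exact: norm_sq_quadratic.
have dE : is_derive x 1 (fun z => `|z - y| * (z - y) ^+ e.+1)
    (e.+2%:R * (`|x - y| * (x - y) ^+ e)).
  elim: e => [|e IHe].
    by rewrite expr0 mulr1; exact: d0.
  have -> : (fun z => `|z - y| * (z - y) ^+ e.+2) =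
    (fun z => (z - y)) * (fun z => `|z - y| * (z - y) ^+ e.+1).
    by apply/funext => z /=; rewrite -[RHS]/((z - y) * _) exprS mulrCA.
  apply: is_derive_eq.
  rewrite /= ?scaler1 /GRing.scale /= subr0 -[e.+3%:R]natr1 exprS; ring.
have -> : kink e.+1 y = (2 * (e.+2)`!%:R)^-1 *: (fun z => `|z - y| * (z - y) ^+ e.+1).
  by apply/funext => z /=; rewrite /kink mulrC.
apply: is_derive_eq; rewrite /kink /GRing.scale /= factS natrM; have := factR_neq0 R e.+1 => h.
by field; rewrite h -natrD pnatr_eq0.
Qed.

End BernoulliBounds.

(** * Iterated differences of complex-valued functions *)

Section MixedDifferences.
Variable R : realType.
Implicit Types (phi psi : R -> R[i]) (r : nat) (a b c h x y L M : R).

Local Notation nc := (@Normc.normc R).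
Local Notation toC := (real_complex R).

Lemma nc_real x : nc (toC x) = `|x|.
Proof. by rewrite /Normc.normc /real_complex_def expr0n /= addr0 sqrtr_sqr. Qed.

Lemma nc0 : nc 0 = 0.
Proof. by rewrite -[0 in LHS](rmorph0 toC) nc_real normr0. Qed.

Lemma nc1 : nc 1 = 1.
Proof. by rewrite -[1 in LHS](rmorph1 toC) nc_real normr1. Qed.

Lemma nc_ge0 z : 0 <= nc z.
Proof. by case: z => u v; exact: sqrtr_ge0. Qed.

Lemma nc_sum (I : Type) (s : seq I) (P : pred I) (F : I -> R[i]) :
  nc (\sum_(i <- s | P i) F i) <= \sum_(i <- s | P i) nc (F i).
Proof.
elim/big_rec2: _ => [|i y z _ IH]; first by rewrite nc0.
by rewrite (le_trans (le_normcD _ _))// lerD2l.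
Qed.

Lemma nc_prod (I : Type) (s : seq I) (P : pred I) (F : I -> R[i]) :
  nc (\prod_(i <- s | P i) F i) = \prod_(i <- s | P i) nc (F i).
Proof. by elim/big_rec2: _ => [|i y z _ <-]; rewrite ?nc1 ?Normc.normcM. Qed.

(* All the r-fold differences of phi with nonnegative steps h_1, ..., h_r that
   stay inside [0, b] are at most L * h_1 * ... * h_r. *)
Fixpoint diff_bounded (r : nat) (L b : R) (phi : R -> R[i]) : Prop :=
  if r is r'.+1 then
    forall h, 0 <= h <= b -> diff_bounded r' (L * h) (b - h) (fun x => phi (x + h) - phi x)
  else forall x, 0 <= x <= b -> nc (phi x) <= L.

Lemma diff_bounded_eq r L b phi psi : (forall x, 0 <= x <= b -> phi x = psi x) ->
  diff_bounded r L b phi -> diff_bounded r L b psi.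
Proof.
elim: r L b phi psi => [|r IHr] L b phi psi E /= D.
  by move=> x xb; rewrite -E//; exact: D.
move=> h hb; apply: IHr (D h hb) => x xb; rewrite !E//; lra.
Qed.

Lemma diff_bounded_le r L M b phi : L <= M -> diff_bounded r L b phi -> diff_bounded r M b phi.
Proof.
elim: r L M b phi => [|r IHr] L M b phi LM /= D.
  by move=> x xb; exact: le_trans (D x xb) LM.
move=> h hb; apply: IHr (D h hb); rewrite ler_wpM2r//; lra.
Qed.

Lemma diff_boundedD r L M b phi psi : diff_bounded r L b phi -> diff_bounded r M b psi ->
  diff_bounded r (L + M) b (fun x => phi x + psi x).
Proof.
elim: r L M b phi psi => [|r IHr] L M b phi psi /= D1 D2.
  by move=> x xb; apply: le_trans (le_normcD _ _) _; exact: lerD (D1 x xb) (D2 x xb).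
move=> h hb; rewrite mulrDl; apply: diff_bounded_eq (IHr _ _ _ _ _ (D1 h hb) (D2 h hb)).
by move=> x _; ring.
Qed.

Lemma diff_boundedZ r L b (z : R[i]) phi : diff_bounded r L b phi ->
  diff_bounded r (nc z * L) b (fun x => z * phi x).
Proof.
elim: r L b phi => [|r IHr] L b phi /= D.
  by move=> x xb; rewrite Normc.normcM ler_wpM2l ?nc_ge0//; exact: D.
move=> h hb; rewrite -mulrA; apply: diff_bounded_eq (IHr _ _ _ (D h hb)).
by move=> x _; ring.
Qed.

Lemma diff_bounded0 r b : diff_bounded r 0 b (fun=> 0).
Proof.
elim: r b => [|r IHr] b /=; first by move=> x _; rewrite nc0.
by move=> h hb; rewrite mul0r; apply: diff_bounded_eq (IHr _) => x _; rewrite subrr.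
Qed.

Lemma diff_bounded_sum r b (I : Type) (s : seq I) (L : I -> R) (phi : I -> R -> R[i]) :
  (forall i, diff_bounded r (L i) b (phi i)) ->
  diff_bounded r (\sum_(i <- s) L i) b (fun x => \sum_(i <- s) phi i x).
Proof.
move=> D; elim: s => [|i s IHs].
  by rewrite big_nil; apply: diff_bounded_eq (diff_bounded0 _ _) => x _; rewrite big_nil.
rewrite big_cons; apply: diff_bounded_eq (diff_boundedD (D i) IHs) => x _.
by rewrite big_cons.
Qed.

Lemma diff_bounded_affine r L b b' a c phi : 0 <= a -> 0 <= c -> a + c * b' <= b ->
  diff_bounded r L b phi -> diff_bounded r (L * c ^+ r) b' (fun x => phi (a + c * x)).
Proof.
move=> a0 c0; elim: r L b b' phi => [|r IHr] L b b' phi ab /= D.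
  by move=> x /andP[x0 xb]; rewrite expr0 mulr1; apply: D; nra.
move=> h /andP[h0 hb]; have hb' : 0 <= c * h <= b by nra.
have ab' : a + c * (b' - h) <= b - c * h by nra.
have -> : L * c ^+ r.+1 * h = L * (c * h) * c ^+ r by rewrite exprS; ring.
apply: diff_bounded_eq (IHr _ _ _ _ ab' (D _ hb')) => x _.
by congr (phi _ - _); ring.
Qed.

(** Here an order is traded for a factor: comparing two translates consumes one difference and gains
    the distance between them. *)
Lemma diff_bounded_shift r L b b' a a' phi : 0 <= a -> 0 <= a' -> 0 <= b' ->
    a + b' <= b -> a' + b' <= b -> diff_bounded r.+1 L b phi ->
  diff_bounded r (L * `|a' - a|) b' (fun x => phi (a' + x) - phi (a + x)).
Proof.
move=> + + b'0; wlog aa' : a a' / a <= a'.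
  move=> H a0 a'0 ab a'b D; have [/H|/ltW/H H'] := leP a a'; first exact.
  rewrite distrC; have := diff_boundedZ (-1) (H' a'0 a0 a'b ab D).
  rewrite normcN nc1 mul1r; apply: diff_bounded_eq => x _; ring.
move=> a0 a'0 ab a'b /(_ (a' - a)) D; rewrite ger0_norm ?subr_ge0//.
have h1 : 0 <= a' - a <= b by lra.
have h2 : a + 1 * b' <= b - (a' - a) by lra.
have := diff_bounded_affine a0 ler01 h2 (D h1); rewrite expr1n mulr1.
by apply: diff_bounded_eq => x _; congr (phi _ - phi _); ring.
Qed.

(** Differences commute with differentiation, so the mean value theorem is needed only for a single
    difference, at the bottom of the induction. *)
Lemma diff_bounded_derive r L b (phi dphi : R -> R) :
  (forall x, is_derive x (1 : R) phi (dphi x)) ->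
  diff_bounded r L b (toC \o dphi) -> diff_bounded r.+1 L b (toC \o phi).
Proof.
elim: r L b phi dphi => [|r IHr] L b phi dphi dE D.
  move=> h /andP[h0 hb] x /andP[x0 xb] /=; rewrite -rmorphB nc_real.
  apply: MVT_bound dE _ => // z /andP[xz zx]; rewrite -nc_real; apply: D; lra.
move=> h hb; have dE' x : is_derive x (1 : R) (fun z => phi (z + h) - phi z) (dphi (x + h) - dphi x).
  apply: is_deriveB; have := @is_derive1_comp _ phi (shift h) x _ _ (dE (x + h)) (is_derive_shift x 1 h).
  by rewrite mulr1.
apply: diff_bounded_eq (IHr _ _ _ _ dE' _) => [x _|]; first by rewrite /= rmorphB.
by apply: diff_bounded_eq (D h hb) => x _; rewrite /= rmorphB.
Qed.

Lemma diff_bounded_poly r L b (P : {poly R}) :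
  (forall x, 0 <= x <= b -> `|P^`(r).[x]| <= L) -> diff_bounded r L b (fun x => toC P.[x]).
Proof.
elim: r P => [|r IHr] P H; first by move=> x xb; rewrite nc_real; exact: H.
apply: (@diff_bounded_derive _ _ _ (horner P) (horner P^`()) (is_derive_horner P)).
by apply: IHr => x xb; rewrite -derivSn; exact: H.
Qed.

(** Each derivative lowers e by one; at e = 0 there remains |x - y| / 2, which is Lipschitz and
    yields the last order. *)
Lemma diff_bounded_kink r e y : 0 <= y <= 1 -> (r <= e.+1)%N ->
  diff_bounded r 2^-1 1 (toC \o kink e y).
Proof.
move=> y01; elim: r e => [|r IHr] e re.
  move=> x x01 /=; rewrite nc_real /kink normrM.
  have f1 : (1 : R) <= (e.+1)`!%:R by rewrite ler1n fact_gt0.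
  have n1 : `|x - y| <= 1 by rewrite ler_norml; lra.
  rewrite normrM normrX normr_id -exprS [X in _ * X]ger0_norm; last first.
    by rewrite invr_ge0 mulr_ge0.
  rewrite ler_pdivrMr ?mulr_gt0 ?ltr0n ?fact_gt0//.
  by apply: le_trans (exprn_ile1 _ _ n1) _ => //; lra.
case: e re => [|e] re; last first.
  apply: (@diff_bounded_derive _ _ _ (kink e.+1 y) (kink e y)); last exact: IHr.
  exact: is_derive_kink.
case: r {IHr} re => // _ h /andP[h0 h1] x /andP[x0 xh] /=.
rewrite -rmorphB nc_real /kink !expr0 !mulr1.
rewrite -mulrBl normrM mulrC [X in X * _]ger0_norm ?invr_ge0 ?mulr_ge0//.
apply: ler_pM => //.
rewrite -[leRHS](ger0_norm h0) (le_trans (ler_dist_dist _ _))//.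
by have -> : x + h - y - (x - y) = h by ring.
Qed.

End MixedDifferences.

(** * Walsh coefficients *)

Section Walsh.
Variables (R : realType) (p : nat) (om : R[i]).
Hypotheses (p_prime : prime p) (omX : om ^+ p = 1) (om_neq1 : om != 1).

Local Notation nc := (@Normc.normc R).
Local Notation toC := (real_complex R).
Local Notation F := 'F_p.
Implicit Types (phi psi : R -> R[i]) (ks ds : seq F) (k : F).

Let p_gt0 : (0 < p)%N := prime_gt0 p_prime.

Let pR_gt0 : 0 < p%:R :> R. Proof. by rewrite ltr0n. Qed.

Let pR_neq0 : p%:R != 0 :> R. Proof. by rewrite gt_eqF. Qed.

Let omX' : om ^+ (Zp_trunc (pdiv p)).+2 = 1. Proof. by rewrite Fp_cast. Qed.

Definition chi (a : F) : R[i] := om ^+ (a : nat).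

Lemma chi0 : chi 0 = 1.
Proof. by []. Qed.

Lemma chiD (a b : F) : chi (a + b) = chi a * chi b.
Proof. by rewrite /chi /= (expr_mod _ omX') exprD. Qed.

Lemma chiM (a b : F) : chi (a * b) = chi a ^+ (b : nat).
Proof. by rewrite /chi /= (expr_mod _ omX') exprM. Qed.

Lemma chi_sum (I : Type) (s : seq I) (P : pred I) (f : I -> F) :
  chi (\sum_(i <- s | P i) f i) = \prod_(i <- s | P i) chi (f i).
Proof. exact: (big_morph chi chiD chi0). Qed.

Lemma nc_om : nc om = 1.
Proof.
have ncX n : nc (om ^+ n) = nc om ^+ n.
  by elim: n => [|n IHn]; rewrite ?expr0 ?nc1// !exprS Normc.normcM IHn.
have := ncX p; rewrite omX nc1 => /esym/eqP.
by rewrite pexpr_eq1 ?nc_ge0// => /eqP.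
Qed.

Lemma nc_chi a : nc (chi a) = 1.
Proof.
rewrite /chi; elim: (a : nat) => [|n IHn]; first by rewrite expr0 nc1.
by rewrite exprS Normc.normcM IHn nc_om mulr1.
Qed.

(** The power of [chi k] with exponent k^-1 is [om]. As p is prime, any p-th root of unity other
    than 1 thus gives a nontrivial character for every nonzero k. *)
Lemma chi_neq1 k : k != 0 -> chi k != 1.
Proof.
move=> k0; apply: contra om_neq1 => /eqP k1.
have := chiM k k^-1; rewrite divff// k1 expr1n /chi => <-.
by rewrite -[om in X in X == _]expr1; apply/eqP; congr (om ^+ _); rewrite /= Fp_cast// modn_small// prime_gt1.
Qed.

Lemma sum_chi k : k != 0 -> \sum_(a : F) chi (k * a) = 0.
Proof.
move=> k0; have k1 := chi_neq1 k0; set S := \sum_a _.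
have : (chi k - 1) * S = 0.
  rewrite mulrBl mul1r; apply/eqP; rewrite subr_eq0; apply/eqP.
  rewrite /S [RHS](reindex_inj (addrI 1)) /= big_distrr /=; apply: eq_bigr => a _.
  by rewrite mulrDr mulr1 chiD.
by move/eqP; rewrite mulf_eq0 subr_eq0 (negPf k1) => /eqP.
Qed.

Lemma sum_Fp (V : nmodType) (f : nat -> V) : \sum_(a : F) f a = \sum_(i < p) f i.
Proof. by rewrite -!(big_mkord xpredT f) Fp_cast. Qed.

(* The digit recursion phi |-> \int chi(- k xi_1(x)) phi: it averages phi over
   the p intervals of length 1/p, rescaled to the unit interval. *)
Definition digit_avg k phi : R -> R[i] := fun x =>
  toC p%:R^-1 * \sum_(xi : F) chi (- (k * xi)) * phi (((xi : nat)%:R + x) / p%:R).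

(* For digits [k_1; ...; k_n], the mean of phi(x) times the conjugate of the
   k-th Walsh function over the grid of mesh p^-n. *)
Fixpoint walsh_coef ks phi : R[i] :=
  if ks is k :: ks' then walsh_coef ks' (digit_avg k phi) else phi 0.

Fixpoint digits_point ds : R :=
  if ds is d :: ds' then ((d : nat)%:R + digits_point ds') / p%:R else 0.

Fixpoint digits_dot ks ds : F :=
  match ks, ds with k :: ks', d :: ds' => k * d + digits_dot ks' ds' | _, _ => 0 end.

Lemma Fp_ltn (a : F) : (a < p)%N.
Proof. by rewrite -[X in (_ < X)%N](Fp_cast p_prime). Qed.

Lemma digits_point_itv ds : 0 <= digits_point ds < 1.
Proof.
elim: ds => [|d ds /andP[IH0 IH1]] /=; first by rewrite lexx ltr01.
have : (d : nat)%:R + 1 <= p%:R :> R by rewrite natr1 ler_nat Fp_ltn.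
by rewrite divr_ge0 ?addr_ge0// ltr_pdivrMr// mul1r; lra.
Qed.

Lemma big_tuple_cons (T : finType) n (V : nmodType) (f : n.+1.-tuple T -> V) :
  \sum_t f t = \sum_x \sum_(t : n.-tuple T) f [tuple of x :: t].
Proof.
rewrite pair_big /= (reindex (fun u : T * n.-tuple T => [tuple of u.1 :: u.2])) //=.
exists (fun t => (thead t, [tuple of behead t])) => [[x t] _|t _] /=.
  by rewrite theadE; congr pair; apply: val_inj.
by rewrite -tuple_eta.
Qed.

(** Fourier inversion digit by digit: in the sum over the first k, orthogonality of characters
    leaves only the subinterval selected by the first digit d. *)
Lemma walsh_inversion n phi (ds : n.-tuple F) :
  \sum_(ks : n.-tuple F) chi (digits_dot ks ds) * walsh_coef ks phi = phi (digits_point ds).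
Proof.
elim: n phi ds => [|n IHn] phi ds.
  have -> : ds = [tuple] by exact: tuple0.
  rewrite (big_pred1 [tuple]) ?mul1r// => t; apply/esym/eqP; exact: tuple0.
case/tupleP: ds => d ds; rewrite big_tuple_cons /=.
under eq_bigr => k _ do (under eq_bigr => t _ do rewrite chiD -mulrA;
  rewrite -big_distrr /= IHn /digit_avg mulrCA big_distrr /=).
rewrite -big_distrr /= exchange_big /= (bigD1 d) //= [X in _ + X]big1 => [|xi xid].
  rewrite addr0; under eq_bigr => k _ do rewrite mulrA -chiD subrr mul1r.
  rewrite sumr_const card_Fp// -[phi _ *+ p]mulr_natl mulrA -(rmorph_nat toC).
  by rewrite -rmorphM mulVf// rmorph1 mul1r.
under eq_bigr => k _ do rewrite mulrA -chiD -mulrBr [k * _]mulrC.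
by rewrite -big_distrl /= sum_chi ?mul0r// subr_eq0 eq_sym.
Qed.

Lemma digit_avg_eq k phi psi : (forall x, 0 <= x <= 1 -> phi x = psi x) ->
  forall x, 0 <= x <= 1 -> digit_avg k phi x = digit_avg k psi x.
Proof.
move=> E x /andP[x0 x1]; congr (_ * _); apply: eq_bigr => xi _; congr (_ * _).
have : (xi : nat)%:R + 1 <= p%:R :> R by rewrite natr1 ler_nat Fp_ltn.
by move=> H; apply: E; rewrite divr_ge0 ?addr_ge0// ler_pdivrMr// mul1r; lra.
Qed.

Lemma walsh_coef_eq ks phi psi : (forall x, 0 <= x <= 1 -> phi x = psi x) ->
  walsh_coef ks phi = walsh_coef ks psi.
Proof.
elim: ks phi psi => [|k ks IHks] phi psi E /=; first by rewrite E ?lexx ?ler01.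
by apply: IHks; exact: digit_avg_eq.
Qed.

Lemma walsh_coefZ ks z phi : walsh_coef ks (fun x => z * phi x) = z * walsh_coef ks phi.
Proof.
elim: ks phi => //= k ks IHks phi; rewrite -IHks; apply: walsh_coef_eq => x _.
rewrite /digit_avg mulrCA; congr (_ * _); rewrite big_distrr /=.
by apply: eq_bigr => xi _; rewrite mulrCA.
Qed.

Lemma walsh_coef_sum ks (I : finType) (phi : I -> R -> R[i]) :
  walsh_coef ks (fun x => \sum_i phi i x) = \sum_i walsh_coef ks (phi i).
Proof.
elim: ks phi => //= k ks IHks phi; rewrite -IHks; apply: walsh_coef_eq => x _.
rewrite /digit_avg -big_distrr /= exchange_big /=; congr (_ * _).
by apply: eq_bigr => xi _; rewrite -big_distrr.
Qed.

Lemma walsh_coefD ks phi psi :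
  walsh_coef ks (fun x => phi x + psi x) = walsh_coef ks phi + walsh_coef ks psi.
Proof.
have := walsh_coef_sum ks (fun b : bool => if b then phi else psi).
by rewrite big_bool /= => <-; apply: walsh_coef_eq => x _; rewrite big_bool.
Qed.

Lemma nc_pinv : nc (toC p%:R^-1) = p%:R^-1.
Proof. by rewrite nc_real ger0_norm// invr_ge0 ltW. Qed.

Lemma digit_avg_bound k r (L : R) phi : diff_bounded r L 1 phi ->
  diff_bounded r (L / p%:R ^+ r) 1 (digit_avg k phi).
Proof.
move=> D; have -> : L / p%:R ^+ r = nc (toC p%:R^-1) * \sum_(xi : F) (L / p%:R ^+ r).
  rewrite nc_pinv sumr_const card_Fp// -[(L / p%:R ^+ r) *+ p]mulr_natr.
  have pr : (p%:R ^+ r : R) != 0 by rewrite expf_neq0.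
  by field; rewrite pR_neq0 pr.
apply: diff_boundedZ; apply: diff_bounded_sum => xi.
apply: (@diff_bounded_le _ _ (nc (chi (- (k * xi))) * (L / p%:R ^+ r))).
  by rewrite nc_chi mul1r.
apply: diff_boundedZ.
have xi1 : (xi : nat)%:R + 1 <= p%:R :> R by rewrite natr1 ler_nat Fp_ltn.
have h : (xi : nat)%:R / p%:R + p%:R^-1 * 1 <= 1 :> R.
  have -> : (xi : nat)%:R / p%:R + p%:R^-1 * 1 = ((xi : nat)%:R + 1) / p%:R :> R by ring.
  by rewrite ler_pdivrMr// mul1r.
have := diff_bounded_affine _ _ h D; rewrite exprVn => /(_ _ _) H.
apply: diff_bounded_eq (H _ _) => [x _||]; rewrite ?divr_ge0 ?invr_ge0 ?ler0n//.
by congr phi; rewrite mulrDl [x / _]mulrC.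
Qed.

(** Source of the constant p / 4: the middle index minimises the total distance. *)
Lemma sum_dist_half n : \sum_(i < n) `|i%:R - (n./2)%:R| <= n%:R ^+ 2 / 4 :> R.
Proof.
have low c j : (j <= c)%N ->
    \sum_(i < j) `|i%:R - c%:R| = j%:R * c%:R - j%:R * (j%:R - 1) / 2 :> R.
  elim: j => [|j IHj] jc; first by rewrite big_ord0; field.
  rewrite big_ord_recr /= IHj ?(ltnW jc)// ler0_norm ?subr_le0 ?ler_nat ?(ltnW jc)//.
  by rewrite -natr1; field.
have full c j : \sum_(i < c + j) `|i%:R - c%:R| =
    c%:R * (c%:R + 1) / 2 + j%:R * (j%:R - 1) / 2 :> R.
  elim: j => [|j IHj]; first by rewrite addn0 low//; field.
  have e : (c + j)%:R - c%:R = j%:R :> R by rewrite natrD addrC addKr.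
  rewrite addnS big_ord_recr /= IHj e ger0_norm//.
  by rewrite -natr1; field.
have E := odd_double_half n; set c := n./2 in E *.
have -> : n = (c + (c + odd n))%N by rewrite -{1}E -addnn; lia.
rewrite full !natrD; case: (odd n); rewrite /= ?mulr1n ?mulr0n; lra.
Qed.

(** For k != 0 the characters sum to zero, so the values on the middle subinterval c may be
    subtracted from all others at no cost. Each difference gains |xi - c| / p, and the mean of |xi -
    c| is at most p / 4. *)
Lemma digit_avg_bound_nz k r (L : R) phi : k != 0 -> 0 <= L -> diff_bounded r.+1 L 1 phi ->
  diff_bounded r (L / p%:R ^+ r.+1 * (p%:R / 4)) 1 (digit_avg k phi).
Proof.
move=> k0 L0 D; set c := (p./2)%N; set L' := L / p%:R ^+ r.+1.
have cp : (c < p)%N by rewrite /c -divn2 ltn_Pdiv.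
pose psi y := phi (0 + p%:R^-1 * y).
have D' : diff_bounded r.+1 L' p%:R psi.
  rewrite /L' -exprVn; apply: diff_bounded_affine D; rewrite ?lexx ?add0r ?mulVf ?invr_ge0 ?ler0n//.
apply: (@diff_bounded_eq _ _ _ _ (fun x => toC p%:R^-1 * \sum_(xi : F) chi (- (k * xi)) *
    (psi ((xi : nat)%:R + x) - psi (c%:R + x)))) => [x _|].
  congr (_ * _); under eq_bigr do rewrite mulrBr; rewrite sumrB -big_distrl /=.
  have -> : \sum_(a : F) chi (- (k * a)) = 0.
    by under eq_bigr do rewrite -mulNr; rewrite sum_chi ?oppr_eq0.
  by rewrite mul0r subr0; apply: eq_bigr => a _; rewrite /psi add0r [_ * (_ + x)]mulrC.
apply: (@diff_bounded_le _ _ (nc (toC p%:R^-1) * \sum_(xi : F) L' * `|(xi : nat)%:R - c%:R|)).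
  rewrite nc_pinv -big_distrr /= (sum_Fp (fun i => `|i%:R - c%:R| : R)).
  rewrite mulrCA ler_wpM2l//; first by rewrite divr_ge0// exprn_ge0// ltW.
  by rewrite ler_pdivrMl// (le_trans (sum_dist_half p))// expr2 mulrA.
apply: diff_boundedZ; apply: diff_bounded_sum => xi.
apply: (@diff_bounded_le _ _ (nc (chi (- (k * xi))) * (L' * `|(xi : nat)%:R - c%:R|))).
  by rewrite nc_chi mul1r.
apply: diff_boundedZ.
by apply: diff_bounded_shift D' => //; rewrite natr1 ler_nat// Fp_ltn.
Qed.

Definition nzcount a ks : nat := minn a (count (predC1 0) ks).

(* mu_alpha for a list of digits, least significant first: the c-th digit
   contributes to one term for each position at most c. *)
Fixpoint digit_weight a ks : nat :=
  if ks is _ :: ks' then (digit_weight a ks' + nzcount a ks)%N else 0.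

Definition walsh_decay a ks : R :=
  (p%:R / 4) ^+ nzcount a ks / p%:R ^+ digit_weight a ks.

Lemma nzcount_cons a k ks :
  nzcount a (k :: ks) = if (k != 0) && (count (predC1 0%R) ks < a)%N
    then (nzcount a ks).+1 else nzcount a ks.
Proof. by rewrite /nzcount /=; case: eqP => //= _; case: ltnP; lia. Qed.

Lemma walsh_decay_ge0 a ks : 0 <= walsh_decay a ks.
Proof. by rewrite /walsh_decay divr_ge0 ?exprn_ge0 ?divr_ge0. Qed.

(** Every digit rescales by 1/p and so divides the bound by p to the number of orders still held,
    which is the capped count of the remaining nonzero digits. A nonzero digit consumes one order
    unless at least [a] nonzero digits follow it. The exponents add up to [digit_weight]. *)
Lemma walsh_coef_bound a ks (L : R) phi : 0 <= L -> diff_bounded (nzcount a ks) L 1 phi ->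
  nc (walsh_coef ks phi) <= L * walsh_decay a ks.
Proof.
elim: ks L phi => [|k ks IHks] L phi L0 D.
  rewrite /walsh_decay /nzcount /= minn0 !expr0 divr1 mulr1; apply: D; lra.
rewrite [walsh_coef _ _]/=; have pn0 n : (p%:R ^+ n : R) != 0 by rewrite expf_neq0.
have pn n : 0 <= p%:R ^+ n :> R by rewrite exprn_ge0.
move: D; rewrite /walsh_decay nzcount_cons [digit_weight _ _]/= nzcount_cons.
case: ifP => [/andP[k0 lt_a]|_] D.
  have L' : 0 <= L / p%:R ^+ (nzcount a ks).+1 * (p%:R / 4) by rewrite mulr_ge0 ?divr_ge0.
  apply: le_trans (IHks _ _ L' (digit_avg_bound_nz k0 L0 D)) _.
  rewrite le_eqVlt; apply/orP; left; apply/eqP; rewrite /walsh_decay exprD.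
  rewrite [(_ / 4) ^+ _.+1]exprS; field; rewrite !pn0 //.
have L' : 0 <= L / p%:R ^+ (nzcount a ks) by rewrite divr_ge0.
apply: le_trans (IHks _ _ L' (digit_avg_bound k D)) _.
rewrite le_eqVlt; apply/orP; left; apply/eqP; rewrite /walsh_decay exprD.
by field; rewrite !pn0.
Qed.

Lemma kink_scale e (y x : R) (q : nat) :
  kink e y ((q%:R + x) / p%:R) = p%:R^-1 ^+ e.+1 * kink e (p%:R * y - q%:R) x.
Proof.
rewrite /kink; have -> : (q%:R + x) / p%:R - y = p%:R^-1 * (x - (p%:R * y - q%:R)) :> R by field.
by rewrite normrM exprMn ger0_norm ?invr_ge0// exprS; ring.
Qed.

(** With the cap [a] set to the full number of nonzero digits, the differences reach an order at
    which the derivative of P vanishes. *)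
Lemma walsh_coef_poly0 ks (P : {poly R}) phi : (size P <= count (predC1 0%R) ks)%N ->
  (forall x, 0 <= x <= 1 -> phi x = toC P.[x]) -> walsh_coef ks phi = 0.
Proof.
move=> sP E; apply: Normc.eq0_normc; apply/eqP; rewrite eq_le nc_ge0 andbT.
rewrite -[leRHS](mul0r (walsh_decay (count (predC1 0%R) ks) ks)); apply: walsh_coef_bound => //.
apply: (@diff_bounded_eq _ _ _ _ (fun x => toC P.[x])); first by move=> x /E ->.
apply: diff_bounded_poly => x _; rewrite /nzcount minnn derivn_poly0//.
by rewrite horner0 normr0.
Qed.

Lemma walsh_coef_kink0 e (y : R) ks : (e.+2 <= count (predC1 0%R) ks)%N -> ~~ (0 < y < 1) ->
  walsh_coef ks (toC \o kink e y) = 0.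
Proof.
move=> le_ks y01; pose P : {poly R} := (2 * (e.+1)`!%:R)^-1 *: ('X - y%:P) ^+ e.+1.
have sP : (size P <= count (predC1 0%R) ks)%N.
  apply: leq_trans le_ks; apply: leq_trans (size_scale_leq _ _) _.
  by rewrite size_exp_XsubC.
have PE x : P.[x] = (x - y) ^+ e.+1 / (2 * (e.+1)`!%:R).
  by rewrite /P !hornerE mulrC.
have [y0|y1] : y <= 0 \/ 1 <= y
    by have [] := leP y 0; have [] := ltP y 1; move: y01; case: ltP; case: ltP; lra || tauto.
  apply: (@walsh_coef_poly0 _ P) => // x /andP[x0 x1]; rewrite /= PE /kink exprS.
  by rewrite ger0_norm ?subr_ge0 ?(le_trans y0).
apply: (@walsh_coef_poly0 _ (- P)) => [|x /andP[x0 x1]]; first by rewrite size_polyN.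
rewrite /= hornerN PE /kink exprS ler0_norm ?subr_le0 ?(le_trans x1)//.
by congr toC; ring.
Qed.

(** The kink offers e + 1 orders where e + 2 are wanted. While e + 2 nonzero digits still follow,
    every subinterval but the one containing y carries a polynomial with vanishing coefficient, and
    the average gives 1/p in place of the missing order. When only e + 1 follow, the general bound
    applies; the current digit then gains nothing from its character, and the constant 2 pays for
    it, since 2 (p/4) / p = 1/2. *)
Lemma walsh_coef_kink e (y : R) ks : 0 <= y < 1 -> (e.+2 <= count (predC1 0%R) ks)%N ->
  nc (walsh_coef ks (toC \o kink e y)) <= 2 * walsh_decay e.+2 ks.
Proof.
elim: ks y => [|k ks IHks] y y01; first by rewrite leqn0.
have y01' : 0 <= y <= 1 by move/andP: y01 => [-> /ltW ->].
have pn0 n : (p%:R ^+ n : R) != 0 by rewrite expf_neq0.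
rewrite [walsh_coef _ _]/=; case: (leqP e.+2 (count (predC1 0%R) ks)) => [le_ks _|lt_ks le_ks].
  have avgE x : digit_avg k (toC \o kink e y) x = \sum_(xi : F)
      (toC p%:R^-1 * chi (- (k * xi)) * toC (p%:R^-1 ^+ e.+1)) *
        (toC \o kink e (p%:R * y - (xi : nat)%:R)) x.
    rewrite /digit_avg big_distrr /=; apply: eq_bigr => xi _.
    by rewrite kink_scale rmorphM /= -!mulrA.
  rewrite (walsh_coef_eq _ (fun x _ => avgE x)) walsh_coef_sum.
  under eq_bigr do rewrite walsh_coefZ.
  have nE (xi : F) : nc (toC p%:R^-1 * chi (- (k * xi)) * toC (p%:R^-1 ^+ e.+1)) = (p%:R ^+ e.+2)^-1.
    rewrite !Normc.normcM nc_chi mulr1 !nc_real -normrM -exprS ger0_norm ?exprn_ge0 ?invr_ge0//.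
    by rewrite exprVn.
  have wdE : walsh_decay e.+2 (k :: ks) = walsh_decay e.+2 ks / p%:R ^+ e.+2.
    have cE : nzcount e.+2 ks = e.+2 by apply/minn_idPl.
    rewrite /walsh_decay nzcount_cons ltnNge le_ks andbF [digit_weight _ _]/=.
    rewrite nzcount_cons ltnNge le_ks andbF cE exprD invfM mulrA.
    by [].
  (* [q] numbers the subinterval containing y; for any other xi the rescaled kink p y - xi falls
     outside ]0, 1[. *)
  pose q := Num.truncn (p%:R * y); have py0 : 0 <= p%:R * y by case/andP: y01 => *; rewrite mulr_ge0.
  have /andP[q1 q2] := truncn_itv py0; rewrite -/q in q1 q2.
  have qp : (q < p)%N.
    by rewrite -(ltr_nat R) (le_lt_trans q1)// gtr_pMr//; case/andP: y01.
  have [xi0 xi0E] : exists xi0 : F, xi0 = q :> nat.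
    have qp' : (q < (Zp_trunc (pdiv p)).+2)%N by rewrite Fp_cast.
    by exists (Ordinal qp').
  rewrite (bigD1 xi0)//= big1 => [|xi xiq].
    rewrite addr0 Normc.normcM nE wdE [2 * _]mulrA mulrC ler_pM2r ?invr_gt0 ?exprn_gt0//.
    by apply: IHks; rewrite // xi0E; move: q2; rewrite -natr1; lra.
  rewrite walsh_coef_kink0 ?mulr0//; apply/negP => /andP[h1 h2].
  have xq : (xi : nat) != q by rewrite -xi0E.
  move: xq; rewrite neq_ltn => /orP[|]; rewrite -(ler_nat R) -natr1; move: q2; rewrite -natr1; lra.
have cE : count (predC1 0%R) ks = e.+1 /\ k != 0.
  by move: le_ks lt_ks => /=; case: eqP => //= _; lia.
case: cE => cE k0; have nE : nzcount e.+2 ks = e.+1 by rewrite /nzcount cE; lia.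
have D0 : diff_bounded (nzcount e.+2 ks) 2^-1 1 (toC \o kink e y).
  by rewrite nE; exact: diff_bounded_kink.
have := walsh_coef_bound _ (digit_avg_bound k D0); rewrite divr_ge0 ?invr_ge0 ?exprn_ge0// => /(_ isT) H.
apply: le_trans H _; rewrite le_eqVlt; apply/orP; left; apply/eqP.
have nE' : nzcount e.+2 (k :: ks) = e.+2 by rewrite nzcount_cons k0 cE ltnSn nE.
have dE : digit_weight e.+2 (k :: ks) = (digit_weight e.+2 ks + e.+2)%N.
  by rewrite -[LHS]/(digit_weight e.+2 ks + nzcount e.+2 (k :: ks))%N nE'.
rewrite /walsh_decay nE' dE nE [(_ / 4) ^+ e.+2]exprS exprD [_ ^+ e.+2]exprS.
move: (pn0 e.+1) (pn0 (digit_weight e.+2 ks)); set A := (_ / 4) ^+ _; set B := _ ^+ e.+1.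
by move: A B (p%:R ^+ _) => A B E B0 E0; field; rewrite B0 E0 pR_neq0.
Qed.

Lemma walsh_coef_bern a tau ks : (tau <= a)%N ->
  nc (walsh_coef ks (fun x => toC (bern tau x))) <= walsh_decay a ks.
Proof.
move=> ta; rewrite -[leRHS]mul1r; apply: walsh_coef_bound => //.
under eq_fun do rewrite bernE; apply: diff_bounded_poly => x x01.
rewrite derivn_bernp; case: ifP => _; first exact: bernp_le1.
by rewrite horner0 normr0.
Qed.

(** The arguments y - x and y + 1 - x of the two polynomial pieces range over [-1, 2]. Moving by one
    unit into [0, 1] changes the value by at most 1, by [bernp_diff]. *)
Lemma bernp_le2 n x : -1 <= x <= 2 -> `|(bernp R n).[x]| <= 2.
Proof.
case: n => [|n] /andP[x1 x2]; first by rewrite bernp0 hornerC normr1; lra.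
have powb (z : R) : -1 <= z <= 1 -> `|z ^+ n / n`!%:R| <= 1.
  move=> z1; rewrite normrM normrX normfV ler_pdivrMr ?normr_gt0 ?factR_neq0//.
  rewrite mul1r normr_nat (le_trans (exprn_ile1 _ _ _))// ?ler_norml ?ler1n ?fact_gt0//.
have b1 (z : R) : 0 <= z <= 1 -> `|(bernp R n.+1).[z]| <= 1 by exact: bernp_le1.
have [x0|x0] := ltP x 0.
  have := bernp_diff n x => E; have := powb x; rewrite -E => h1.
  have h2 := b1 (x + 1); have := h1 ltac:(lra); have := h2 ltac:(lra).
  by rewrite !ler_norml; lra.
have [x1'|x1'] := leP x 1; first by apply: le_trans (b1 _ _) _; lra.
have := bernp_diff n (x - 1); rewrite subrK => E; have := powb (x - 1); rewrite -E => h1.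
have h2 := b1 (x - 1); have := h1 ltac:(lra); have := h2 ltac:(lra).
by rewrite !ler_norml; lra.
Qed.

Lemma derivn_comp_sub (P : {poly R}) c r :
  (P \Po (c%:P - 'X))^`(r) = (-1) ^+ r *: (P^`(r) \Po (c%:P - 'X)).
Proof.
elim: r => [|r IHr]; first by rewrite !derivn0 expr0 scale1r.
rewrite derivnS IHr derivZ deriv_comp derivB derivC derivX sub0r mulrN1 -derivnS.
by rewrite exprS mulN1r scaleNr scalerN.
Qed.

Lemma bern_per_int a (x : R) (q : int) : bern_per a (x + q%:~R) = bern_per a x.
Proof.
rewrite /bern_per floorDrz ?intr_int// intrKfloor rmorphD /=; congr bern; ring.
Qed.

Lemma bern_per_frac a (y x : R) :
  bern_per a (y - x) = bern_per a ((y - (Num.floor y)%:~R) - x).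
Proof.
by rewrite -[RHS](bern_per_int _ _ (Num.floor y)); congr bern_per; ring.
Qed.

(* Where y - x changes sign, bern_per jumps between two polynomials that differ by
   (y - x)^(e+1) / (e+1)!; it is their mean plus a kink. *)
Lemma bern_per_split e (y x : R) : 0 <= y < 1 -> 0 <= x <= 1 ->
  bern_per e.+2 (y - x) =
  ((bernp R e.+2).[y - x] + (bernp R e.+2).[y + 1 - x]) / 2 + (-1) ^+ e.+1 * kink e y x.
Proof.
move=> /andP[y0 y1] /andP[x0 x1]; rewrite /bern_per bernE.
have D := bernp_diff e.+1 (y - x); rewrite -addrA [- x + 1]addrC addrA in D.
have fn0 := factR_neq0 R e.+1.
have kE : kink e y x = `|x - y| * (x - y) ^+ e / (e.+1)`!%:R / 2.
  by rewrite /kink; field.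
have [xy|yx] := leP x y.
  have -> : Num.floor (y - x) = 0 by apply/eqP; rewrite floor_eq/=; lra.
  rewrite subr0 kE ler0_norm ?subr_le0//.
  have -> : (-1) ^+ e.+1 * (- (x - y) * (x - y) ^+ e / (e.+1)`!%:R / 2) =
      - ((y - x) ^+ e.+1 / (e.+1)`!%:R) / 2.
    by rewrite -(opprB x y) [(- (x - y)) ^+ _]exprNn; rewrite !exprS; ring.
  by rewrite -D; lra.
have -> : Num.floor (y - x) = -1 by apply/eqP; rewrite floor_eq/= ?mulrN1z; lra.
rewrite kE gtr0_norm ?subr_gt0//.
have -> : (-1) ^+ e.+1 * ((x - y) * (x - y) ^+ e / (e.+1)`!%:R / 2) =
    ((y - x) ^+ e.+1 / (e.+1)`!%:R) / 2.
  by rewrite -(opprB x y) [(- (x - y)) ^+ _]exprNn !exprS; ring.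
have -> : y - x - (-1)%:~R = y + 1 - x by rewrite mulrN1z; ring.
rewrite -D; lra.
Qed.

(** The constant is 1 + 2 when at least [a] digits are nonzero, because the derivative of order [a]
    of the polynomial part is then 1 up to sign and the kink contributes 2. Otherwise it is 2 +
    1/2. *)
Lemma walsh_coef_bern_per a (y : R) ks : (2 <= a)%N ->
  nc (walsh_coef ks (fun x => toC (bern_per a (y - x)))) <= 3 * walsh_decay a ks.
Proof.
case: a => [|[|e]]// _; under eq_fun do rewrite bern_per_frac.
set z := y - _; have z01 : 0 <= z < 1.
  by rewrite /z; have := floor_itv y; rewrite intrD1; lra.
have z01' : 0 <= z <= 1 by lra.
pose P : {poly R} := 2^-1 *: ((bernp R e.+2 \Po (z%:P - 'X)) + (bernp R e.+2 \Po ((z + 1)%:P - 'X))).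
have PE x : P.[x] = ((bernp R e.+2).[z - x] + (bernp R e.+2).[z + 1 - x]) / 2.
  by rewrite hornerZ hornerD !horner_comp !hornerE mulrC.
rewrite (@walsh_coef_eq ks _ (fun x => toC P.[x] + toC ((-1) ^+ e.+1) * (toC \o kink e z) x)); last first.
  by move=> x x01; rewrite bern_per_split// -PE rmorphD; congr (_ + _); exact: rmorphM.
rewrite walsh_coefD walsh_coefZ; apply: le_trans (le_normcD _ _) _.
rewrite Normc.normcM nc_real normrX normrN1 expr1n mul1r.
have dP r : P^`(r) = (2^-1 * (-1) ^+ r) *: (((bernp R e.+2)^`(r) \Po (z%:P - 'X)) +
    ((bernp R e.+2)^`(r) \Po ((z + 1)%:P - 'X))).
  by rewrite derivnZ derivnD !derivn_comp_sub -scalerDr scalerA.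
have w0 := walsh_decay_ge0 e.+2 ks.
have PB (L : R) : 0 <= L -> (forall z, -1 <= z <= 2 -> `|((bernp R e.+2)^`(nzcount e.+2 ks)).[z]| <= L) ->
    nc (walsh_coef ks (fun x => toC P.[x])) <= L * walsh_decay e.+2 ks.
  move=> L0 H; apply: walsh_coef_bound => //; apply: diff_bounded_poly => x x01.
  rewrite dP hornerZ hornerD !horner_comp !hornerE !normrM normrX normrN1 expr1n mulr1.
  rewrite ger0_norm ?invr_ge0// ler_pdivrMl//; apply: le_trans (ler_normD _ _) _.
  have h1 := H (z - x) ltac:(lra); have h2 := H (z + 1 - x) ltac:(lra); lra.
have [le_ks|lt_ks] := leqP e.+2 (count (predC1 0%R) ks).
  have cE : nzcount e.+2 ks = e.+2 by apply/minn_idPl.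
  have h1 := walsh_coef_kink z01 le_ks; have h2 := PB 1 ler01.
  have : nc (walsh_coef ks (fun x => toC P.[x])) <= 1 * walsh_decay e.+2 ks.
    by apply: h2 => w _; rewrite cE derivn_bernp leqnn subnn bernp0 hornerC normr1.
  by move: h1; lra.
have cE : nzcount e.+2 ks = count (predC1 0%R) ks by apply/minn_idPr; exact: ltnW.
have h1 : nc (walsh_coef ks (toC \o kink e z)) <= 2^-1 * walsh_decay e.+2 ks.
  by apply: walsh_coef_bound; rewrite ?invr_ge0// cE; exact: diff_bounded_kink.
have : nc (walsh_coef ks (fun x => toC P.[x])) <= 2 * walsh_decay e.+2 ks.
  apply: PB => // w wb; rewrite derivn_bernp; case: ifP => _; first exact: bernp_le2.
  by rewrite horner0 normr0.
by move: h1; lra.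
Qed.

Lemma bern_per_mult a (z : R) :
  \sum_(i < p) bern_per a ((z - i%:R) / p%:R) = p%:R / p%:R ^+ a * bern_per a z.
Proof.
pose G (z : R) : R := \sum_(i < p) bern_per a ((z - i%:R) / p%:R).
have G1 w : G (w + 1) = G w.
  rewrite /G; case: p p_gt0 pR_neq0 => // p' _ p0.
  rewrite big_ord_recl big_ord_recr addrC /=; congr (_ + _).
    by apply: eq_bigr => i _; rewrite /bump /= add1n -natr1; congr bern_per; congr (_ / _); ring.
  rewrite -[RHS](bern_per_int a _ 1); congr bern_per.
  have {p0} : p'%:R + 1 != 0 :> R by rewrite natr1.
  by rewrite -natr1 -[1%:~R]/(1 : R) => p0; field; rewrite addrC.
have Gn w n : G (w + n%:R) = G w.
  by elim: n => [|n IHn]; rewrite ?addr0// -natr1 addrA G1.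
pose f := z - (Num.floor z)%:~R.
have f01 : 0 <= f < 1 by rewrite /f; have := floor_itv z; rewrite intrD1; lra.
(* [G] is 1-periodic. Starting from f + p - 1 makes the arguments (f + i) / p, all in [0, 1[, where
   the periodic extension is the polynomial itself. *)
have -> : \sum_(i < p) bern_per a ((z - i%:R) / p%:R) = G (f + p.-1%:R).
  rewrite Gn -/(G z) /f; case: (Num.floor z) => n.
    by rewrite -(Gn (z - n%:~R) n) subrK.
  by rewrite NegzE mulrNz opprK Gn.
rewrite -[bern_per a z](bern_per_int _ _ (- Num.floor z)) rmorphN -/f.
have fE : bern_per a f = (bernp R a).[f].
  have -> : bern_per a f = bern a (f - (Num.floor f)%:~R) by [].
  by have -> : Num.floor f = 0; [apply/eqP; rewrite floor_eq/=; lra|rewrite subr0 bernE].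
rewrite fE -(bernp_mult _ _ p_gt0) /G (reindex_inj rev_ord_inj) /=.
apply: eq_bigr => i _; have ip := ltn_ord i.
have -> : (f + p.-1%:R - (p - i.+1)%:R) / p%:R = (f + i%:R) / p%:R.
  congr (_ / _); rewrite natrB// -subn1 natrB// -natr1; ring.
rewrite /bern_per bernE; congr _.[_].
have i1 : i%:R + 1 <= p%:R :> R by rewrite natr1 ler_nat.
have -> : Num.floor ((f + i%:R) / p%:R) = 0; last by rewrite subr0.
have i0 : 0 <= i%:R :> R by [].
have x0 : 0 <= (f + i%:R) / p%:R by rewrite divr_ge0//; lra.
have x1 : (f + i%:R) / p%:R < 1 by rewrite ltr_pdivrMr//; lra.
by apply/eqP; rewrite floor_eq /=; lra.
Qed.

(** The digit 0 takes the plain mean over the subintervals; by the multiplication theorem Bernoulli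
    polynomials are its eigenfunctions, with eigenvalue p^-tau. *)
Lemma digit_avg0_bern tau x :
  digit_avg 0 (fun x => toC (bern tau x)) x = toC (p%:R ^+ tau)^-1 * toC (bern tau x).
Proof.
rewrite /digit_avg; under eq_bigr do rewrite mul0r oppr0 chi0 mul1r addrC.
rewrite (sum_Fp (fun i => toC (bern tau ((x + i%:R) / p%:R)))) -rmorph_sum /=.
under eq_bigr do rewrite bernE; rewrite bernp_mult// bernE -!rmorphM.
have pt0 : (p%:R ^+ tau : R) != 0 by rewrite expf_neq0.
by congr toC; field; rewrite pR_neq0 pt0.
Qed.

Lemma digit_avg0_bern_per a (y x : R) :
  digit_avg 0 (fun x => toC (bern_per a (y - x))) x =
  toC (p%:R ^+ a)^-1 * toC (bern_per a (p%:R * y - x)).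
Proof.
rewrite /digit_avg; under eq_bigr do rewrite mul0r oppr0 chi0 mul1r.
rewrite (sum_Fp (fun i => toC (bern_per a (y - (i%:R + x) / p%:R)))) -rmorph_sum /=.
have -> : \sum_(i < p) bern_per a (y - (i%:R + x) / p%:R) =
    \sum_(i < p) bern_per a ((p%:R * y - x - i%:R) / p%:R).
  by apply: eq_bigr => i _; congr bern_per; field.
rewrite bern_per_mult -!rmorphM.
have pt0 : (p%:R ^+ a : R) != 0 by rewrite expf_neq0.
by congr toC; field; rewrite pR_neq0 pt0.
Qed.

Lemma walsh_coef0_bern n tau :
  walsh_coef (nseq n 0) (fun x => toC (bern tau x)) = toC ((p%:R ^+ n)^-1 ^+ tau * bern tau 0).
Proof.
elim: n => [|n IHn] /=; first by rewrite expr0 invr1 expr1n mul1r.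
rewrite (walsh_coef_eq _ (fun x _ => digit_avg0_bern tau x)) walsh_coefZ IHn -rmorphM mulrA.
by congr (toC (_ * _)); rewrite -exprVn -exprMn -invfM -exprS.
Qed.

Lemma walsh_coef0_bern_per n a (y : R) :
  walsh_coef (nseq n 0) (fun x => toC (bern_per a (y - x))) =
  toC ((p%:R ^+ n)^-1 ^+ a * bern_per a (p%:R ^+ n * y)).
Proof.
elim: n y => [|n IHn] y /=; first by rewrite !expr0 invr1 expr1n !mul1r subr0.
rewrite (walsh_coef_eq _ (fun x _ => digit_avg0_bern_per a y x)) walsh_coefZ IHn -rmorphM mulrA.
by rewrite mulrA -exprSr; congr (toC (_ * _)); rewrite -exprVn -exprMn -invfM -exprS.
Qed.

Lemma walsh_coef0_cst n (z : R[i]) : walsh_coef (nseq n 0) (fun=> z) = z.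
Proof.
elim: n => //= n IHn; rewrite -[RHS]IHn; apply: walsh_coef_eq => x _.
rewrite /digit_avg; under eq_bigr do rewrite mul0r oppr0 chi0 mul1r.
rewrite sumr_const card_Fp// -[z *+ p]mulr_natl mulrA -(rmorph_nat toC).
by rewrite -rmorphM mulVf// rmorph1 mul1r.
Qed.

Lemma walsh_coef_cst ks (z : R[i]) : has (predC1 0) ks -> walsh_coef ks (fun=> z) = 0.
Proof.
rewrite has_count => ks0; rewrite (_ : (fun=> z) = (fun=> z * toC (1%:P).[0])); last first.
  by rewrite hornerC rmorph1 mulr1.
rewrite walsh_coefZ (walsh_coef_poly0 (P := 1%:P)) ?mulr0// => [|x _].
  by rewrite (leq_trans (size_polyC_leq1 _)).
by rewrite !hornerC.
Qed.

End Walsh.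

(** * Digital nets and their duals *)

Section DigitExpansions.
Variable p : nat.
Hypothesis p_prime : prime p.
Implicit Types (ks : seq 'F_p).

Let p_gt0 : (0 < p)%N := prime_gt0 p_prime.
Let p_gt1 : (1 < p)%N := prime_gt1 p_prime.

Lemma digit0 k : digit p k 0 = (k %% p)%N.
Proof. by rewrite /digit expn0 divn1. Qed.

Lemma digitS k i : digit p k i.+1 = digit p (k %/ p) i.
Proof. by rewrite /digit expnS divnMA. Qed.

Lemma digit_inj m a b : (a < p ^ m)%N -> (b < p ^ m)%N ->
  (forall l, (l < m)%N -> digit p a l = digit p b l) -> a = b.
Proof.
elim: m a b => [|m IHm] a b; first by rewrite expn0 !ltnS !leqn0 => /eqP -> /eqP ->.
rewrite expnSr -!ltn_divLR// => am bm E.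
rewrite (divn_eq a p) (divn_eq b p) -!digit0 (E 0)//; congr (_ * _ + _)%N.
by apply: IHm => // l lm; rewrite -!digitS E.
Qed.

Fixpoint nat_of_digits ks : nat :=
  if ks is k :: ks' then (k + p * nat_of_digits ks')%N else 0%N.

Lemma digit_nat_of_digits ks i : digit p (nat_of_digits ks) i = nth 0%R ks i.
Proof.
elim: ks i => [|k ks IHks] i; first by rewrite nth_nil /digit /= div0n mod0n.
have kp : (k < p)%N by rewrite -[X in (_ < X)%N](Fp_cast p_prime).
case: i => [|i] /=; first by rewrite digit0 addnC mulnC modnMDl modn_small.
by rewrite digitS addnC mulnC divnMDl// divn_small// addn0 IHks.
Qed.

Definition nz_positions ks : seq nat :=
  [seq c <- iota 1 (size ks) | nth 0 ks c.-1 != 0].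

Lemma nz_positions_cons k ks :
  nz_positions (k :: ks) = (if k != 0 then [:: 1%N] else [::]) ++ map S (nz_positions ks).
Proof.
rewrite /nz_positions /= -[2%N]/(1 + 1)%N iotaDl filter_map.
have -> : [seq c <- iota 1 (size ks) | preim (addn 1)
   (fun c => nth 0 (k :: ks) c.-1 != 0) c] = nz_positions ks.
  by rewrite /nz_positions; apply: eq_in_filter => -[|c]//; rewrite mem_iota.
by case: (k != 0).
Qed.

Lemma size_nz_positions ks : size (nz_positions ks) = count (predC1 0) ks.
Proof.
elim: ks => // k ks IHks; rewrite nz_positions_cons size_cat size_map IHks /=.
by case: eqP.
Qed.

Lemma digit_weightE a ks :
  digit_weight a ks = (\sum_(c <- take a (rev (nz_positions ks))) c)%N.
Proof.
elim: ks => [|k ks IHks]; first by rewrite /nz_positions /= big_nil.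
rewrite -[LHS]/(digit_weight a ks + nzcount a (k :: ks))%N nz_positions_cons rev_cat.
have -> : rev (if k != 0 then [:: 1%N] else [::]) = if k != 0 then [:: 1%N] else [::].
  by case: ifP.
rewrite -map_rev take_cat size_map size_rev size_nz_positions IHks.
have sumS s : (\sum_(c <- map S s) c = \sum_(c <- s) c + size s)%N.
  rewrite big_map; elim: s => [|x s IHs]; first by rewrite !big_nil.
  by rewrite !big_cons IHs /=; lia.
have szr : size (rev (nz_positions ks)) = count (predC1 0) ks.
  by rewrite size_rev size_nz_positions.
case: ltnP => [a_lt|a_ge].
  rewrite -map_take sumS size_takel ?szr; last exact: ltnW.
  congr (_ + _)%N; apply/minn_idPl.
  by rewrite (leq_trans (ltnW a_lt))//= leq_addl.
rewrite big_cat /= sumS szr take_oversize ?szr// -addnA; congr (_ + _)%N.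
rewrite /nzcount /=; move: (count _ ks) a_ge => N a_ge {szr}.
case: (k =P 0) => k0 /=; first by rewrite big_nil; lia.
case: (a - N)%N (subn_eq0 a N) => [|d] /= h; last by rewrite big_seq1; move: h; lia.
by rewrite big_nil; move: h; lia.
Qed.

(** [mu] scans the positions up to k and [nz_positions] those up to the length of the list; both are
    compared with a common longer scan. *)
Lemma filter_iota_wide (P : pred nat) n N : (n <= N)%N ->
  (forall c, (n < c)%N -> ~~ P c) ->
  seq.filter P (iota 1 N) = seq.filter P (iota 1 n).
Proof.
move=> nN Pn; rewrite -(subnKC nN) iotaD filter_cat.
rewrite [X in _ ++ X](_ : _ = [::]) ?cats0//; apply/eqP.
rewrite -[_ == _]negbK -has_filter; apply/hasPn => c; rewrite mem_iota => /andP[c1 _].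
by apply: Pn; rewrite -add1n.
Qed.

Lemma mu_nat_of_digits a ks : mu p a (nat_of_digits ks) = digit_weight a ks.
Proof.
rewrite digit_weightE /mu; set k := nat_of_digits ks; congr (\sum_(c <- take a (rev _)) c)%N.
pose P c := digit p k c.-1 != 0%N.
have PE c : P c = (nth 0 ks c.-1 != 0) by rewrite /P digit_nat_of_digits.
have Pk c : (k < c)%N -> ~~ P c.
  case: c => // c kc; rewrite /P negbK /digit divn_small ?mod0n//.
  have kc' : (k <= c)%N by [].
  exact: leq_ltn_trans kc' (ltn_expl _ p_gt1).
have Pn c : (size ks < c)%N -> ~~ P c.
  by case: c => // c sc; rewrite PE negbK nth_default.
have -> : nz_positions ks = seq.filter P (iota 1 (size ks)).
  by apply: eq_filter => c; rewrite PE.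
rewrite -(filter_iota_wide (leq_maxl (size ks) k))//.
by rewrite -(filter_iota_wide (leq_maxr (size ks) k)).
Qed.

Lemma nat_of_digits_eq0 ks : nat_of_digits ks = 0%N -> all (pred1 0) ks.
Proof.
move=> k0; apply/(all_nthP 0) => i _; apply/eqP/val_inj.
by rewrite /= -digit_nat_of_digits k0 /digit div0n mod0n.
Qed.

End DigitExpansions.

(** * Net averages as Walsh sums over the dual net *)

Section NetAverage.
Variables (R : realType) (p : nat) (om : R[i]).
Hypotheses (p_prime : prime p) (omX : om ^+ p = 1) (om_neq1 : om != 1).

Local Notation nc := (@Normc.normc R).
Local Notation toC := (real_complex R).
Local Notation F := 'F_p.
Local Notation chi := (chi om).

Definition row_tuple n (v : 'rV[F]_n) : n.-tuple F := [tuple v 0 i | i < n].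

Arguments row_tuple : simpl never.

Lemma digits_point_map n (f : 'I_n -> F) :
  digits_point R [seq f i | i <- enum 'I_n] = \sum_(i < n) (f i : nat)%:R / p%:R ^+ i.+1.
Proof.
elim: n f => [|n IHn] f; first by rewrite big_ord0 (size0nil (size_enum_ord 0)).
rewrite enum_ordSl /= -map_comp IHn big_ord_recl expr1 mulrDl; congr (_ + _).
rewrite big_distrl /=; apply: eq_bigr => i _; rewrite /= -mulrA -invfM -exprSr.
by rewrite /bump /= add1n.
Qed.

Lemma digits_dot_map n (f g : 'I_n -> F) :
  digits_dot [seq f i | i <- enum 'I_n] [seq g i | i <- enum 'I_n] = \sum_(i < n) f i * g i.
Proof.
elim: n f g => [|n IHn] f g; first by rewrite big_ord0 (size0nil (size_enum_ord 0)).
have cons k ks d ds : digits_dot (k :: ks) (d :: ds) = k * d + digits_dot ks ds :> F by [].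
by rewrite enum_ordSl !map_cons cons -(map_comp f) -(map_comp g) IHn big_ord_recl.
Qed.

Lemma row_tuple_bij n : bijective (@row_tuple n).
Proof.
exists (fun t => \row_i tnth t i) => [v|t].
  by apply/rowP => i; rewrite mxE tnth_mktuple.
by apply: eq_from_tnth => i; rewrite tnth_mktuple mxE.
Qed.

Lemma walsh_inversion_row n phi (d : 'rV[F]_n) :
  \sum_(k : 'rV[F]_n) chi ((d *m k^T) 0 0) * walsh_coef om (row_tuple k) phi =
  phi (digits_point R (row_tuple d)).
Proof.
rewrite -(walsh_inversion p_prime omX om_neq1) (reindex (@row_tuple n)) /=; last first.
  by have [g h1 h2] := row_tuple_bij n; exists g => ? _.
apply: eq_bigr => k _; congr (chi _ * _); rewrite digits_dot_map mxE.
by apply: eq_bigr => i _; rewrite mxE mulrC.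
Qed.

Lemma sum_chi_row m (z : 'cV[F]_m) :
  \sum_(eta : 'rV[F]_m) chi ((eta *m z) 0 0) = if z == 0 then (p ^ m)%:R else 0.
Proof.
case: eqP => [->|/eqP z0].
  under eq_bigr do rewrite mulmx0 mxE chi0.
  by rewrite sumr_const card_mx card_Fp// mul1n.
have [l zl] : exists l, z l 0 != 0.
  apply/existsP; apply: contraR z0 => /existsPn H; apply/eqP/colP => i.
  by rewrite mxE; apply/eqP; rewrite -[_ == _]negbK H.
set S := \sum_eta _; have : (chi (z l 0) - 1) * S = 0.
  rewrite mulrBl mul1r; apply/eqP; rewrite subr_eq0; apply/eqP.
  rewrite /S [RHS](reindex_inj (addrI (delta_mx 0 l))) /= big_distrr /=.
  apply: eq_bigr => eta _;
  have -> : ((delta_mx 0 l + eta) *m z) 0 0 = z l 0 + (eta *m z) 0 0.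
    by rewrite mulmxDl -rowE mxE [row l z _ _]mxE.
  exact/esym/(chiD p_prime omX).
have := chi_neq1 p_prime omX om_neq1 zl => h.
by move/eqP; rewrite mulf_eq0 subr_eq0 (negPf h) => /eqP.
Qed.

Section Net.
Variables (s n m : nat) (C : 'I_s -> 'M[F]_(n, m)).
Implicit Types (k : {ffun 'I_s -> 'rV[F]_n}).

Definition dual_mem k : bool := \sum_j (C j)^T *m (k j)^T == 0.

Lemma net_pointE h j :
  tnth (net_point R C h) j = digits_point R (row_tuple (net_digits C h j)).
Proof. by rewrite tnth_mktuple /row_tuple digits_point_map. Qed.

Lemma big_net_digits (G : 'rV[F]_m -> R[i]) :
  \sum_(h < p ^ m) G (\row_l (digit p h l)%:R) = \sum_(eta : 'rV[F]_m) G eta.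
Proof.
pose f (h : 'I_(p ^ m)) : 'rV[F]_m := \row_l (digit p h l)%:R.
have f_inj : injective f.
  move=> h h' /rowP E; apply/val_inj/(@digit_inj p p_prime m) => [||l lm]; try exact: ltn_ord.
  have := congr1 (@nat_of_ord _) (E (Ordinal lm)); rewrite !mxE /= !val_Fp_nat//.
  by rewrite /digit !modn_mod.
have f_bij : bijective f.
  by apply: inj_card_bij => //; rewrite card_mx card_Fp// mul1n card_ord.
rewrite [RHS](reindex f)//; have [g h1 h2] := f_bij; by exists g => ? _.
Qed.

(** Poisson summation for the net. After Walsh inversion in each factor, the sum over the digit
    vectors eta of h is a character sum on F_p^m: it is p^m if k solves the dual equation and zero
    otherwise. *)
Lemma net_sum_product (phi : 'I_s -> R -> R[i]) :
  (p ^ m)%:R^-1 * \sum_(h < p ^ m) \prod_j phi j (tnth (net_point R C h) j) =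
  \sum_(k | dual_mem k) \prod_j walsh_coef om (row_tuple (k j)) (phi j).
Proof.
pose G (eta : 'rV[F]_m) := \prod_j phi j (digits_point R (row_tuple (eta *m (C j)^T))).
have -> : \sum_(h < p ^ m) \prod_j phi j (tnth (net_point R C h) j) =
    \sum_(h < p ^ m) G (\row_l (digit p h l)%:R).
  by apply: eq_bigr => h _; apply: eq_bigr => j _; rewrite net_pointE.
rewrite big_net_digits /G.
under eq_bigr do (under eq_bigr do rewrite -walsh_inversion_row; rewrite bigA_distr_bigA).
rewrite exchange_big /= big_distrr /= [RHS]big_mkcond /=; apply: eq_bigr => k _.
under eq_bigr do rewrite big_split /=.
rewrite -big_distrl /=.
have -> : \sum_(eta : 'rV[F]_m) \prod_j chi ((eta *m (C j)^T *m (k j)^T) 0 0) =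
   \sum_(eta : 'rV[F]_m) chi ((eta *m (\sum_j (C j)^T *m (k j)^T)) 0 0).
  apply: eq_bigr => eta _; rewrite -(chi_sum p_prime omX) mulmx_sumr summxE.
  by congr chi; apply: eq_bigr => j _; rewrite mulmxA.
rewrite sum_chi_row -/(dual_mem k); case: (dual_mem k); last by rewrite mul0r mulr0.
by rewrite mulrA mulVf ?mul1r// pnatr_eq0 -lt0n expn_gt0 prime_gt0.
Qed.

End Net.

End NetAverage.

(** * Counting points of the dual net by weight *)

Section TopDigits.
Variables (p a : nat).
Local Notation F := 'F_p.
Implicit Types (ks : seq F).
Local Notation nz := (count (predC1 (0 : F))).

(* Keeps the a most significant nonzero digits. *)
Fixpoint top_digits ks : seq F :=
  if ks is k :: ks' then (if (nz ks' < a)%N then k else 0) :: top_digits ks' else [::].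

(* The number of digits below the a-th most significant nonzero one. *)
Fixpoint free_digits ks : nat :=
  if ks is k :: ks' then (if (nz ks' < a)%N then 0 else (free_digits ks').+1) else 0%N.

Lemma size_top_digits ks : size (top_digits ks) = size ks.
Proof. by elim: ks => //= k ks ->. Qed.

Lemma nzcount_top_digits ks : nzcount a (top_digits ks) = nzcount a ks.
Proof.
elim: ks => // k ks; rewrite /nzcount /=; case: ltnP => h /=.
  by case: (k != 0); move: (count _ (top_digits ks)) (count _ ks) h => A B /=; lia.
by case: (k != 0); move: (count _ (top_digits ks)) (count _ ks) h => A B /=; lia.
Qed.

Lemma nz_top_digits ks : (nz (top_digits ks) <= a)%N.
Proof.
elim: ks => //= k ks; have := nzcount_top_digits ks; rewrite /nzcount.
move: (count _ (top_digits ks)) (count _ ks) => A B /=; case: ltnP => /= h; rewrite ?eqxx /=; case: (k != 0); lia.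
Qed.

Lemma digit_weight_top_digits ks : digit_weight a (top_digits ks) = digit_weight a ks.
Proof.
elim: ks => // k ks IHks; have := nzcount_top_digits (k :: ks).
have dwE k' ks' : digit_weight a (k' :: ks' : seq F) = (digit_weight a ks' + nzcount a (k' :: ks'))%N by [].
by rewrite [top_digits _]/= !dwE IHks => ->.
Qed.

Lemma nz_lt_top ks : (nz (top_digits ks) < a)%N = (nz ks < a)%N.
Proof.
have := nzcount_top_digits ks; rewrite /nzcount.
by move: (count _ (top_digits ks)) (count _ ks) => A B; lia.
Qed.

Lemma free_digits_top ks : free_digits (top_digits ks) = free_digits ks.
Proof. by elim: ks => //= k ks IHks; rewrite IHks nz_lt_top. Qed.

Lemma free_digits_small ks : (nz ks < a)%N -> free_digits ks = 0%N.
Proof.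
case: ks => //= k ks h; rewrite ifT//; apply: leq_ltn_trans h.
by rewrite leq_addl.
Qed.

Lemma free_digits_le ks : (free_digits ks <= size ks)%N.
Proof. by elim: ks => //= k ks IHks; case: ifP. Qed.

(** Every free position has at least [a] nonzero digits above it and so contributes the full [a] to
    the weight. *)
Lemma free_digits_weight ks : (a * free_digits ks <= digit_weight a ks)%N.
Proof.
elim: ks => [|k ks IHks]; first by rewrite muln0.
have dwE : digit_weight a (k :: ks) = (digit_weight a ks + nzcount a (k :: ks))%N by [].
rewrite dwE [free_digits _]/=; case: ltnP => h; first by rewrite muln0.
have -> : nzcount a (k :: ks) = a by apply/minn_idPl; rewrite (leq_trans h)//= leq_addl.
by rewrite mulnS addnC leq_add2r.
Qed.

(** Hence the difference of two lists with equal top digits is supported on the free positions,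
    which form a box. *)
Lemma nth_top_digits_eq ks ks' i : size ks = size ks' -> top_digits ks = top_digits ks' ->
  (free_digits (top_digits ks) <= i)%N -> nth 0 ks i = nth 0 ks' i.
Proof.
elim: ks ks' i => [|k ks IHks] [|k' ks'] i //= [sz] [hd tl].
rewrite nz_lt_top; have E : (nz ks < a)%N = (nz ks' < a)%N by rewrite -(nz_lt_top ks) -(nz_lt_top ks') tl.
rewrite -E in hd; case: i => [|i]; case: ifP hd => h hd le_i //=.
  by apply: IHks => //; rewrite free_digits_top free_digits_small.
exact: (IHks _ _ sz tl).
Qed.

Lemma all0_top_digits ks : all (pred1 0) ks -> all (pred1 0) (top_digits ks).
Proof.
by elim: ks => //= k ks IHks /andP[/eqP -> /IHks ->]; rewrite if_same eqxx.
Qed.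

Lemma count_nz_le ks z : (forall i, (z <= i)%N -> nth 0 ks i = 0) -> (nz ks <= z)%N.
Proof.
elim: ks z => //= k ks IHks [|z] H.
  have -> : k = 0 := H 0%N isT.
  by rewrite eqxx; apply: IHks => i _; exact: (H i.+1).
have : (nz ks <= z)%N by apply: IHks => i zi; exact: (H i.+1).
by case: (k != 0); move: (count _ ks) => A /=; lia.
Qed.

Lemma digit_weight_box ks z : (forall i, (z <= i)%N -> nth 0 ks i = 0) ->
  (digit_weight a ks <= \sum_(i < z) minn a i.+1)%N.
Proof.
elim: ks z => // k ks IHks z H.
have dwE : digit_weight a (k :: ks) = (digit_weight a ks + nzcount a (k :: ks))%N by [].
have c := count_nz_le H; rewrite dwE; case: z H c => [|z] H c.
  have : (nz ks <= 0)%N by move: c => /=; case: (k != 0).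
  rewrite leqn0 => /eqP ks0; rewrite /nzcount; move: c; rewrite leqn0 => /eqP ->.
  rewrite minn0 addn0 big_ord0; have := IHks 0%N; rewrite big_ord0; apply.
  by move=> i _; exact: (H i.+1).
rewrite big_ord_recr leq_add//; first by apply: IHks => i zi; exact: (H i.+1).
by rewrite /nzcount leq_min geq_minl (leq_trans (geq_minr _ _)).
Qed.

End TopDigits.

(** * Counting and weighted sums in a subgroup whose nonzero members have weight above M *)

Section DualCounting.
Variables (R : realType) (p s n a M : nat).
Hypotheses (p_prime : prime p) (a_gt0 : (0 < a)%N).
Local Notation F := 'F_p.
Local Notation vec := {ffun 'I_s -> 'rV[F]_n}.
Local Notation nz := (count (predC1 (0 : F))).
Implicit Types (k : vec) (z : 'I_s -> nat) (u : {set 'I_s}).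

Variable V : {pred vec}.
Hypothesis VB : forall k k', k \in V -> k' \in V -> k - k' \in V.

Definition vec_weight k : nat := (\sum_j digit_weight a (row_tuple (k j)))%N.

Hypothesis V_weight : forall k, k \in V -> k != 0 -> (M < vec_weight k)%N.

(** The weight of a vector whose digits in the box are all nonzero, the largest that the box
    admits. *)
Definition box_weight z : nat := (\sum_j \sum_(i < z j) minn a i.+1)%N.

Definition in_box z k : bool := [forall j, forall i : 'I_n, (z j <= i)%N ==> (k j 0 i == 0)].

Lemma nth_row_tuple (v : 'rV[F]_n) (i : 'I_n) : nth 0 (row_tuple v) i = v 0 i.
Proof. by rewrite -tnth_nth tnth_mktuple. Qed.

Lemma in_boxP z k : reflect (forall j i, (z j <= i)%N -> nth 0 (row_tuple (k j)) i = 0) (in_box z k).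
Proof.
apply: (iffP forallP) => [H j i zi|H j].
  have [i_lt|i_ge] := ltnP i n; last by rewrite nth_default ?size_tuple.
  rewrite (nth_row_tuple _ (Ordinal i_lt)).
  by have /forallP/(_ (Ordinal i_lt))/implyP/(_ zi)/eqP := H j.
by apply/forallP => i; apply/implyP => zi; rewrite -nth_row_tuple H.
Qed.

Lemma in_box_weight z k : in_box z k -> (vec_weight k <= box_weight z)%N.
Proof. by move/in_boxP => H; apply: leq_sum => j _; apply: digit_weight_box => i /H. Qed.

(** Shorten the box by one digit: subtracting a fixed member maps each fibre of the removed digit
    into the smaller box, so the count falls by a factor of at most p while the box weight falls by
    at least 1. A box of weight at most M meets V in zero alone. *)
Lemma card_box z : (forall j, z j <= n)%N ->
  (#|[pred k in V | in_box z k]| <= p ^ (box_weight z - M))%N.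
Proof.
move: {2}(\sum_j z j)%N (erefl (\sum_j z j)%N) => N.
elim: N z => [|N IHN] z zN zn.
all: have [bw|bw] := leqP (box_weight z) M.
1,3: have -> : (box_weight z - M = 0)%N by apply/eqP.
1,2: apply: (@leq_trans #|pred1 (0 : vec)|); last by rewrite card1.
1,2: apply/subset_leq_card/fintype.subsetP => k; rewrite !inE => /andP[kV kz];
  apply: contraTT bw => k0; rewrite -ltnNge;
  exact: leq_trans (V_weight kV k0) (in_box_weight kz).
  (* The remaining case with N = 0 is void: an empty box has weight 0. *)
  move: bw; rewrite /box_weight big1// => j _.
  have : (z j <= 0)%N by rewrite -zN (bigD1 j)//= leq_addr.
  by rewrite leqn0 => /eqP ->; rewrite big_ord0.
have [j0 zj0] : exists j, (0 < z j)%N.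
  apply/existsP; apply: contra_eqT zN => /existsPn H; rewrite big1// => j _.
  by apply/eqP; rewrite -leqn0 leqNgt H.
pose z' j := if j == j0 then (z j).-1 else z j.
have z'N : (\sum_j z' j)%N = N.
  apply/eqP; rewrite -eqSS -zN (bigD1 j0)//= [X in _ == X](bigD1 j0)//=.
  rewrite /z' eqxx -addSn prednK//; apply/eqP; congr (_ + _)%N.
  by apply: eq_bigr => j /negPf ->.
have z'n j : (z' j <= n)%N.
  by rewrite /z'; case: ifP => _ //; rewrite (leq_trans (leq_pred _)).
have bw' : box_weight z = (box_weight z' + minn a (z j0))%N.
  rewrite /box_weight (bigD1 j0)//= [in RHS](bigD1 j0)//= /z' eqxx addnAC; congr (_ + _)%N.
    by case: (z j0) zj0 => // q _; rewrite big_ord_recr.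
  by apply: eq_bigr => j /negPf ->.
have i0p : ((z j0).-1 < n)%N by rewrite prednK.
pose i0 := Ordinal i0p; pose d k : F := k j0 0 i0.
have fib c : (#|[pred k in V | in_box z k && (d k == c)]| <= #|[pred k in V | in_box z' k]|)%N.
  have [k0 /=|noA] := pickP [pred k in V | in_box z k && (d k == c)]; last by rewrite eq_card0.
  move=> /and3P[k0V /forallP k0z /eqP dk0].
  rewrite -(card_imset _ (subIr k0)); apply/subset_leq_card/fintype.subsetP => _ /imsetP[k + ->].
  rewrite !inE => /and3P[kV /forallP kz /eqP dk]; rewrite VB//=.
  apply/forallP => j; apply/forallP => i; apply/implyP.
  rewrite /z' !ffunE !mxE; have [->|_] := eqVneq j j0; last first.
    move=> zi; have /forallP/(_ i)/implyP/(_ zi)/eqP -> := kz j.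
    by have /forallP/(_ i)/implyP/(_ zi)/eqP -> := k0z j; rewrite subrr.
  rewrite leq_eqVlt => /predU1P[E|zi].
    have -> : i = i0 by apply: val_inj.
    by rewrite -/(d k) -/(d k0) dk dk0 subrr.
  rewrite prednK// in zi; have /forallP/(_ i)/implyP/(_ zi)/eqP -> := kz j0.
  by have /forallP/(_ i)/implyP/(_ zi)/eqP -> := k0z j0; rewrite subrr.
have : (#|[pred k in V | in_box z k]| <= p * #|[pred k in V | in_box z' k]|)%N.
  rewrite -sum1_card (partition_big d xpredT)//=.
  rewrite -[X in (X * _)%N](card_Fp p_prime) -sum_nat_const; apply: leq_sum => c _.
  rewrite sum1_card; apply: leq_trans (fib c); apply: subset_leq_card.
  apply/fintype.subsetP => k /andP[kA dk]; move: kA; rewrite !inE => /andP[-> ->] /=.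
  exact: dk.
move=> H; apply: leq_trans H _; apply: leq_trans (leq_mul (leqnn p) (IHN z' z'N z'n)) _.
rewrite -expnS leq_exp2l ?prime_gt1//; move: bw; rewrite bw'.
have : (0 < minn a (z j0))%N by rewrite leq_min a_gt0.
lia.
Qed.

Definition tops k : {ffun 'I_s -> n.-tuple F} :=
  [ffun j => tcast (etrans (size_top_digits a (row_tuple (k j))) (size_tuple _))
               (in_tuple (top_digits a (row_tuple (k j))))].

Lemma topsE k j : tops k j = top_digits a (row_tuple (k j)) :> seq F.
Proof. by rewrite ffunE val_tcast. Qed.

(** After translation by one of its members the fibre lies in the box of free positions. That box
    weighs at most as much as [kap]: a free position counts min(a, i + 1) in the box and [a] in
    [kap]. *)
Lemma card_tops (kap : {ffun 'I_s -> n.-tuple F}) :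
  (#|[pred k in V | (tops k == kap) && (k != 0%R)]| <=
     p ^ ((\sum_j digit_weight a (kap j)) - M))%N.
Proof.
have [k0 /=|noA] := pickP [pred k in V | (tops k == kap) && (k != 0)]; last by rewrite eq_card0.
move=> /and3P[k0V /eqP tk0 k0n0].
pose z j := free_digits a (kap j).
have zn j : (z j <= n)%N by rewrite (leq_trans (free_digits_le _ _))// size_tuple.
have bz : (box_weight z <= \sum_j digit_weight a (kap j))%N.
  apply: leq_sum => j _; apply: leq_trans (free_digits_weight a (kap j)).
  rewrite -[X in (_ <= _ * X)%N]card_ord mulnC -sum_nat_const; apply: leq_sum => i _.
  exact: geq_minl.
apply: (@leq_trans #|[pred k in V | in_box z k]|); last first.
  by apply: leq_trans (card_box zn) _; rewrite leq_exp2l ?prime_gt1// leq_sub2r.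
rewrite -(card_imset _ (subIr k0)); apply/subset_leq_card/fintype.subsetP => _ /imsetP[k + ->].
rewrite !inE => /and3P[kV /eqP tk _]; rewrite VB//=.
apply/forallP => j; apply/forallP => i; apply/implyP => zi.
rewrite !ffunE !mxE -!nth_row_tuple subr_eq0; apply/eqP.
have tE : top_digits a (row_tuple (k j)) = top_digits a (row_tuple (k0 j)).
  by rewrite -!topsE tk tk0.
by apply: nth_top_digits_eq tE _; rewrite ?size_tuple// -topsE tk.
Qed.

Lemma sum_tuple_pow (y : R) q : \sum_(t : q.-tuple F) y ^+ nz t = (1 + (p%:R - 1) * y) ^+ q.
Proof.
elim: q => [|q IHq].
  rewrite (big_pred1 [tuple]) ?expr0// => t; apply/esym/eqP; exact: tuple0.
rewrite big_tuple_cons exprS -IHq; under eq_bigr do under eq_bigr do rewrite /= exprD.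
under eq_bigr do rewrite -big_distrr /=.
rewrite -big_distrl /=; congr (_ * _); rewrite (bigD1 0)//= expr0; congr (_ + _).
rewrite (eq_bigr (fun=> y)) => [|c /negPf c0]; last by rewrite c0 expr1.
rewrite sumr_const -[y *+ _]mulr_natl; congr (_ * _).
have : (#|[pred c : F | c != 0%R]| + 1 = p)%N.
  rewrite addn1 (eq_card (B := predC1 (0 : F)))// cardC1 card_Fp// prednK//.
  exact: prime_gt0.
by move=> /(congr1 (fun q : nat => q%:R : R)); rewrite natrD => <-; rewrite addrK.
Qed.

(* Rankin's trick: with y = 1 / ((p - 1) m), the r-th power of p / 4 is at most
   (x m)^a y^r for r <= a, and the sum of y^r over all tuples factors. *)
Lemma sum_tuple_decay (x : R) (m : nat) : (0 < m)%N -> 1 <= x -> (p%:R - 1) * (p%:R / 4) <= x ->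
  \sum_(t : n.-tuple F | (nz t <= a)%N) (p%:R / 4) ^+ nz t <=
    (x * m%:R) ^+ a * (1 + m%:R^-1) ^+ n.
Proof.
move=> m0 x1 xp; have p1 : 0 < p%:R - 1 :> R by rewrite subr_gt0 ltr1n prime_gt1.
have mR : 1 <= m%:R :> R by rewrite ler1n.
pose y : R := ((p%:R - 1) * m%:R)^-1.
have y0 : 0 <= y by rewrite invr_ge0 mulr_ge0// ltW.
have -> : 1 + m%:R^-1 = 1 + (p%:R - 1) * y.
  by rewrite /y; congr (_ + _); field; rewrite !gt_eqF//; lra.
rewrite -sum_tuple_pow big_distrr /= [leLHS]big_mkcond /=; apply: ler_sum => t _.
have xm1 : 1 <= x * m%:R by nra.
case: ifP => [ta|_]; last by rewrite mulr_ge0 ?exprn_ge0// (le_trans ler01).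
apply: (@le_trans _ _ ((x * m%:R) ^+ nz t * y ^+ nz t)).
  rewrite -exprMn; apply: lerXn2r; rewrite ?nnegrE ?divr_ge0 ?mulr_ge0//; try lra.
  have -> : p%:R / 4 = (p%:R - 1) * (p%:R / 4) * m%:R * y.
    by rewrite /y; field; rewrite !gt_eqF//; lra.
  by rewrite ler_wpM2r// ler_wpM2r.
by rewrite ler_wpM2r ?exprn_ge0// ler_weXn2l.
Qed.

(** [walsh_decay] depends only on the top digits. A fibre over top digits of weight W has at most
    p^(W - M) members, each contributing p^-W times powers of p / 4. So p^-M comes out, and the rest
    is a product over the coordinates. *)
Lemma dual_decay_sum u (x : R) (m : nat) :
    (0 < m)%N -> 1 <= x -> (p%:R - 1) * (p%:R / 4) <= x ->
  \sum_(k | [&& k \in V, k != 0 & [forall j, (j \notin u) ==> (k j == 0)]])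
     \prod_j walsh_decay R a (row_tuple (k j)) <=
  (p%:R ^+ M)^-1 * ((x * m%:R) ^+ a * (1 + m%:R^-1) ^+ n) ^+ #|u|.
Proof.
move=> m0 x1 xp; have p0 : 0 < p%:R :> R by rewrite ltr0n prime_gt0.
(* Outside u only the zero tuple counts. Inside u the sum is enlarged to all tuples with at most [a]
   nonzero digits, whether or not they arise from a dual vector. *)
pose g j (t : n.-tuple F) : R := if j \in u then (if (nz t <= a)%N then (p%:R / 4) ^+ nz t else 0)
  else (all (pred1 0) t)%:R.
have g_ge0 j t : 0 <= g j t.
  by rewrite /g; case: ifP => _; [case: ifP => _|]; rewrite ?exprn_ge0 ?divr_ge0.
pose X := (x * m%:R) ^+ a * (1 + m%:R^-1) ^+ n.
have gsum j : \sum_t g j t <= if j \in u then X else 1.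
  rewrite /g; case: ifP => _; first by rewrite -big_mkcond; exact: sum_tuple_decay.
  rewrite (bigD1 [tuple 0 | _ < n])//= big1 ?addr0 => [|t tn0].
    by case: (all _ _).
  case: allP => // t0; case/eqP: tn0; apply: eq_from_tnth => i.
  by rewrite tnth_mktuple; apply/eqP/t0/mem_tnth.
have -> : X ^+ #|u| = \prod_j (if j \in u then X else 1).
  by rewrite -big_mkcond prodr_const.
apply: (@le_trans _ _ ((p%:R ^+ M)^-1 * \prod_j \sum_t g j t)); last first.
  rewrite ler_wpM2l ?invr_ge0 ?exprn_ge0//; apply: ler_prod => j _.
  by rewrite gsum andbT; apply: sumr_ge0 => t _; exact: g_ge0.
rewrite bigA_distr_bigA big_distrr /= (partition_big tops xpredT)//=.
apply: ler_sum => kap _.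
pose W := (\sum_j digit_weight a (kap j))%N.
have termE k : k \in [pred k in V | (tops k == kap) && (k != 0)] ->
    [forall j, (j \notin u) ==> (k j == 0)] ->
  \prod_j walsh_decay R a (row_tuple (k j)) = (p%:R ^+ W)^-1 * \prod_j g j (kap j) /\ (M < W)%N.
  rewrite inE => /and3P[kV /eqP tk kn0] /forallP ku.
  have WE : vec_weight k = W.
    by apply: eq_bigr => j _; rewrite -tk topsE digit_weight_top_digits.
  split; last by rewrite -WE; exact: V_weight.
  rewrite -WE /vec_weight -prodrXr -prodfV -big_split; apply: eq_bigr => j _.
  rewrite /g -tk topsE /walsh_decay mulrC -nzcount_top_digits; congr (_ * _).
  have nzE : nzcount a (top_digits a (row_tuple (k j))) = nz (top_digits a (row_tuple (k j))).
    by apply/minn_idPr/nz_top_digits.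
  rewrite nz_top_digits nzE; case: ifPn => // ju.
  have /implyP/(_ ju)/eqP kj0 := ku j.
  have t0 : all (pred1 0) (top_digits a (row_tuple (k j))).
    by apply: all0_top_digits; apply/allP => c /tnthP[i ->]; rewrite kj0 tnth_mktuple mxE /=.
  by rewrite t0 (_ : nz _ = 0%N) ?expr0//; apply/eqP; rewrite -leqn0 leqNgt -has_count has_predC t0.
have pg0 : 0 <= \prod_j g j (kap j) by apply: prodr_ge0.
pose P k := [&& k \in V, k != 0 & [forall j, (j \notin u) ==> (k j == 0)]] && (tops k == kap).
pose A := [pred k in V | (tops k == kap) && (k != 0)].
have PA k : P k -> k \in A /\ [forall j, (j \notin u) ==> (k j == 0)].
  by rewrite /P inE => /andP[/and3P[-> -> ->] ->].
(* A nonempty fibre has W > M, so the truncated difference W - M is the true one. *)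
have [[k0 Pk0]|noP] := pselect (exists k, P k); last first.
  rewrite big_pred0 => [|k]; first by rewrite mulr_ge0// invr_ge0 exprn_ge0.
  by apply/negP => Pk; apply: noP; exists k; exact: Pk.
have [k0A k0u] := PA _ Pk0; have [_ MW] := termE _ k0A k0u.
rewrite (eq_bigr (fun=> (p%:R ^+ W)^-1 * \prod_j g j (kap j))) => [|k /PA[kA ku]]; last first.
  by have [] := termE _ kA ku.
rewrite sumr_const -[_ *+ _]mulr_natl mulrA ler_wpM2r// -(ler_pM2r (exprn_gt0 W p0)).
rewrite mulfVK ?gt_eqF ?exprn_gt0//.
have -> : (p%:R ^+ M)^-1 * p%:R ^+ W = (p ^ (W - M))%:R :> R.
  by rewrite natrX -[in p%:R ^+ W](subnK (ltnW MW)) exprD mulrC mulfK// gt_eqF ?exprn_gt0.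
rewrite ler_nat; apply: leq_trans (card_tops kap).
by apply/subset_leq_card/fintype.subsetP => k /PA[].
Qed.

End DualCounting.

(** * Richardson extrapolation *)

Section Extrapolation.
Variables (R : realType) (p : nat).
Hypothesis p_prime : prime p.
Implicit Types (a b : nat -> R) (tau i : nat).

Let p_gt1 : 1 < p%:R :> R. Proof. by rewrite ltr1n prime_gt1. Qed.

(** The recursion of [richardson] on an arbitrary sequence, so that the k = 0 term and the remainder
    can be extrapolated separately. *)
Fixpoint extrapolate a tau i : R :=
  if tau is tau'.+1 then
    (p%:R ^+ tau * extrapolate a tau' i.+1 - extrapolate a tau' i) / (p%:R ^+ tau - 1)
  else a i.

Lemma richardsonE s n m (C : 'I_s -> 'M['F_p]_(n, m)) f tau i :
  richardson C f tau i =
  extrapolate (fun i => net_average (fun j => upper_rows (m + i) (C j)) f) tau i.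
Proof. by elim: tau i => //= tau IH i; rewrite !IH. Qed.

Lemma powp_neq1 tau : p%:R ^+ tau.+1 - 1 != 0 :> R.
Proof. by rewrite subr_eq0 gt_eqF// exprn_egt1. Qed.

Lemma richardson_weightS tau i : (0 < i <= tau)%N ->
  p%:R ^+ tau.+1 * richardson_weight R p tau.+1 i.-1 - richardson_weight R p tau.+1 i =
  (p%:R ^+ tau.+1 - 1) * richardson_weight R p tau.+2 i.
Proof.
case: i => // i /= it; have [d ->] : exists d, tau = (i.+1 + d)%N by exists (tau - i.+1)%N; lia.
rewrite /richardson_weight.
have -> : ((i.+1 + d).+1 - i = d.+2)%N by lia.
have -> : ((i.+1 + d).+1 - i.+1 = d.+1)%N by lia.
have -> : ((i.+1 + d).+2 - i.+1 = d.+2)%N by lia.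
rewrite [\prod_(1 <= j < d.+2) _]big_nat_recr//= [\prod_(1 <= j < i.+2) _]big_nat_recr//=.
move: (\prod_(1 <= j < d.+1) _) (\prod_(1 <= j < i.+1) _) => X Y.
have -> : (i.+1 + d).+1 = (i.+1 + d.+1)%N by lia.
rewrite exprD; move: (powp_neq1 d) (powp_neq1 i).
by move: (p%:R ^+ d.+1) (p%:R ^+ i.+1) => A B hA hB; field; rewrite hA hB.
Qed.

(** The inner weights satisfy the recursion by [richardson_weightS]; the two end weights receive a
    single contribution each and are treated apart. *)
Lemma extrapolateE a tau i :
  extrapolate a tau i = \sum_(l < tau.+1) richardson_weight R p tau.+1 l * a (i + l)%N.
Proof.
elim: tau i => [|tau IH] i.
  by rewrite big_ord1 /richardson_weight !big_geq// !mul1r addn0.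
have pn := powp_neq1 tau.
have w0 : richardson_weight R p tau.+2 0 = - richardson_weight R p tau.+1 0 / (p%:R ^+ tau.+1 - 1).
  rewrite /richardson_weight !subn0 big_nat_recr//= !(@big_geq _ _ _ 1 1)// !mulr1 mulNr mul1r.
  by rewrite mulrN mulNr.
have wn : richardson_weight R p tau.+2 tau.+1 =
    p%:R ^+ tau.+1 * richardson_weight R p tau.+1 tau / (p%:R ^+ tau.+1 - 1).
  rewrite /richardson_weight !subSnn !(@big_geq _ _ _ 1 1)// !mul1r big_nat_recr//=.
  by field.
pose w := richardson_weight R p tau.+1; pose w' := richardson_weight R p tau.+2.
have e1 : \sum_(l < tau.+1) w l * a (i.+1 + l)%N =
    \sum_(l < tau) w l * a (i + l.+1)%N + w tau * a (i + tau.+1)%N.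
  by rewrite big_ord_recr /= addSnnS; congr (_ + _); apply: eq_bigr => l _; rewrite addSnnS.
have e2 : \sum_(l < tau.+1) w l * a (i + l)%N =
    w 0 * a i + \sum_(l < tau) w l.+1 * a (i + l.+1)%N.
  by rewrite big_ord_recl /= addn0; congr (_ + _); apply: eq_bigr => l _; rewrite /bump /= add1n.
have e3 : \sum_(l < tau.+2) w' l * a (i + l)%N =
    w' 0 * a i + \sum_(l < tau) w' l.+1 * a (i + l.+1)%N + w' tau.+1 * a (i + tau.+1)%N.
  by rewrite big_ord_recr big_ord_recl /= addn0; congr (_ + _ + _).
have e4 : (p%:R ^+ tau.+1 - 1) * (\sum_(l < tau) w' l.+1 * a (i + l.+1)%N) =
    p%:R ^+ tau.+1 * (\sum_(l < tau) w l * a (i + l.+1)%N) - \sum_(l < tau) w l.+1 * a (i + l.+1)%N.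
  rewrite !big_distrr /= -sumrB; apply: eq_bigr => l _.
  have E := @richardson_weightS tau l.+1 (ltn_ord l); rewrite -/w -/w' /= in E.
  by rewrite [LHS]mulrA -E; ring.
rewrite [LHS]/= !IH -/w -/w' e1 e2 e3; apply: (mulIf pn); rewrite mulfVK//.
rewrite 2!mulrDl [X in _ = _ + X + _]mulrC e4 /w' w0 wn -/w.
by move: (p%:R ^+ tau.+1) pn => A hA; field.
Qed.

Lemma eq_extrapolate a b tau i : (forall l, a l = b l) -> extrapolate a tau i = extrapolate b tau i.
Proof. by move=> E; elim: tau i => //= tau IH i; rewrite !IH. Qed.

Lemma extrapolateD a b tau i :
  extrapolate (fun l => a l + b l) tau i = extrapolate a tau i + extrapolate b tau i.
Proof. by elim: tau i => //= tau IH i; rewrite !IH; ring. Qed.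

Lemma extrapolate_cst (c : R) tau i : extrapolate (fun=> c) tau i = c.
Proof.
elim: tau i => //= tau IH i; rewrite !IH; have := powp_neq1 tau.
by move: (p%:R ^+ tau.+1) => A hA; field.
Qed.

(** A sequence of ratio p^-T is an eigenvector of each step: step tau + 1 multiplies it by
    (p^(tau+1-T) - 1) / (p^(tau+1) - 1), which vanishes at tau + 1 = T. *)
Lemma extrapolate_geometric (c : R) T tau i : (0 < T <= tau)%N ->
  extrapolate (fun l => c * (p%:R ^+ T)^-1 ^+ l) tau i = 0.
Proof.
have p0 : (p%:R : R) != 0 by rewrite gt_eqF// (lt_trans ltr01).
move=> Tt; suff [K ->] : exists K, forall i, extrapolate (fun l => c * (p%:R ^+ T)^-1 ^+ l) tau i =
    (if (0 < T <= tau)%N then 0 else K) * (p%:R ^+ T)^-1 ^+ i by rewrite Tt mul0r.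
elim: tau {i Tt} => [|tau [K IH]]; first by exists c => i; case: T.
have pn := powp_neq1 tau; have pA := expf_neq0 tau.+1 p0.
have step i : extrapolate (fun l => c * (p%:R ^+ T)^-1 ^+ l) tau.+1 i =
    (if (0 < T <= tau)%N then 0 else K) * (p%:R ^+ tau.+1 * (p%:R ^+ T)^-1 - 1) /
      (p%:R ^+ tau.+1 - 1) * (p%:R ^+ T)^-1 ^+ i.
  rewrite [LHS]/= !IH [_ ^+ i.+1]exprS; move: (if _ then _ else _) => K'.
  move: (p%:R ^+ tau.+1) pn (p%:R ^+ T)^-1 => A hA r.
  by move: (r ^+ i) => ri; field.
exists (K * (p%:R ^+ tau.+1 * (p%:R ^+ T)^-1 - 1) / (p%:R ^+ tau.+1 - 1)) => i.
rewrite step; case: (ltnP 0 T) => //= T0.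
case: (ltngtP T tau.+1) => [Tt|Tt|E].
- by rewrite -ltnS Tt !mul0r.
- by rewrite leqNgt (ltnW Tt).
- by rewrite E ltnn divff// subrr mulr0 !mul0r.
Qed.

Lemma extrapolate_le a (B : R) tau : (forall l, (l <= tau)%N -> `|a l| <= B) ->
  `|extrapolate a tau 0| <= (\sum_(0 <= l < tau.+1) `|richardson_weight R p tau.+1 l|) * B.
Proof.
move=> aB; rewrite extrapolateE (le_trans (ler_norm_sum _ _ _))// big_mkord big_distrl /=.
by apply: ler_sum => l _; rewrite normrM add0n ler_wpM2l// aB// -ltnS.
Qed.

End Extrapolation.

(** * The error of extrapolated nets on the kernels *)

Section KernelBound.
Variables (R : realType) (p s a m t : nat) (C : 'I_s -> 'M['F_p]_(a * m, m)).
Hypotheses (p_prime : prime p) (a_ge2 : (2 <= a)%N) (m_gt0 : (0 < m)%N).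
Hypothesis C_net : order_digital_net a t C.
Variables (u v : {set 'I_s}) (beta : {ffun 'I_s -> 'I_a.+1}).
Hypothesis v_sub : v \subset u.
Hypothesis beta_uv : deriv_index u v beta.

Local Notation nc := (@Normc.normc R).
Local Notation toC := (real_complex R).
Local Notation F := 'F_p.
Local Notation M := (a * m - t)%N.

Let pR_gt0 : 0 < p%:R :> R. Proof. by rewrite ltr0n prime_gt0. Qed.

Definition kernel_factor (y : cube_point R s) (j : 'I_s) (x : R) : R :=
  if j \in v then bern_per a (tnth y j - x) else if j \in u then bern (beta j) x else 1.

(** The coefficient of the j-th factor at k = 0, stripped of its power p^(-n beta_j). *)
Definition grid_mean (y : cube_point R s) (n : nat) (j : 'I_s) : R :=
  if j \in v then bern_per a (p%:R ^+ n * tnth y j) else if j \in u then bern (beta j) 0 else 1.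

Section FixedPrecision.
Variables (i : nat) (i_lt : (i < a)%N) (om : R[i]).
Hypotheses (omX : om ^+ p = 1) (om_neq1 : om != 1).
Let n := (m + i)%N.
Let C' j := upper_rows n (C j).

Let n_le : (n <= a * m)%N. Proof. rewrite /n; nia. Qed.

Local Notation vec := {ffun 'I_s -> 'rV[F]_n}.

Lemma dual_mem_sub (k k' : vec) : dual_mem C' k -> dual_mem C' k' -> dual_mem C' (k - k').
Proof.
move=> /eqP kC /eqP k'C; apply/eqP.
rewrite (eq_bigr (fun j => (C' j)^T *m (k j)^T - (C' j)^T *m (k' j)^T)) => [|j _].
  by rewrite sumrB kC k'C subrr.
by rewrite !ffunE raddfB /= mulmxBr.
Qed.

(** As n <= a m, padding with zero digits turns a dual vector of the first n rows into one of the
    full net; every truncated net inherits the weight bound of [C]. *)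
Lemma dual_mem_weight (k : vec) : dual_mem C' k -> k != 0 -> (M < vec_weight a k)%N.
Proof.
move=> /eqP kC k0; pose K j := nat_of_digits (row_tuple (k j)).
have [_ /(_ K)] := C_net; rewrite /mu_vec.
under eq_bigr do rewrite mu_nat_of_digits//.
apply.
  rewrite /dual_net /= -[RHS]kC; apply: eq_bigr => j _; apply/colP => l; rewrite !mxE.
  pose f (i : nat) : F := (if insub i is Some i' then C j i' l else 0) * nth 0 (row_tuple (k j)) i.
  transitivity (\sum_(i < a * m) f i).
    apply: eq_bigr => i' _; rewrite !mxE /f valK digit_nat_of_digits//; congr (_ * _).
    by rewrite natr_Zp.
  transitivity (\sum_(i < n) f i); last first.
    by apply: eq_bigr => i' _; rewrite !mxE /f /= nth_row_tuple.
  rewrite (big_ord_widen _ f n_le) [RHS]big_mkcond /=; apply: eq_bigr => i' _.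
  case: ltnP => // ni; rewrite /f [nth _ _ _]nth_default ?mulr0//.
  by rewrite size_tuple.
move=> K0; case/eqP: k0; apply/ffunP => j; rewrite ffunE; apply/rowP => l; rewrite mxE.
have := congr1 (fun g => g j) K0; rewrite /K => /(nat_of_digits_eq0 p_prime)/allP H.
by apply/eqP/H/tnthP; exists l; rewrite tnth_mktuple.
Qed.

Lemma nc_walsh_kernel y j (ks : seq F) :
  nc (walsh_coef om ks (fun x => toC (kernel_factor y j x))) <=
  (if j \in u then 3 else 1) * walsh_decay R a ks.
Proof.
have /forallP/(_ j) := beta_uv; rewrite /kernel_factor.
have w0 : 0 <= walsh_decay R a ks by exact: walsh_decay_ge0.
case: ifP => [jv|_] bj.
  rewrite (fintype.subsetP v_sub _ jv).
  exact: walsh_coef_bern_per.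
case: ifP bj => ju bj.
  apply: (@le_trans _ _ (walsh_decay R a ks)); last by rewrite ler_peMl//; lra.
  by apply: walsh_coef_bern; rewrite // -ltnS ltn_ord.
apply: walsh_coef_bound => //; apply: (@diff_bounded_eq _ _ _ _ (fun x => toC (1%:P).[x])).
  by move=> x _; rewrite hornerC.
apply: diff_bounded_poly => x _; case: (nzcount a ks) => [|r].
  by rewrite derivn0 hornerC normr1.
by rewrite derivnC /= horner0 normr0.
Qed.

Lemma walsh_kernel0 y j :
  walsh_coef om (row_tuple (0 : 'rV[F]_n)) (fun x => toC (kernel_factor y j x)) =
  toC ((p%:R ^+ n)^-1 ^+ beta j * grid_mean y n j).
Proof.
have r0 : row_tuple (0 : 'rV[F]_n) = nseq n 0 :> seq F.
  apply: (@eq_from_nth _ 0); rewrite ?size_tuple ?size_nseq// => l ln.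
  by rewrite nth_nseq ln (nth_row_tuple _ (Ordinal ln)) mxE.
have /forallP/(_ j) := beta_uv; rewrite r0 /kernel_factor /grid_mean.
case: ifP => [jv /eqP ->|_]; first exact: walsh_coef0_bern_per.
case: ifP => [ju _|ju /eqP ->]; first exact: walsh_coef0_bern.
by rewrite walsh_coef0_cst// expr0 mulr1.
Qed.

Definition kernel (y x : cube_point R s) : R := \prod_j kernel_factor y j (tnth x j).

(** Contribution of one coordinate of u: the constant 3 of the Walsh coefficients times the bound of
    [sum_tuple_decay] at m + a - 1, the largest precision in the extrapolation. *)
Definition decay_base (x : R) : R := 3 * ((x * m%:R) ^+ a * (1 + m%:R^-1) ^+ (m + a.-1)).

(** The subtracted product is the term k = 0. Dual vectors with a nonzero component outside u drop
    out, because the factor there is the constant 1. *)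
Lemma net_kernel_error y (x : R) : 1 <= x -> (p%:R - 1) * (p%:R / 4) <= x ->
  `|net_average C' (kernel y) - \prod_j ((p%:R ^+ n)^-1 ^+ beta j * grid_mean y n j)| <=
  (p%:R ^+ M)^-1 * decay_base x ^+ #|u|.
Proof.
move=> x1 xp.
have dual0 : dual_mem C' (0 : vec).
  by apply/eqP; rewrite big1// => j _; rewrite ffunE trmx0 mulmx0.
have E : toC (net_average C' (kernel y)) =
    \sum_(k | dual_mem C' k) \prod_j walsh_coef om (row_tuple (k j)) (fun x => toC (kernel_factor y j x)).
  rewrite -(net_sum_product p_prime omX om_neq1) /net_average rmorphM rmorph_sum fmorphV rmorph_nat.
  by congr (_ * _); apply: eq_bigr => h _; rewrite rmorph_prod.
have EB (A B : R) : toC (A - B) = toC A - toC B by exact: rmorphB.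
rewrite -nc_real EB E (bigD1 (0 : vec))//.
have -> : toC (\prod_j ((p%:R ^+ n)^-1 ^+ beta j * grid_mean y n j)) =
    \prod_j walsh_coef om (row_tuple ((0 : vec) j)) (fun x => toC (kernel_factor y j x)).
  by rewrite rmorph_prod; apply: eq_bigr => j _; rewrite ffunE walsh_kernel0.
rewrite addrAC subrr add0r; apply: le_trans (nc_sum _ _ _) _.
have Wle (k : vec) : nc (\prod_j walsh_coef om (row_tuple (k j)) (fun x => toC (kernel_factor y j x))) <=
    if [forall j, (j \notin u) ==> (k j == 0)]
    then 3 ^+ #|u| * \prod_j walsh_decay R a (row_tuple (k j)) else 0.
  rewrite nc_prod; case: ifPn => [_|].
    have -> : 3 ^+ #|u| = \prod_j (if j \in u then 3 else 1) :> R by rewrite -big_mkcond prodr_const.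
    rewrite -big_split /=; apply: ler_prod => j _; rewrite nc_ge0 /=.
    exact: nc_walsh_kernel.
  rewrite negb_forall => /existsP[j]; rewrite negb_imply => /andP[ju kj].
  rewrite (bigD1 j)//= [X in X * _](_ : _ = 0) ?mul0r//.
  have jv : j \in v = false by apply: contraNF ju; exact: (fintype.subsetP v_sub).
  rewrite /kernel_factor jv (negbTE ju) walsh_coef_cst ?nc0//.
  apply: contraR kj; rewrite has_predC negbK => /allP kj; apply/eqP/rowP => l.
  by rewrite mxE; apply/eqP/kj/map_f; rewrite mem_enum.
apply: le_trans (ler_sum _ (fun k _ => Wle k)) _.
rewrite -big_mkcondr /= -big_distrr /=.
have V_w (k : vec) : k \in dual_mem C' -> k != 0 -> (M < vec_weight a k)%N by exact: dual_mem_weight.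
have V_s (k k' : vec) : k \in dual_mem C' -> k' \in dual_mem C' -> k - k' \in dual_mem C'.
  exact: dual_mem_sub.
have a0 : (0 < a)%N by exact: leq_trans a_ge2.
have := @dual_decay_sum R p s n a M p_prime a0 (dual_mem C') V_s V_w u x m m_gt0 x1 xp => H.
apply: (@le_trans _ _ (3 ^+ #|u| * ((p%:R ^+ M)^-1 * ((x * m%:R) ^+ a * (1 + m%:R^-1) ^+ n) ^+ #|u|))).
  rewrite ler_wpM2l ?exprn_ge0//; apply: le_trans H; rewrite le_eqVlt; apply/orP; left; apply/eqP.
  by apply: eq_bigl => k; rewrite andbA.
rewrite mulrCA ler_wpM2l ?invr_ge0 ?exprn_ge0//.
rewrite -exprMn; apply: lerXn2r; rewrite ?nnegrE.
- by rewrite !mulr_ge0 ?exprn_ge0 ?mulr_ge0 ?addr_ge0 ?invr_ge0//; lra.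
- by rewrite !mulr_ge0 ?exprn_ge0 ?mulr_ge0 ?addr_ge0 ?invr_ge0//; lra.
rewrite /decay_base ler_wpM2l// ler_wpM2l ?exprn_ge0 ?mulr_ge0//; first lra.
by rewrite ler_weXn2l ?lerDl ?invr_ge0// leq_add2l -ltnS prednK.
Qed.

End FixedPrecision.

Lemma bern_per_le_D (x : R) : `|bern_per a x| <= const_D R a.
Proof.
rewrite /const_D le_max; apply/orP; right.
have floor01 (z : R) : 0 <= z - (Num.floor z)%:~R < 1.
  by have := floor_itv z; rewrite intrD1; lra.
have per : bern_per a x = bern_per a (x - (Num.floor x)%:~R).
  by rewrite -[LHS](bern_per_int _ _ (- Num.floor x)) rmorphN.
rewrite per; apply: ub_le_sup; last first.
  by exists (x - (Num.floor x)%:~R) => //=; rewrite in_itv /=.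
exists 1 => _ [z /= _ <-]; rewrite /bern_per bernE bernp_le1//.
by have := floor01 z; lra.
Qed.

Lemma bern0_le_D tau : (0 < tau <= a)%N -> `|bern tau (0 : R)| <= const_D R a.
Proof.
case/andP => t0; rewrite leq_eqVlt => /predU1P[->|ta].
  have -> : bern a (0 : R) = bern_per a 0 by rewrite /bern_per floor0 subr0.
  exact: bern_per_le_D.
rewrite /const_D le_max; apply/orP; left.
apply: (@order.Order.TotalTheory.le_bigmax_seq _ R _ _ 0 tau xpredT (fun tau => `|bern tau (0 : R)|)) => //.
by rewrite mem_index_iota t0.
Qed.

Lemma const_D_ge0 : 0 <= const_D R a.
Proof. exact: le_trans (bern_per_le_D 0). Qed.

Lemma primitive_root_exists : exists2 om : R[i], om ^+ p = 1 & om != 1.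
Proof.
have p0 := prime_gt0 p_prime.
have sz : size (\poly_(i < p) (1 : R[i])) = p by rewrite size_poly_eq ?oner_eq0.
have /closed_rootP[om /rootP om0] : size (\poly_(i < p) (1 : R[i])) != 1%N.
  by rewrite sz gtn_eqF// prime_gt1.
rewrite horner_poly in om0; have S0 : \sum_(i < p) om ^+ i = 0.
  by rewrite -[RHS]om0; apply: eq_bigr => i _; rewrite mul1r.
exists om; first by apply/eqP; rewrite -subr_eq0 subrX1 S0 mulr0.
apply/eqP => om1; move: S0; rewrite om1; under eq_bigr do rewrite expr1n.
by rewrite sumr_const card_ord => /eqP; rewrite pnatr_eq0 gtn_eqF.
Qed.

Lemma kernel_error y (x : R) : 1 <= x -> (p%:R - 1) * (p%:R / 4) <= x -> u != finset.set0 ->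
  `|richardson C (kernel y) a.-1 0| <=
  (\sum_(0 <= l < a) `|richardson_weight R p a l|) *
    ((p%:R ^+ M)^-1 * decay_base x ^+ #|u| + (p%:R ^+ (a * m))^-1 * const_D R a ^+ #|u|).
Proof.
move=> x1 xp u0; have [om omX om1] := primitive_root_exists.
pose T := (\sum_j beta j)%N.
pose Z l := \prod_j ((p%:R ^+ (m + l))^-1 ^+ beta j * grid_mean y (m + l) j).
pose Q l := net_average (fun j => upper_rows (m + l) (C j)) (kernel y).
have QZ l : (l <= a.-1)%N -> `|Q l - Z l| <= (p%:R ^+ M)^-1 * decay_base x ^+ #|u|.
  move=> la; have la' : (l < a)%N by rewrite -(@prednK a) ?ltnS// (leq_trans _ a_ge2).
  exact: (net_kernel_error la' omX om1 y x1 xp).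
have a1 : a.-1.+1 = a by rewrite prednK// (leq_trans _ a_ge2).
have ZE l : Z l = (p%:R ^+ (m + l))^-1 ^+ T * \prod_j grid_mean y (m + l) j.
  by rewrite /Z big_split /= prodrXr.
have gm_le l : `|\prod_j grid_mean y l j| <= const_D R a ^+ #|u|.
  have -> : const_D R a ^+ #|u| = \prod_j (if j \in u then const_D R a else 1).
    by rewrite -big_mkcond prodr_const.
  rewrite normr_prod; apply: ler_prod => j _; rewrite normr_ge0 /=.
  have /forallP/(_ j) := beta_uv; rewrite /grid_mean; case: ifP => [jv _|_].
    by rewrite (fintype.subsetP v_sub _ jv) bern_per_le_D.
  case: ifP => _ bj; last by rewrite normr1.
  by rewrite bern0_le_D// bj -ltnS ltn_ord.
rewrite richardsonE (eq_extrapolate _ _ _ (b := fun l => (Q l - Z l) + Z l)) => [|l]; last first.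
  by rewrite subrK.
rewrite extrapolateD; apply: le_trans (ler_normD _ _) _; rewrite mulrDr; apply: lerD.
  by have := extrapolate_le p_prime QZ; rewrite a1.
have B0 : 0 <= (\sum_(0 <= l < a) `|richardson_weight R p a l|) *
    ((p%:R ^+ (a * m))^-1 * const_D R a ^+ #|u|).
  by rewrite mulr_ge0 ?sumr_ge0// mulr_ge0 ?exprn_ge0 ?const_D_ge0// invr_ge0 exprn_ge0.
(* T < a forces v to be empty: then Z is geometric with ratio p^-T, which the
   extrapolation kills. Otherwise Z is already of order p^(- a m). *)
have [Ta|Ta] := ltnP T a.
  have v0 j : j \in v = false.
    apply/negP => jv; have /forallP/(_ j) := beta_uv; rewrite jv => /eqP bj.
    by move: Ta; rewrite /T (bigD1 j)//= bj ltnNge leq_addr.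
  have T0 : (0 < T)%N.
    have [j ju] := set0Pn _ u0; have /forallP/(_ j) := beta_uv; rewrite v0 ju => bj.
    by rewrite /T (bigD1 j)//= addn_gt0 bj.
  have -> : extrapolate p Z a.-1 0 = 0; last by rewrite normr0.
  rewrite (eq_extrapolate _ _ _ (b := fun l => ((p%:R ^+ T)^-1 ^+ m * \prod_j grid_mean y 0 j) *
      (p%:R ^+ T)^-1 ^+ l)) => [|l].
    by apply: extrapolate_geometric; rewrite ?T0 // -ltnS a1.
  have -> : \prod_j grid_mean y 0 j = \prod_j grid_mean y (m + l) j.
    by apply: eq_bigr => j _; rewrite /grid_mean v0.
  rewrite ZE (_ : (p%:R ^+ (m + l))^-1 ^+ T = (p%:R ^+ T)^-1 ^+ (m + l)).
    by rewrite exprD; ring.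
  by rewrite !exprVn -!exprM mulnC.
have := @extrapolate_le R p p_prime Z ((p%:R ^+ (a * m))^-1 * const_D R a ^+ #|u|) a.-1.
rewrite a1; apply => l la; rewrite ZE normrM; apply: ler_pM => //.
rewrite ger0_norm ?exprn_ge0 ?invr_ge0 ?exprn_ge0 ?(ltW pR_gt0)//.
rewrite exprVn lef_pV2 ?posrE ?exprn_gt0// -exprM ler_weXn2l//; last by nia.
by rewrite ler1n prime_gt0.
Qed.

End KernelBound.

(** * Comparison of the constants *)

Section Constants.
Variable R : realType.
Implicit Types (p a m d t : nat).

Lemma sin_le (x : R) : 0 <= x -> sin x <= x.
Proof.
move=> x0; have := @MVT_bound R sin cos 0 x 1 x0 (@is_derive_sin R).
rewrite add0r sin0 subr0 mul1r => H; apply: le_trans (ler_norm _) _.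
by apply: H => z _; rewrite ler_norml cos_geN1 cos_le1.
Qed.

Lemma euler_bound m : (0 < m)%N -> (1 + m%:R^-1) ^+ m.-1 <= 3 :> R.
Proof.
move=> m0; have mR : 0 < m%:R :> R by rewrite ltr0n.
have e3 : expR 1 <= 3 :> R.
  (* The inequality 1 + x <= e^x at x = -1/7 gives 1/e >= (6/7)^7 > 1/3. *)
  have h : expR (- 7^-1) >= 6 / 7 :> R by apply: le_trans (expR_ge1Dx _); lra.
  have E : expR 1 * expR (- 7^-1) ^+ 7 = 1 :> R.
    by rewrite -expRM_natl -expRD (_ : _ + _ = 0) ?expR0//; field.
  have h7 : (6 / 7) ^+ 7 <= expR (- 7^-1) ^+ 7 :> R by apply: lerXn2r; rewrite ?nnegrE ?expR_ge0//; lra.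
  have h8 : 1 / 3 <= expR (- 7^-1) ^+ 7 :> R.
    by apply: le_trans h7; rewrite !exprS expr0; lra.
  have h9 : expR 1 * (1 / 3) <= 1 :> R by rewrite -[leRHS]E ler_wpM2l ?expR_ge0.
  lra.
apply: le_trans e3; apply: (@le_trans _ _ ((1 + m%:R^-1) ^+ m)).
  by rewrite ler_weXn2l ?lerDl ?invr_ge0 ?ltW// leq_pred.
apply: (@le_trans _ _ (expR m%:R^-1 ^+ m)).
  by apply: lerXn2r; rewrite ?nnegrE ?expR_ge0 ?addr_ge0 ?invr_ge0 ?(ltW mR)// expR_ge1Dx.
by rewrite -expRM_natl mulfV// gt_eqF.
Qed.

(** Here 9 = 3 * 3 joins the kernel constant to the bound for e, a + 1 counts kernels per
    coordinate, 20 = 2 * 10 comes from the lower bounds for A and C, and 5/4 is the slack kept in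
    [base_comparison]. *)
Lemma geometric_beats_linear a : (2 <= a)%N -> 9 * (a%:R + 1) <= 20 * (5 / 4) ^+ a :> R.
Proof.
case: a => [|[|[|a]]]// _; first by rewrite expr2; lra.
elim: a => [|a IHa]; first by rewrite !exprS expr0; lra.
rewrite exprS -natr1; have : 0 <= a%:R :> R by [].
by move: IHa; rewrite -[a.+3%:R]natr1 -[a.+2%:R]natr1 -[a.+1%:R]natr1; lra.
Qed.

Lemma const_A_ge2 p a : (1 < p)%N -> (2 <= a)%N -> 2 <= const_A R p a.
Proof.
move=> p1 a2; have pR : 1 < p%:R :> R by rewrite ltr1n.
have f0 i : 0 <= (p%:R - 1) / (p%:R ^+ i - 1) :> R.
  by rewrite divr_ge0 ?subr_ge0 ?exprn_ege1 ?(ltW pR).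
have e1 : \prod_(1 <= i < 2) ((p%:R - 1) / (p%:R ^+ i - 1)) = 1 :> R.
  by rewrite big_nat1 expr1 divff ?subr_eq0 ?gt_eqF.
rewrite /const_A [\sum_(1 <= w < a) _]big_ltn// e1.
have h1 : 0 <= \sum_(2 <= w < a) \prod_(1 <= i < w.+1) ((p%:R - 1) / (p%:R ^+ i - 1)) :> R.
  by apply: sumr_ge0 => w _; apply: prodr_ge0 => i _.
have h2 : 0 <= (p%:R ^+ a - 1) / (p%:R ^+ a - p%:R) *
    \prod_(1 <= i < a.+1) ((p%:R - 1) / (p%:R ^+ i - 1)) :> R.
  rewrite mulr_ge0//; last by apply: prodr_ge0 => i _.
  rewrite divr_ge0 ?subr_ge0 ?exprn_ege1 ?(ltW pR)//.
  by rewrite -[leLHS]expr1 ler_weXn2l ?(ltW pR)// (leq_trans _ a2).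
lra.
Qed.

Lemma sin_pi_div_gt0 p : (1 < p)%N -> 0 < sin (pi / p%:R) :> R.
Proof.
move=> p1; have pR : 1 < p%:R :> R by rewrite ltr1n.
apply: sin_gt0_pi; rewrite divr_gt0 ?pi_gt0//=; last lra.
by rewrite ltr_pdivrMr ?ltr_pMr ?pi_gt0//; lra.
Qed.

Lemma const_C_ge p a : (1 < p)%N -> 10 / (2 * sin (pi / p%:R)) ^+ a <= const_C R p a.
Proof.
move=> p1; have pR : 1 < p%:R :> R by rewrite ltr1n.
have s0 := sin_pi_div_gt0 p1; have S0 : 0 < 2 * sin (pi / p%:R) :> R by rewrite mulr_gt0.
have c1 : 1 <= (1 + p%:R^-1 + (p%:R * (p%:R + 1))^-1) ^+ (a - 2) :> R.
  apply: exprn_ege1; rewrite -addrA lerDl addr_ge0 ?invr_ge0 ?mulr_ge0//; lra.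
have c2 : 5 <= 3 + 2 / p%:R + (2 * p%:R + 1) / (p%:R - 1) :> R.
  have h1 : 0 <= 2 / p%:R :> R by rewrite divr_ge0.
  have h2 : 2 <= (2 * p%:R + 1) / (p%:R - 1) :> R by rewrite ler_pdivlMr ?subr_gt0//; lra.
  lra.
have q0 : 0 <= 2 / (2 * sin (pi / p%:R)) ^+ a :> R by rewrite divr_ge0// exprn_ge0// ltW.
have -> : 10 / (2 * sin (pi / p%:R)) ^+ a = 1 * 5 * (2 / (2 * sin (pi / p%:R)) ^+ a) :> R by ring.
rewrite /const_C; apply: ler_pM => //; first by apply: ler_pM.
by rewrite le_max lexx.
Qed.

Lemma log2_ge p b c : (0 < p)%N -> (2 ^ b <= p ^ c)%N -> b%:R * ln 2 <= c%:R * ln p%:R :> R.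
Proof.
move=> p0 H; rewrite !mulr_natl -!lnXn ?ltr0n//.
by rewrite ler_ln ?posrE ?exprn_gt0 ?ltr0n// -!natrX ler_nat.
Qed.

(* For p <= 3 use sin <= 1; for p >= 5 use p sin(pi/p) <= pi < 4 and
   5 (p - 1)^2 <= p^2 (log_2 p + 1), where log_2 p is bounded below through powers
   of 2 when p < 16. *)
Lemma base_comparison p m (L : R) : prime p -> (0 < m)%N ->
  m%:R * (ln p%:R / ln 2) + 1 <= L ->
  5 / 4 * (Num.max 1 (p%:R * (p%:R - 1) / 4) * (m%:R + 1)) <=
  p%:R ^+ 2 / (p%:R - 1) / (2 * sin (pi / p%:R)) * L.
Proof.
move=> pp m0; have p1 := prime_gt1 pp; have pR : 1 < p%:R :> R by rewrite ltr1n.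
have mR : 1 <= m%:R :> R by rewrite ler1n.
have ln2 : 0 < ln 2 :> R by rewrite ln_gt0// ltr1n.
have s0 := sin_pi_div_gt0 p1; have s1 := sin_le1 (pi / p%:R : R).
set l := ln p%:R / ln 2; set S := 2 * _ => HL.
have S0 : 0 < S by rewrite /S; lra.
have P0 : 0 < p%:R - 1 :> R by lra.
have l1 : 1 <= l by rewrite /l ler_pdivlMr// mul1r ler_ln ?posrE ?ltr0n ?ler_nat// prime_gt0.
have lb b c : (0 < c)%N -> (2 ^ b <= p ^ c)%N -> b%:R / c%:R <= l.
  move=> c0 /(log2_ge (prime_gt0 pp)) H.
  by rewrite /l ler_pdivrMr ?ltr0n// mulrAC ler_pdivlMr// [_ * c%:R]mulrC.
have ml : m%:R <= m%:R * l by rewrite ler_peMr// (le_trans ler01).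
have -> : p%:R ^+ 2 / (p%:R - 1) / S * L = p%:R ^+ 2 * L / ((p%:R - 1) * S).
  by field; rewrite !gt_eqF.
rewrite ler_pdivlMr ?mulr_gt0//; have S2 : S <= 2 by rewrite /S; lra.
have [p3|p3] := leqP p 3.
  have [E|E] : p = 2%N \/ p = 3%N by move: p1 p3 {HL lb}; lia.
    have -> : Num.max 1 (p%:R * (p%:R - 1) / 4) = 1 :> R.
      by apply/max_idPl; rewrite E; lra.
    have h : m%:R * S <= m%:R * 2 by rewrite ler_wpM2l// (le_trans ler01).
    by rewrite E; lra.
  have -> : Num.max 1 (p%:R * (p%:R - 1) / 4) = 3 / 2 :> R.
    by rewrite E max_r; lra.
  have h : m%:R * S <= m%:R * 2 by rewrite ler_wpM2l// (le_trans ler01).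
  by rewrite E; lra.
have p5 : 5 <= p%:R :> R.
  rewrite (ler_nat R 5); move: p3; rewrite leq_eqVlt => /predU1P[E|//].
  by move: pp; rewrite -E.
have -> : Num.max 1 (p%:R * (p%:R - 1) / 4) = p%:R * (p%:R - 1) / 4 :> R.
  apply/max_idPr; have : 5 * 4 <= p%:R * (p%:R - 1) :> R by apply: ler_pM => //; lra.
  lra.
have Sp : p%:R * S <= 8.
  have := sin_le (divr_ge0 (pi_ge0 R) (ler0n _ p)); have := pihalf_lt2 R => h1 h2.
  have h3 : p%:R * sin (pi / p%:R) <= pi :> R by rewrite mulrC -ler_pdivlMr//; lra.
  by rewrite /S mulrCA; lra.
have key : 5 * (p%:R - 1) ^+ 2 <= p%:R ^+ 2 * (l + 1).
  have [p16|p16] := ltnP p 16; last first.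
    have l4 : 4 <= l.
      have := lb 4 1%N isT; rewrite expn1 divr1; apply.
      exact: leq_trans p16.
    have : p%:R ^+ 2 * 5 <= p%:R ^+ 2 * (l + 1) by rewrite ler_wpM2l ?sqr_ge0//; lra.
    rewrite !expr2; lra.
  have : all (fun q => prime q ==> (q \in [:: 2; 3; 5; 7; 11; 13]%N)) (iota 0 16) by [].
  move=> /allP/(_ p); rewrite mem_iota p16 => /(_ isT)/implyP/(_ pp).
  rewrite !inE => /or4P[/eqP E|/eqP E|/eqP E|/or3P[/eqP E|/eqP E|/eqP E]].
  - by move: p3; rewrite E.
  - by move: p3; rewrite E.
  - have := lb 9 4%N isT; rewrite E => /(_ isT); rewrite !expr2; lra.
  - have := lb 14 5%N isT; rewrite E => /(_ isT); rewrite !expr2; lra.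
  - have := lb 10 3%N isT; rewrite E => /(_ isT); rewrite !expr2; lra.
  - have := lb 11 3%N isT; rewrite E => /(_ isT); rewrite !expr2; lra.
have Lm : (m%:R + 1) * (l + 1) <= 2 * L.
  have : 0 <= (m%:R - 1) * (l - 1) by rewrite mulr_ge0// subr_ge0.
  lra.
have P2 : 0 <= (p%:R - 1) ^+ 2 :> R by rewrite sqr_ge0.
have h1 : (p%:R - 1) ^+ 2 * (m%:R + 1) * (p%:R * S) <= (p%:R - 1) ^+ 2 * (m%:R + 1) * 8.
  by rewrite ler_wpM2l// mulr_ge0//; lra.
have h2 : 5 * (p%:R - 1) ^+ 2 * (m%:R + 1) <= p%:R ^+ 2 * (l + 1) * (m%:R + 1).
  by rewrite ler_wpM2r//; lra.
have h3 : p%:R ^+ 2 * ((m%:R + 1) * (l + 1)) <= p%:R ^+ 2 * (2 * L).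
  by rewrite ler_wpM2l ?sqr_ge0.
move: h1 h2 h3; rewrite !expr2; lra.
Qed.

(** Of the m + a - 1 factors 1 + 1/m, [a] many turn (x m)^a into (x (m + 1))^a, and the product of
    the other m - 1 is at most 3. *)
Lemma decay_comparison p a m (L : R) : prime p -> (2 <= a)%N -> (0 < m)%N ->
  m%:R * (ln p%:R / ln 2) + 1 <= L ->
  (a%:R + 1) * decay_base a m (Num.max 1 (p%:R * (p%:R - 1) / 4)) <=
  const_A R p a * const_C R p a * (p%:R ^+ 2 / (p%:R - 1) * L) ^+ a.
Proof.
move=> pp a2 m0 HL; have ma : (m + a.-1 = m.-1 + a)%N by clear -m0 a2; lia.
have B := base_comparison pp m0 HL; have p1 := prime_gt1 pp.
set x := Num.max _ _ in B *; have x1 : 1 <= x by rewrite le_max lexx.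
have mR : 1 <= m%:R :> R by rewrite ler1n.
have s0 := sin_pi_div_gt0 p1; have S0 : 0 < 2 * sin (pi / p%:R) :> R by rewrite mulr_gt0.
have pR : 1 < p%:R :> R by rewrite ltr1n.
have ln2 : 0 < ln 2 :> R by rewrite ln_gt0// ltr1n.
have lp : 0 <= ln p%:R :> R by rewrite ltW// ln_gt0.
have L0 : 0 <= L.
  by apply: le_trans HL; rewrite addr_ge0// mulr_ge0 ?divr_ge0// ltW.
set S := 2 * _ in B S0; set Y := p%:R ^+ 2 / (p%:R - 1) * L.
have Y0 : 0 <= Y by rewrite /Y mulr_ge0// divr_ge0 ?sqr_ge0// subr_ge0 ltW.
have BY : 5 / 4 * (x * (m%:R + 1)) <= Y / S.
  by apply: le_trans B _; rewrite /Y mulrAC.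
have dE : decay_base a m x = 3 * ((1 + m%:R^-1) ^+ m.-1 * (x * (m%:R + 1)) ^+ a).
  have -> : x * (m%:R + 1) = x * m%:R * (1 + m%:R^-1) by field; rewrite gt_eqF//; lra.
  by rewrite /decay_base ma exprD [(x * m%:R * _) ^+ a]exprMn; ring.
have d1 : decay_base a m x <= 9 * (x * (m%:R + 1)) ^+ a.
  have h : 0 <= (x * (m%:R + 1)) ^+ a by rewrite exprn_ge0// mulr_ge0//; lra.
  have := ler_wpM2r h (euler_bound m0); rewrite dE; lra.
have g := geometric_beats_linear a2.
apply: (@le_trans _ _ (20 * (5 / 4 * (x * (m%:R + 1))) ^+ a)).
  have h : 0 <= (x * (m%:R + 1)) ^+ a by rewrite exprn_ge0// mulr_ge0//; lra.
  have h1 := ler_wpM2r h g; rewrite exprMn.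
  have h2 : (a%:R + 1) * decay_base a m x <= (a%:R + 1) * (9 * (x * (m%:R + 1)) ^+ a).
    by rewrite ler_wpM2l// addr_ge0.
  by move: h1 h2; lra.
apply: (@le_trans _ _ (20 * (Y / S) ^+ a)).
  rewrite ler_wpM2l//; apply: lerXn2r => //; rewrite nnegrE.
    by apply: mulr_ge0; [lra | rewrite mulr_ge0//; lra].
  by rewrite divr_ge0// ltW.
have -> : 20 * (Y / S) ^+ a = 2 * (10 / S ^+ a) * Y ^+ a.
  by rewrite expr_div_n; ring.
rewrite ler_wpM2r ?exprn_ge0//; apply: ler_pM => //.
- by rewrite divr_ge0// exprn_ge0// ltW.
- exact: const_A_ge2.
- exact: const_C_ge.
Qed.

Lemma const_E_ge p d a : (1 < p)%N -> (p%:R ^+ 2 / (p%:R - 1)) ^+ (a * d) <= const_E R p d a.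
Proof.
move=> p1; have pR : 1 < p%:R :> R by rewrite ltr1n.
have -> : p%:R ^+ 2 / (p%:R - 1) = p%:R * (p%:R / (p%:R - 1)) :> R by rewrite mulrA.
rewrite exprMn /const_E ler_wpM2l ?exprn_ge0//.
by rewrite lerDr invr_ge0.
Qed.

(** With L = log_2 N, the product of a / log_p 2 and log_p N is a L, and N^a = a^a p^(a m). The
    quotient Q = (a L)^(a d) / a^a dominates L^(a d), because d > 0, and hence 1: the first serves
    the dual sum, the second the k = 0 part. *)
Lemma constants_comparison p a m t d : prime p -> (2 <= a)%N -> (0 < m)%N -> (0 < d)%N ->
    (t <= a * m)%N ->
  (a%:R + 1) ^+ d * ((\sum_(0 <= l < a) `|richardson_weight R p a l|) *
    ((p%:R ^+ (a * m - t))^-1 * decay_base a m (Num.max 1 (p%:R * (p%:R - 1) / 4)) ^+ d +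
     (p%:R ^+ (a * m))^-1 * const_D R a ^+ d)) <=
  const_V R p d a t * (logb p ((a * p ^ m)%:R : R) ^+ (a * d) / (a * p ^ m)%:R ^+ a).
Proof.
move=> pp a2 m0 d0 tam; set N : R := (a * p ^ m)%:R.
have p1 := prime_gt1 pp; have pR : 1 < p%:R :> R by rewrite ltr1n.
have p0 : 0 < p%:R :> R by lra.
have ln2 : 0 < ln 2 :> R by rewrite ln_gt0// ltr1n.
have lp : 0 < ln p%:R :> R by rewrite ln_gt0.
have aR : 2 <= a%:R :> R by rewrite (ler_nat R 2).
have a0 : 0 < a%:R :> R by lra.
set x := Num.max _ _; set W := \sum_(_ <= _ < _) _; set D := const_D R a.
have W0 : 0 <= W by apply: sumr_ge0.
have D0 : 0 <= D by exact: const_D_ge0.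
pose L := ln N / ln 2.
have NE : N = a%:R * p%:R ^+ m by rewrite /N natrM natrX.
have LE : L = ln a%:R / ln 2 + m%:R * (ln p%:R / ln 2).
  rewrite /L NE lnM ?posrE ?exprn_gt0//.
  by rewrite lnXn// -[ln p%:R *+ m]mulr_natl mulrDl mulrA.
(* The summand 1 is a lower bound for log_2 a. *)
have HL : m%:R * (ln p%:R / ln 2) + 1 <= L.
  by rewrite LE addrC lerD2r ler_pdivlMr// mul1r ler_ln ?posrE.
have L1 : 1 <= L.
  by apply: le_trans HL; rewrite lerDr mulr_ge0 ?divr_ge0// ltW.
have dc := decay_comparison pp a2 m0 HL; rewrite -/x in dc.
have ee := const_E_ge d a p1.
pose Q := (a%:R * L) ^+ (a * d) / a%:R ^+ a.
have aa0 : 0 < a%:R ^+ a :> R by rewrite exprn_gt0.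
have pam0 : 0 < p%:R ^+ (a * m) :> R by rewrite exprn_gt0.
have LQ : L ^+ (a * d) <= Q.
  have -> : Q = a%:R ^+ (a * d) / a%:R ^+ a * L ^+ (a * d) by rewrite /Q exprMn mulrAC.
  rewrite ler_peMl ?exprn_ge0//; first lra.
  by rewrite ler_pdivlMr// mul1r ler_weXn2l ?leq_pmulr//; lra.
have Q1 : 1 <= Q by apply: le_trans LQ; exact: exprn_ege1.
have VE : const_V R p d a t * (logb p N ^+ (a * d) / N ^+ a) =
    W * ((p%:R ^+ (a * m))^-1 *
    (Q * (p%:R ^+ t * const_A R p a ^+ d * const_C R p a ^+ d * const_E R p d a) +
     Q * ((a%:R + 1) ^+ d * D ^+ d))).
  have e1 : (a%:R / logb p 2) ^+ (a * d) * logb p N ^+ (a * d) = (a%:R * L) ^+ (a * d).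
    rewrite -exprMn; congr (_ ^+ _); rewrite /L /logb; field; rewrite !gt_eqF//.
  have e2 : N ^+ a = a%:R ^+ a * p%:R ^+ (a * m) by rewrite NE exprMn -exprM (mulnC m).
  rewrite /const_V -/W -/D e2 -mulrDr /Q -e1.
  move: (_ + _ : R) ((a%:R / _) ^+ _) (logb p N ^+ _) => X Y Z.
  by rewrite invfM; ring.
have LHSE : (a%:R + 1) ^+ d * (W * ((p%:R ^+ (a * m - t))^-1 * decay_base a m x ^+ d +
     (p%:R ^+ (a * m))^-1 * D ^+ d)) =
    W * ((p%:R ^+ (a * m))^-1 * (p%:R ^+ t * ((a%:R + 1) * decay_base a m x) ^+ d +
       (a%:R + 1) ^+ d * D ^+ d)).
  have pt0 : 0 < p%:R ^+ (a * m - t) :> R by rewrite exprn_gt0.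
  have e1 : p%:R ^+ (a * m) = p%:R ^+ t * p%:R ^+ (a * m - t) :> R by rewrite -exprD subnKC.
  have ptt : 0 < p%:R ^+ t :> R by rewrite exprn_gt0.
  rewrite e1; move: (decay_base a m x) => B; rewrite exprMn; field.
  by rewrite !lt0r_neq0.
rewrite VE LHSE ler_wpM2l// ler_wpM2l ?invr_ge0 ?(ltW pam0)//; apply: lerD; last first.
  by rewrite ler_peMl// mulr_ge0 ?exprn_ge0// addr_ge0// ltW.
have A0 : 0 <= const_A R p a by apply: le_trans (const_A_ge2 p1 a2).
have C0 : 0 <= const_C R p a.
  by apply: le_trans (const_C_ge a p1); rewrite divr_ge0 ?exprn_ge0 ?mulr_ge0 ?(ltW (sin_pi_div_gt0 p1)).
have dec0 : 0 <= (a%:R + 1) * decay_base a m x.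
  have x0 : 0 <= x by rewrite /x le_max ler01.
  by rewrite /decay_base !mulr_ge0 ?exprn_ge0 ?mulr_ge0 ?addr_ge0 ?invr_ge0 ?(ltW a0).
have -> : Q * (p%:R ^+ t * const_A R p a ^+ d * const_C R p a ^+ d * const_E R p d a) =
    p%:R ^+ t * (const_A R p a ^+ d * const_C R p a ^+ d * (const_E R p d a * Q)) by ring.
rewrite ler_wpM2l ?exprn_ge0 ?(ltW p0)//.
apply: (@le_trans _ _ ((const_A R p a * const_C R p a * (p%:R ^+ 2 / (p%:R - 1) * L) ^+ a) ^+ d)).
  by apply: lerXn2r; rewrite ?nnegrE//; exact: le_trans dc.
have pp0 : 0 <= p%:R ^+ 2 / (p%:R - 1) :> R by rewrite divr_ge0 ?sqr_ge0// subr_ge0 ltW.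
rewrite exprMn [(_ * const_C R p a) ^+ d]exprMn -exprM [(_ * L) ^+ _]exprMn.
rewrite ler_wpM2l ?mulr_ge0 ?exprn_ge0//; apply: ler_pM => //; rewrite exprn_ge0//; lra.
Qed.

End Constants.

(** * Integration over the cube *)

Section CubeIntegral.
Variable R : realType.
Implicit Types (s : nat).

Local Notation U := (uniform_prob (@ltr01 R)).
Local Notation mu := (cube_measure R).
Local Notation I := (measurableTypeR R).

Lemma tnth_cons0 s (x : I) (y : cube_point R s) : tnth (cons_point (x, y)) ord0 = x.
Proof. by rewrite (tnth_nth 0). Qed.

Lemma tnth_consS s (x : I) (y : cube_point R s) j : tnth (cons_point (x, y)) (lift ord0 j) = tnth y j.
Proof. by rewrite !(tnth_nth 0). Qed.

Lemma ge0_integral_cons s (f : cube_point R s.+1 -> \bar R) :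
    measurable_fun [set: cube_point R s.+1] f -> (forall y, 0 <= f y)%E ->
  (\int[mu s.+1]_z f z = \int[U]_x \int[mu s]_y f (cons_point (x, y)))%E.
Proof.
move=> mf f0; rewrite /= ge0_integral_distribution//.
have mfc := measurableT_comp mf (@measurable_cons_point R s).
exact: (@fubini_tonelli1 _ _ _ _ R U (mu s) _ mfc (fun z => f0 _)).
Qed.

Lemma bounded_integrable d (T : measurableType d) (P : probability T R) (f : T -> R) (M : R) :
  measurable_fun setT f -> (forall x, `|f x| <= M) -> P.-integrable setT (EFin \o f).
Proof.
move=> mf fM; apply: measurable_bounded_integrable => //.
  by rewrite (le_lt_trans (probability_le1 _ _)) ?ltry.
exists M; split; first exact: num_real.
by move=> x Mx y _; exact: le_trans (fM y) (ltW Mx).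
Qed.

Lemma Rintegral_cons s (f : cube_point R s.+1 -> R) (M : R) :
    measurable_fun [set: cube_point R s.+1] f -> (forall y, `|f y| <= M) ->
  \int[mu s.+1]_z f z = \int[U]_x \int[mu s]_y f (cons_point (x, y)).
Proof.
move=> mf fM; have mfc : measurable_fun setT (f \o @cons_point R s).
  by apply: measurableT_comp => //; exact: measurable_cons_point.
have ifc : (U \x mu s)%E.-integrable setT (EFin \o (f \o @cons_point R s)).
  by have := @bounded_integrable _ _ (U \x mu s)%E _ M mfc; apply => z; exact: fM.
rewrite {1}/Rintegral /= integral_distribution//; last exact/measurable_EFinP.
rewrite -integral12_prod_meas1//; rewrite /Rintegral; congr fine.
apply: eq_integral => x _; rewrite fineK//.
apply: integrable_fin_num => //; apply: (@bounded_integrable _ _ _ _ M) => //.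
exact: measurableT_comp mfc _.
Qed.

Lemma normr_prod_le1 (J : finType) (P : pred J) (g : J -> R) :
  (forall j, P j -> `|g j| <= 1) -> `|\prod_(j | P j) g j| <= 1.
Proof.
move=> g1; apply: (@le_trans _ _ (\prod_(j | P j) 1)); last by rewrite big1.
by rewrite normr_prod; apply: ler_prod => j Pj; rewrite normr_ge0 g1.
Qed.

Lemma Rintegral_prod s (phi : 'I_s -> R -> R) :
    (forall j, measurable_fun setT (phi j : I -> R)) -> (forall j x, `|phi j x| <= 1) ->
  \int[mu s]_y \prod_j phi j (tnth y j) = \prod_j \int[U]_x phi j x.
Proof.
elim: s phi => [|s IHs] phi mphi phi1.
  rewrite big_ord0; under eq_Rintegral do rewrite big_ord0.
  transitivity (1 * fine (mu 0 setT)); first exact: Rintegral_cst.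
  by rewrite (@probability_setT _ _ _ (mu 0)) mul1r.
rewrite (@Rintegral_cons _ _ 1); last 2 first.
- by apply: measurable_prod => j _; apply: measurableT_comp => //; exact: measurable_tnth.
- by move=> y; apply: normr_prod_le1.
rewrite big_ord_recl -IHs//; set c := \int[mu s]_y _.
under eq_Rintegral => x _.
  under eq_Rintegral => y _.
    rewrite big_ord_recl tnth_cons0; under eq_bigr do rewrite tnth_consS.
    over.
  rewrite RintegralZl//; last first.
    apply: (@bounded_integrable _ _ _ _ 1); last by move=> y; apply: normr_prod_le1.
    by apply: measurable_prod => j _; apply: measurableT_comp => //; exact: measurable_tnth.
  over.
by rewrite RintegralZr// (@bounded_integrable _ _ _ _ 1).
Qed.

End CubeIntegral.

(** * Replacing part of the coordinates by independent copies *)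

Section Splice.
Variable R : realType.
Implicit Types (s : nat).

Local Notation U := (uniform_prob (@ltr01 R)).
Local Notation mu := (cube_measure R).
Local Notation I := (measurableTypeR R).

Lemma measurable_tnth_comp d (T : measurableType d) s (g : T -> cube_point R s) j :
  measurable_fun [set: T] g -> measurable_fun [set: T] (fun z => tnth (g z) j).
Proof. by move=> mg; apply: (measurableT_comp (measurable_tnth _) mg). Qed.

Lemma measurable_splice d (T : measurableType d) s (v : {set 'I_s}) (g h : T -> cube_point R s) :
  measurable_fun [set: T] g -> measurable_fun [set: T] h ->
  measurable_fun [set: T] (fun z => splice v (g z) (h z)).
Proof.
move=> mg mh; apply/measurable_fun_tnthP => j.
have -> : (@tnth s _)^~ j \o (fun z => splice v (g z) (h z)) =
    (fun z => if j \in v then tnth (g z) j else tnth (h z) j).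
  by apply/funext => z; rewrite /= /splice tnth_mktuple.
by case: (j \in v); exact: measurable_tnth_comp.
Qed.

Lemma measurable_cons_comp d (T : measurableType d) s (g : T -> I) (h : T -> cube_point R s) :
  measurable_fun [set: T] g -> measurable_fun [set: T] h ->
  measurable_fun [set: T] (fun z => cons_point (g z, h z)).
Proof.
by move=> mg mh; apply: (measurableT_comp (@measurable_cons_point R s)); exact: measurable_fun_pair.
Qed.

Lemma integral_prob_cst d (T : measurableType d) (P : probability T R) (c : \bar R) :
  (\int[P]_x c = c)%E.
Proof.
transitivity (c * P setT)%E; first exact: integral_cst.
by rewrite (@probability_setT _ _ _ P) mule1.
Qed.

Lemma splice_cons s (v : {set 'I_s.+1}) x0 y0 (x y : cube_point R s) :
  splice v (cons_point (x0, x)) (cons_point (y0, y)) =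
  cons_point (if ord0 \in v then x0 else y0, splice [set j | lift ord0 j \in v]%SET x y).
Proof.
apply: eq_from_tnth => j; rewrite tnth_mktuple; case: (unliftP ord0 j) => [k ->|->].
  by rewrite !tnth_consS tnth_mktuple inE.
by rewrite !tnth_cons0.
Qed.

(** Mixing the coordinates of two independent uniform points gives a uniform point. In the induction
    one of the two copies of the first coordinate integrates out trivially. *)
Lemma ge0_integral_splice s (v : {set 'I_s}) (f : cube_point R s -> \bar R) :
    measurable_fun [set: cube_point R s] f -> (forall y, 0 <= f y)%E ->
  (\int[mu s]_x \int[mu s]_y f (splice v x y) = \int[mu s]_x f x)%E.
Proof.
elim: s v f => [|s IHs] v f mf f0.
  rewrite [RHS](_ : _ = f [tuple]); last first.
    by rewrite -[RHS](integral_prob_cst (mu 0)); apply: eq_integral => x _; rewrite (tuple0 x).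
  rewrite -[RHS](integral_prob_cst (mu 0)); apply: eq_integral => x _.
  rewrite -[RHS](integral_prob_cst (mu 0)); apply: eq_integral => y _.
  by rewrite (tuple0 (splice _ _ _)).
have mF : measurable_fun [set: cube_point R s.+1] (fun x => \int[mu s.+1]_y f (splice v x y))%E.
  apply: (@measurable_fun_fubini_tonelli_F _ _ _ _ R (mu s.+1) (fun z => f (splice v z.1 z.2))) => //.
  exact: (measurableT_comp mf (measurable_splice v measurable_fst measurable_snd)).
rewrite ge0_integral_cons//; last by move=> x; exact: integral_ge0.
set v' := [set j | lift ord0 j \in v]%SET.
have E x0 x : (\int[mu s.+1]_y f (splice v (cons_point (x0, x)) y) =
    \int[U]_y0 \int[mu s]_y f (cons_point (if ord0 \in v then x0 else y0, splice v' x y)))%E.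
  rewrite ge0_integral_cons//; last first.
    by apply: (measurableT_comp mf); exact: measurable_splice.
  by apply: eq_integral => y0 _; apply: eq_integral => y _; rewrite splice_cons.
transitivity (\int[U]_x0 \int[mu s]_x \int[U]_y0 \int[mu s]_y
    f (cons_point (if ord0 \in v then x0 else y0, splice v' x y)))%E.
  by apply: eq_integral => x0 _; apply: eq_integral => x _; exact: E.
rewrite [RHS]ge0_integral_cons//.
have mfc x0 : measurable_fun [set: cube_point R s] (fun x => f (cons_point (x0, x))).
  by apply: (measurableT_comp mf); exact: measurable_cons_comp.
clear E; case: (ord0 \in v).
  apply: eq_integral => x0 _; rewrite -(IHs v' _ (mfc x0))//.
  by apply: eq_integral => x _; rewrite integral_prob_cst.
(* Now the first coordinate comes from the second point: x0 disappears, and Tonelli exchanges x with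
   y0. *)
rewrite integral_prob_cst.
pose H (z : (cube_point R s * I) * cube_point R s) := f (cons_point (z.1.2, splice v' z.1.1 z.2)).
have mG : measurable_fun [set: cube_point R s * I] (fun z => \int[mu s]_y H (z, y))%E.
  apply: (@measurable_fun_fubini_tonelli_F _ _ _ _ R (mu s) H) => [|z]; last exact: f0.
  apply: (measurableT_comp mf); apply: measurable_cons_comp.
    exact: (measurableT_comp measurable_snd measurable_fst).
  apply: measurable_splice; last exact: measurable_snd.
  exact: (measurableT_comp measurable_fst measurable_fst).
have := @fubini_tonelli _ _ _ _ R (mu s) U _ mG; rewrite /H/= => ->; last first.
  by move=> z; exact: integral_ge0.
by apply: eq_integral => y0 _; rewrite -(IHs v' _ (mfc y0)).
Qed.

Lemma integrable_splice s (v : {set 'I_s}) (f : cube_point R s -> \bar R) :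
    (mu s).-integrable [set: cube_point R s] f ->
  (mu s \x mu s)%E.-integrable [set: cube_point R s * cube_point R s] (fun z => f (splice v z.1 z.2)).
Proof.
move=> /integrableP[mf f1]; apply/integrable12ltyP => /=.
  exact: (measurableT_comp mf (measurable_splice v measurable_fst measurable_snd)).
by rewrite (@ge0_integral_splice _ v (fun z => `|f z|)%E)//; exact: measurableT_comp.
Qed.

Lemma integral_splice s (v : {set 'I_s}) (f : cube_point R s -> \bar R) :
    (mu s).-integrable [set: cube_point R s] f ->
  (\int[mu s]_x \int[mu s]_y f (splice v x y) = \int[mu s]_x f x)%E.
Proof.
move=> f1; have mf := measurable_int _ f1.
have := integral12_prod_meas1 (integrable_splice v f1); rewrite /fubini_F/= => ->.
rewrite integralE [RHS]integralE.
have ms := measurable_splice v measurable_fst measurable_snd.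
have -> : (fun z : cube_point R s * cube_point R s => f (splice v z.1 z.2)) = f \o (fun z => splice v z.1 z.2) by [].
rewrite funepos_comp funeneg_comp; have mp := measurable_funepos mf; have mn := measurable_funeneg mf.
congr (_ - _)%E.
  rewrite -(ge0_integral_splice v mp)//.
  by have := @fubini_tonelli1 _ _ _ _ R (mu s) (mu s) _ (measurableT_comp mp ms); apply => z; exact: funepos_ge0.
rewrite -(ge0_integral_splice v mn)//.
by have := @fubini_tonelli1 _ _ _ _ R (mu s) (mu s) _ (measurableT_comp mn ms); apply => z; exact: funeneg_ge0.
Qed.

End Splice.

(** * Bernoulli polynomials have mean zero *)

Section BernoulliMean.
Variable R : realType.

Local Notation U := (uniform_prob (@ltr01 R)).
Local Notation leb := (@lebesgue_measure R).
Local Notation I := (measurableTypeR R).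

Lemma measurable_horner (P : {poly R}) : measurable_fun [set: I] (horner P : I -> R).
Proof. by apply: continuous_measurable_fun; exact: continuous_horner. Qed.

Lemma measurable_bern n : measurable_fun [set: I] (bern n : I -> R).
Proof.
have -> : bern n = horner (bernp R n) by apply/funext => x; exact: bernE.
exact: measurable_horner.
Qed.

Lemma measurable_bern_per n : measurable_fun [set: I] (bern_per n : I -> R).
Proof.
apply: (measurableT_comp (measurable_bern n)).
apply: measurable_funB => //; apply: nondecreasing_measurable => // x y xy.
by rewrite ler_int le_floor.
Qed.

Lemma Rintegral_uniform (f : I -> R) : measurable_fun [set: I] f ->
  \int[U]_x f x = \int[leb]_(x in `[0, 1]) f x.
Proof.
move=> mf; rewrite /Rintegral; congr fine; rewrite integralE [RHS]integralE.
have mEf : measurable_fun [set: I] (EFin \o f) by exact/measurable_EFinP.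
have c1 : ((1 - 0 : R)^-1)%:E = 1%E by rewrite subr0 invr1.
have mp := measurable_funepos mEf; have mn := measurable_funeneg mEf.
congr (_ - _)%E.
  have := integral_uniform (@ltr01 R) mp (fun x => funepos_ge0 _ x).
  by rewrite c1 mul1e.
have := integral_uniform (@ltr01 R) mn (fun x => funeneg_ge0 _ x).
by rewrite c1 mul1e.
Qed.

Lemma integrable_itv (i : interval R) (f : I -> R) (M : R) :
  [set` i] `<=` `[0, 1]%classic -> measurable_fun [set: I] f -> (forall x, [set` i] x -> `|f x| <= M) ->
  leb.-integrable [set` i] (EFin \o f).
Proof.
move=> i01 mf fM; apply: measurable_bounded_integrable => //.
- by apply: (@le_lt_trans _ _ (leb `[0, 1]%classic)); rewrite ?le_measure ?inE//=
    lebesgue_measure_itv/= lte_fin ltr01 -EFinB ltry.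
- exact: measurable_funTS.
exists M; split; first exact: num_real.
by move=> x Mx y iy; exact: le_trans (fM y iy) (ltW Mx).
Qed.

Lemma Rintegral_deriv_poly (P : {poly R}) (x y : R) : x <= y ->
  \int[leb]_(z in `[x, y]) P^`().[z] = P.[y] - P.[x].
Proof.
rewrite le_eqVlt => /predU1P[->|xy]; first by rewrite set_itv1 Rintegral_set1 subrr.
have cP z : {for z, continuous (horner P)} by exact: continuous_horner.
rewrite /Rintegral (@continuous_FTC2 _ _ (horner P))//.
- by apply: continuous_subspaceT => z; exact: continuous_horner.
- split; first by move=> z _; exact: derivable_horner.
    exact/cvg_at_right_filter/cP.
  exact/cvg_at_left_filter/cP.
- by move=> z _; rewrite derivE.
Qed.

(** [uniform_prob] lives on [0, 1] while the cube is half-open; the cut-off also keeps polynomials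
    bounded on the whole line. *)
Lemma Rintegral_restrict (f : I -> R) : measurable_fun [set: I] f ->
  (forall x, 0 <= x < 1 -> `|f x| <= 1) ->
  \int[U]_x (if 0 <= x < 1 then f x else 0) = \int[leb]_(x in `[0, 1[) f x.
Proof.
move=> mf f1; have E : (fun x => if 0 <= x < 1 then f x else 0) = f \_ `[0, 1[.
  by apply/funext => x; rewrite patchE mem_setE in_itv.
rewrite E Rintegral_uniform; last first.
  by apply/measurable_restrict => //; rewrite setTI; exact: measurable_funTS.
rewrite -Rintegral_mkcondr; congr Rintegral; apply/seteqP; split=> x /=; rewrite !in_itv/=.
  by case.
by move=> /andP[-> /[dup]/ltW -> ->].
Qed.

Lemma bernp_bounded n (x : R) : 0 <= x < 1 -> `|(bernp R n).[x]| <= 1.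
Proof. by case/andP => x0 /ltW x1; apply: bernp_le1; rewrite x0. Qed.

Lemma Rintegral_bern n : (0 < n)%N -> \int[U]_x (if 0 <= x < 1 then bern n x else 0) = 0.
Proof.
move=> n0; rewrite Rintegral_restrict; last 2 first.
- exact: measurable_bern.
- by move=> x x01; rewrite bernE bernp_bounded.
rewrite Rintegral_itv_bndo_bndc; last first.
  apply: (@integrable_itv _ _ 1); first by move=> x /=; rewrite !in_itv/= => /andP[-> /ltW].
    exact: measurable_bern.
  by move=> x /= x01; rewrite bernE bernp_bounded// -in_itv.
under eq_Rintegral do rewrite bernE -deriv_bernp.
by rewrite Rintegral_deriv_poly// bernp_periodic_end ?subrr.
Qed.

(** For y in [0, 1[, split at y. With b = [bernp n.+1] the primitives -b(y - x) and -b(y + 1 - x)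
    leave b(1) - b(0), which is zero. *)
Lemma Rintegral_bern_per n (y : R) : (0 < n)%N ->
  \int[U]_x (if 0 <= x < 1 then bern_per n (y - x) else 0) = 0.
Proof.
move=> n0; have mb (z : R) : measurable_fun [set: I] (fun x => bern_per n (z - x) : R).
  apply: (measurableT_comp (measurable_bern_per n)).
  exact: measurable_funB.
have floor01 (z : R) : 0 <= z - (Num.floor z)%:~R < 1.
  by have := floor_itv z; rewrite intrD1; lra.
have b1 (z : R) : `|bern_per n z| <= 1 by rewrite /bern_per bernE bernp_bounded.
wlog y01 : y / 0 <= y < 1.
  move=> H; rewrite -[RHS](H (y - (Num.floor y)%:~R) (floor01 y)).
  apply: eq_Rintegral => x _; case: ifP => // _.
  by rewrite -(bern_per_int _ _ (- Num.floor y)) rmorphN addrAC.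
case/andP: y01 => y0 y1.
rewrite Rintegral_restrict//.
have sub01 : [set` `[0, 1[%R] `<=` `[(0 : R), 1]%classic.
  by move=> x /=; rewrite !in_itv/= => /andP[-> /ltW].
have itf : leb.-integrable [set` `[0, 1[%R] (EFin \o (fun x : R => bern_per n (y - x))).
  exact: (@integrable_itv _ _ 1).
have := Rintegral_itvB itf (x := y); rewrite !bnd_simp => /(_ y0 y1)/eqP.
rewrite subr_eq => /eqP ->.
pose Q (c : R) : {poly R} := - (bernp R n.+1 \Po (c%:P - 'X)).
have QE c x : (Q c)^`().[x] = (bernp R n).[c - x].
  rewrite /Q derivN deriv_comp deriv_bernp derivB derivC derivX sub0r mulrN1 opprK.
  by rewrite horner_comp !hornerE.
have Qv c x : (Q c).[x] = - (bernp R n.+1).[c - x].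
  by rewrite /Q hornerN horner_comp !hornerE.
have -> : \int[leb]_(x in `[0, y]) bern_per n (y - x) = \int[leb]_(x in `[0, y]) (Q y)^`().[x].
  apply: eq_Rintegral => x; rewrite inE/= in_itv/= => x0y; rewrite QE.
  by rewrite /bern_per bernE (@floor_def _ _ 0) ?subr0//; lra.
have -> : \int[leb]_(x in `]y, 1[) bern_per n (y - x) = \int[leb]_(x in `]y, 1[) (Q (y + 1))^`().[x].
  apply: eq_Rintegral => x; rewrite inE/= in_itv/= => xy1; rewrite QE.
  have -> : bern_per n (y - x) = bern_per n (y + 1 - x).
    by rewrite -(bern_per_int _ _ 1) addrAC.
  by rewrite /bern_per bernE (@floor_def _ _ 0) ?subr0//; lra.
have iQ (i : interval R) : [set` i] `<=` `[y, 1]%classic -> leb.-integrable [set` i] (EFin \o horner (Q (y + 1))^`()).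
  move=> iy; apply: (@integrable_itv _ _ 1).
  - by move=> x /iy/=; rewrite !in_itv/= => /andP[yx ->]; rewrite (le_trans y0).
  - exact: measurable_horner.
  - move=> x /iy/=; rewrite in_itv/= QE => yx1; apply: bernp_le1; lra.
rewrite Rintegral_itv_obnd_cbnd; last first.
  by apply: iQ => x /=; rewrite !in_itv/= => /andP[/ltW -> /ltW].
rewrite Rintegral_itv_bndo_bndc; last first.
  by apply: iQ => x /=; rewrite !in_itv/= => /andP[-> /ltW].
rewrite !Rintegral_deriv_poly//; last exact: ltW.
rewrite !Qv subrr subr0 addrK [y + 1 - y]addrAC subrr add0r (@bernp_periodic_end R n.+1)//.
ring.
Qed.

End BernoulliMean.

(** * Bounding integrals by the norms *)

Section NormBound.
Variable R : realType.
Implicit Types (s : nat).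

Local Notation mu := (cube_measure R).

(** Hoelder against the constant 1, whose norm is 1 for a probability; q = +oo goes through the
    essential supremum. *)
Lemma le_integral_Lnorm d (T : measurableType d) (P : probability T R) (h : T -> R) (q : \bar R) :
    (1 <= q)%E -> measurable_fun [set: T] h ->
  (\int[P]_x `|(h x)%:E| <= Lnorm P q (EFin \o h))%E.
Proof.
move=> q1 mh; rewrite -[leLHS](Lnorm1 P (EFin \o h)).
case: q q1 => [q||//].
  rewrite lee_fin le_eqVlt => /predU1P[<-//|q1].
  have q0 : 0 < q by exact: lt_trans q1.
  pose q' := (1 - q^-1)^-1; have iq : 0 < 1 - q^-1 by rewrite subr_gt0 invf_lt1.
  have q'0 : 0 < q' by rewrite invr_gt0.
  have := @hoelder _ _ _ P h (cst 1) q q' mh (measurable_cst _) q0 q'0.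
  rewrite /q' invrK addrC subrK => /(_ erefl).
  have -> : (h \* cst 1)%R = h by apply/funext => x /=; rewrite mulr1.
  have -> : Lnorm P (1 - q^-1)^-1%:E (EFin \o cst 1) = 1%E.
    rewrite Lnorm_cst1; transitivity (1 `^ ((1 - q^-1)^-1)^-1)%E; last exact: poweR1r.
    by congr (_ `^ _)%E; exact: probability_setT.
  by rewrite mule1.
move=> _; rewrite Lnorm1 Lnorm.unlock; have P0 : (0 < P [set: T])%E.
  by have := @probability_setT _ _ _ P => ->; rewrite lte_fin.
rewrite ifT//; set S := ess_sup _ _; rewrite -[leRHS](integral_prob_cst P).
apply: ae_ge0_le_integral => //.
- by apply: measurableT_comp => //; exact/measurable_EFinP.
- by move=> x _; apply: ess_sup_gee => //; apply: nearW => y; exact: abse_ge0.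
have := ess_sup_ge P (abse \o (EFin \o h)).
by apply: filterS => x H _.
Qed.

(** [K] sees only the coordinates in v, so the others are integrated out of [g] before absolute
    values are taken. This yields the mean that occurs in the norm of the space, rather than the
    larger integral of [|g|]. *)
Lemma Rintegral_mul_bound s (v : {set 'I_s}) (g K : cube_point R s -> R) (kap : R) :
    (mu s).-integrable [set: cube_point R s] (EFin \o g) ->
    measurable_fun [set: cube_point R s] K ->
    (forall x, `|K x| <= kap) -> (forall x y, K (splice v x y) = K x) ->
  (`|\int[mu s]_x (g x * K x)|%:E <=
     kap%:E * \int[mu s]_x `|(integrate_out v g x)%:E|)%E.
Proof.
move=> ig mK K1 Kv.
have iG : (mu s).-integrable setT (fun x => \int[mu s]_y (g (splice v x y))%:E)%E.
  exact: integrable_fubini_F (integrable_splice v ig).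
have igK : (mu s).-integrable [set: cube_point R s] (EFin \o (fun x => g x * K x)).
  have -> : EFin \o (fun x => g x * K x) = ((EFin \o g) \* (EFin \o K))%E by apply/funext.
  apply: integrableMl => //; exists kap; split; first exact: num_real.
  by move=> x Mx y _; exact: le_trans (K1 y) (ltW Mx).
rewrite EFin_normr_Rintegral// -(integral_splice v igK).
(* Fubini makes the inner function integrable only for almost every x, hence the almost everywhere
   comparison. *)
have Ef : (\int[mu s]_x \int[mu s]_y (g (splice v x y) * K (splice v x y))%:E =
  \int[mu s]_x ((K x)%:E * \int[mu s]_y (g (splice v x y))%:E))%E.
  have aei := ae_integrable1 (integrable_splice v ig).
  apply: ae_eq_integral => //.
  - exact: measurable_fubini_F (integrable_splice v igK).
  - by apply: emeasurable_funM; [exact/measurable_EFinP|exact: measurable_int iG].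
  apply: filterS aei => x /= ix _.
  rewrite -integralZl//; apply: eq_integral => y _; by rewrite Kv mulrC.
rewrite /= Ef.
have mi : measurable_fun setT (fun x => (integrate_out v g x)%:E).
  have -> : (fun x => (integrate_out v g x)%:E) = (fun x => (fine (\int[mu s]_y (g (splice v x y))%:E))%:E) by [].
  by apply/measurable_EFinP; apply: measurableT_comp => //; exact: measurable_int iG.
apply: (@le_trans _ _ (\int[mu s]_x (kap%:E * `|(integrate_out v g x)%:E|))%E); last first.
  rewrite ge0_integralZl//; [exact: measurableT_comp|].
  exact: le_trans (K1 [tuple of nseq s 0]).
apply: le_trans (le_abse_integral _ _ _) _ => //.
  by apply: emeasurable_funM; [exact/measurable_EFinP|exact: measurable_int iG].
apply: ae_ge0_le_integral => //.
- apply: measurableT_comp => //.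
  by apply: emeasurable_funM; [exact/measurable_EFinP|exact: measurable_int iG].
- by move=> x _; rewrite mule_ge0// lee_fin (le_trans _ (K1 [tuple of nseq s 0])).
- by apply: emeasurable_funM => //; exact: measurableT_comp.
apply: filterS (ae_integrable1 (integrable_splice v ig)) => x /= ix _.
have fx : (\int[mu s]_y (g (splice v x y))%:E)%E = (integrate_out v g x)%:E.
  by rewrite /integrate_out /Rintegral fineK//; exact: integrable_fin_num.
by rewrite fx abseM lee_wpmul2r// lee_fin.
Qed.

Lemma integrate_out_measurable s (v : {set 'I_s}) (g : cube_point R s -> R) :
    (mu s).-integrable [set: cube_point R s] (EFin \o g) ->
  measurable_fun [set: cube_point R s] (integrate_out v g).
Proof.
move=> ig; have iG := integrable_fubini_F (integrable_splice v ig).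
by apply: (measurableT_comp (@fine_measurable R setT _)) => //; exact: measurable_int iG.
Qed.

Lemma lnorm_ge_term (q : \bar R) (J : finType) (P : pred J) (F : J -> \bar R) j :
  (1 <= q)%E -> (forall i, 0 <= F i)%E -> P j -> (F j <= lnorm q P F)%E.
Proof.
move=> q1 F0 Pj; case: q q1 => [q||//]; last first.
  by move=> _ /=; rewrite (bigD1 j)//= le_max lexx.
rewrite lee_fin => q1 /=; have q0 : 0 < q by exact: lt_le_trans q1.
have le1 : (F j `^ q <= \sum_(i | P i) F i `^ q)%E.
  by rewrite (bigD1 j)//= leeDl// sume_ge0// => i _; exact: poweR_ge0.
have -> : F j = ((F j `^ q) `^ q^-1)%E by rewrite -poweRrM mulfV ?gt_eqF// poweRe1.
apply: gt0_ler_poweR => //; first by rewrite invr_ge0 ltW.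
- by rewrite in_itv/= poweR_ge0 leey.
- by rewrite in_itv/= leey andbT sume_ge0// => i _; exact: poweR_ge0.
Qed.

Lemma lnorm_ge0 (q : \bar R) (J : finType) (P : pred J) (F : J -> \bar R) :
  (forall i, 0 <= F i)%E -> (0 <= lnorm q P F)%E.
Proof.
move=> F0; case: q => [q||] //=; first exact: poweR_ge0.
by elim/big_ind: _ => // x y x0 y0; rewrite le_max x0.
Qed.

(** For c = 0 the quotient is infinite unless x = 0, so a zero weight forces its terms to vanish. *)
Lemma ediv0_le1 (x : \bar R) (c : R) :
  0 <= c -> (0 <= x)%E -> (ediv0 x c <= 1)%E -> (x <= c%:E)%E.
Proof.
move=> c0 x0; rewrite /ediv0; case: eqVneq => [->|cn].
  by case: eqVneq => [->|].
have cp : 0 < c by rewrite lt_neqAle eq_sym cn.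
by rewrite lee_pdivrMr// mul1e.
Qed.

Lemma ediv0_ge0 (x : \bar R) (c : R) : 0 <= c -> (0 <= x)%E -> (0 <= ediv0 x c)%E.
Proof.
move=> c0 x0; rewrite /ediv0; case: eqVneq => [_|cn]; first by case: ifP.
by rewrite mule_ge0// lee_fin invr_ge0.
Qed.

End NormBound.

(** * Integrating and extrapolating the pointwise representation *)

Section Representation.
Variables (R : realType) (s a : nat).
Implicit Types (u v : {set 'I_s}) (beta : {ffun 'I_s -> 'I_a.+1}) (g : cube_point R s -> R).

Local Notation U := (uniform_prob (@ltr01 R)).
Local Notation mu := (cube_measure R s).
Local Notation T := (cube_point R s).
Local Notation I := (measurableTypeR R).

Lemma measurable_bern_comp n d (X : measurableType d) (h : X -> R) :
  measurable_fun [set: X] h -> measurable_fun [set: X] (fun z => bern n (h z)).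
Proof.
have mb : measurable_fun [set: R] (bern n : R -> R) := measurable_bern n.
exact: measurableT_comp.
Qed.

Lemma measurable_bern_per_comp n d (X : measurableType d) (h : X -> R) :
  measurable_fun [set: X] h -> measurable_fun [set: X] (fun z => bern_per n (h z)).
Proof.
have mb : measurable_fun [set: R] (bern_per n : R -> R) := measurable_bern_per n.
exact: measurableT_comp.
Qed.

Lemma measurable_kernel_factor u v beta d (X : measurableType d) (y x : X -> T) j :
  measurable_fun [set: X] y -> measurable_fun [set: X] x ->
  measurable_fun [set: X] (fun z => kernel_factor u v beta (y z) j (tnth (x z) j)).
Proof.
move=> my mx; rewrite /kernel_factor; have mxj := measurable_tnth_comp j mx.
case: (j \in v).
  apply: measurable_bern_per_comp.
  by apply: measurable_funB => //; exact: measurable_tnth_comp.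
by case: (j \in u) => //; exact: measurable_bern_comp.
Qed.

Lemma measurable_kernel u v beta d (X : measurableType d) (y x : X -> T) :
  measurable_fun [set: X] y -> measurable_fun [set: X] x ->
  measurable_fun [set: X] (fun z => kernel u v beta (y z) (x z)).
Proof. by move=> my mx; apply: measurable_prod => j _; exact: measurable_kernel_factor. Qed.

Lemma bern_per_le1 n (x : R) : `|bern_per n x| <= 1.
Proof.
rewrite /bern_per bernE bernp_bounded//.
by have := floor_itv x; rewrite intrD1; lra.
Qed.

Lemma kernel_factor_le1 u v beta (y : T) j (x : R) : 0 <= x < 1 ->
  `|kernel_factor u v beta y j x| <= 1.
Proof.
move=> x01; rewrite /kernel_factor; case: ifP => _; first exact: bern_per_le1.
by case: ifP => _; rewrite ?normr1// bernE bernp_bounded.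
Qed.

Lemma kernel_le1 u v beta (y x : T) : cube x -> `|kernel u v beta y x| <= 1.
Proof. by move=> cx; apply: normr_prod_le1 => j _; apply: kernel_factor_le1; exact: cx. Qed.

(* Vanishing off the cube makes Fubini applicable on the whole product space. *)
Definition cube_kernel u v beta (y x : T) : R :=
  \prod_j (if 0 <= tnth x j < 1 then kernel_factor u v beta y j (tnth x j) else 0).

Lemma cube_kernelE u v beta (y x : T) :
  cube_kernel u v beta y x = if x \in (@cube R s) then kernel u v beta y x else 0.
Proof.
case: ifPn => [/set_mem cx|].
  by apply: eq_bigr => j _; rewrite cx.
rewrite notin_setE => ncx; have [j nj] : exists j, ~~ (0 <= tnth x j < 1).
  by apply: contrapT => H; apply: ncx => j; apply/negPn/negP => nj; apply: H; exists j.
by rewrite /cube_kernel (bigD1 j)//= (negbTE nj) mul0r.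
Qed.

Lemma cube_kernel_le1 u v beta (y x : T) : `|cube_kernel u v beta y x| <= 1.
Proof.
rewrite cube_kernelE; case: ifPn => [/set_mem|_]; first exact: kernel_le1.
by rewrite normr0.
Qed.

Lemma measurable_restrict01 d (X : measurableType d) (h w : X -> R) :
  measurable_fun [set: X] (h : X -> I) -> measurable_fun [set: X] w ->
  measurable_fun [set: X] (fun z => if 0 <= h z < 1 then w z else 0).
Proof.
move=> mh mw; apply: measurable_fun_ifT => //.
by apply: measurable_and; [exact: measurable_fun_ler | exact: measurable_fun_ltr].
Qed.

Lemma measurable_cube_kernel u v beta d (X : measurableType d) (y x : X -> T) :
  measurable_fun [set: X] y -> measurable_fun [set: X] x ->
  measurable_fun [set: X] (fun z => cube_kernel u v beta (y z) (x z)).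
Proof.
move=> my mx; apply: measurable_prod => j _; apply: measurable_restrict01.
  exact: measurable_tnth_comp.
exact: measurable_kernel_factor.
Qed.

Lemma Rintegral_restrict_cst1 : \int[U]_x (if 0 <= x < 1 then 1 else 0) = 1.
Proof.
rewrite (@Rintegral_restrict _ (cst 1))//= => [|x _]; last by rewrite normr1.
have l1 : lebesgue_measure (`[0, 1[%classic : set R) = 1%E.
  by rewrite lebesgue_measure_itv/= lte_fin ltr01 oppr0 addr0.
transitivity (1 * fine (lebesgue_measure (`[0, 1[%classic : set R))); last by rewrite l1 mul1r.
exact: Rintegral_cst.
Qed.

(** The integral factors over the coordinates, and each factor with index in u has mean zero. *)
Lemma Rintegral_cube_kernel u v beta (y : T) : v \subset u -> deriv_index u v beta -> (0 < a)%N ->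
  \int[mu]_x cube_kernel u v beta y x = (u == finset.set0)%:R.
Proof.
move=> vu /forallP duv a0; pose phi j (x : R) := if 0 <= x < 1 then kernel_factor u v beta y j x else 0.
rewrite /cube_kernel (@Rintegral_prod _ _ phi); last 2 first.
- move=> j; apply: measurable_restrict01 => //; rewrite /kernel_factor.
  case: (j \in v).
    by apply: measurable_bern_per_comp; exact: measurable_funB.
  by case: (j \in u) => //; exact: measurable_bern.
- move=> j x; rewrite /phi; case: ifP => [x01|_]; last by rewrite normr0.
  exact: kernel_factor_le1.
case: (set_0Vmem u) => [u0|[j ju]].
  have v0 : v = finset.set0 by apply/eqP; rewrite -finset.subset0 -u0.
  rewrite u0 eqxx big1// => j _; rewrite -[RHS]Rintegral_restrict_cst1.
  by apply: eq_Rintegral => x _; rewrite /phi /kernel_factor v0 u0 !inE.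
have -> : (u == finset.set0) = false by apply/negP => /eqP u0; rewrite u0 inE in ju.
rewrite (bigD1 j)//= [X in X * _](_ : _ = 0) ?mul0r//.
have := duv j; rewrite /phi /kernel_factor; case: (j \in v) => [_|]; first exact: Rintegral_bern_per.
by rewrite ju => bj; exact: Rintegral_bern.
Qed.

Lemma integrable_mul_bounded g (h : T -> R) (M : R) :
  mu.-integrable [set: T] (EFin \o g) -> measurable_fun [set: T] h -> (forall x, `|h x| <= M) ->
  mu.-integrable [set: T] (EFin \o (fun y => g y * h y)).
Proof.
move=> ig mh hM; have -> : EFin \o (fun x => g x * h x) = ((EFin \o g) \* (EFin \o h))%E by apply/funext.
apply: integrableMl => //; exists M; split; first exact: num_real.
by move=> x Mx y _; exact: le_trans (hM y) (ltW Mx).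
Qed.

Lemma Rintegral_cube_kernel_mul u v beta g : v \subset u -> deriv_index u v beta -> (0 < a)%N ->
    mu.-integrable [set: T] (EFin \o g) ->
  let F x := \int[mu]_y (g y * cube_kernel u v beta y x) in
  mu.-integrable [set: T] (EFin \o F) /\ \int[mu]_x F x = (u == finset.set0)%:R * \int[mu]_y g y.
Proof.
move=> vu duv a0 ig F.
pose h (z : T * T) : \bar R := (g z.2 * cube_kernel u v beta z.2 z.1)%:E.
have ih : (mu \x mu)%E.-integrable [set: T * T] h.
  have igs : (mu \x mu)%E.-integrable [set: T * T] (fun z => (EFin \o g) z.2).
    have := integrable_splice finset.set0 ig.
    have -> : (fun z : T * T => (EFin \o g) (splice finset.set0 z.1 z.2)) = (fun z => (EFin \o g) z.2).
      apply/funext => z /=; congr (g _)%:E; apply: eq_from_tnth => j.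
      by rewrite tnth_mktuple inE.
    exact.
  have -> : h = ((fun z => (EFin \o g) z.2) \* (EFin \o (fun z => cube_kernel u v beta z.2 z.1)))%E.
    by apply/funext.
  apply: integrableMl => //.
    by apply: measurable_cube_kernel; [exact: measurable_snd | exact: measurable_fst].
  exists 1; split; first exact: num_real.
  by move=> x Mx z _; exact: le_trans (cube_kernel_le1 _ _ _ _ _) (ltW Mx).
have FE x : (F x)%:E = fubini_F mu h x.
  rewrite /F /Rintegral fineK//; apply: integrable_fin_num => //.
  apply: (@integrable_mul_bounded _ _ 1) => // [|y]; last exact: cube_kernel_le1.
  by apply: measurable_cube_kernel => //; exact: measurable_cst.
have FE' : EFin \o F = fubini_F mu h by apply/funext => x; rewrite /= FE.
split; first by rewrite FE'; exact: integrable_fubini_F.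
rewrite {1}/Rintegral; under eq_integral do rewrite FE.
rewrite integral12_prod_meas1// -integral21_prod_meas1//.
have GE y : fubini_G mu h y = ((u == finset.set0)%:R * g y)%:E.
  rewrite -(Rintegral_cube_kernel y vu duv a0) mulrC.
  have ik : mu.-integrable [set: T] (EFin \o (fun x => cube_kernel u v beta y x)).
    apply: (@bounded_integrable _ _ _ mu _ 1); last exact: cube_kernel_le1.
    by apply: measurable_cube_kernel => //; exact: measurable_cst.
  rewrite -RintegralZl// /Rintegral fineK//; apply: integrable_fin_num => //.
  have -> : (fun x => (g y * cube_kernel u v beta y x)%:E) =
      (fun x => (g y)%:E * (EFin \o cube_kernel u v beta y) x)%E by apply/funext.
  exact: integrableZl.
under eq_integral do rewrite GE.
exact: RintegralZl.
Qed.

Definition index_pair u (vb : {set 'I_s} * {ffun 'I_s -> 'I_a.+1}) : bool :=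
  (vb.1 \subset u) && deriv_index u vb.1 vb.2.

(** In u \ v the orders are positive, so the value 0 is free to mark membership in v; outside u the
    code is always 0. A pair thus becomes a function from u to {0, ..., a}. *)
Lemma card_index_pair u : (#|[pred vb | index_pair u vb]| <= a.+1 ^ #|u|)%N.
Proof.
pose phi (vb : {set 'I_s} * {ffun 'I_s -> 'I_a.+1}) : {ffun 'I_s -> 'I_a.+1} :=
  [ffun j => if j \in vb.1 then ord0 else vb.2 j].
have phi_inj : {in [pred vb | index_pair u vb] &, injective phi}.
  move=> [v b] [v' b']; rewrite !inE => /andP[/= /fintype.subsetP vu /forallP d].
  move=> /andP[/= /fintype.subsetP vu' /forallP d'] /ffunP E.
  have vv' : v = v'.
    apply/setP => j; have := E j; have := d j; have := d' j; rewrite !ffunE /=.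
    case: (boolP (j \in v')) => jv'; case: (boolP (j \in v)) => jv //.
      by rewrite (vu' _ jv') => _ bj b0; rewrite b0 in bj.
    by rewrite (vu _ jv) => bj _ b0; rewrite -b0 in bj.
  rewrite vv' in E d *; congr pair; apply/ffunP => j.
  have := E j; have := d j; have := d' j; rewrite !ffunE /=.
  by case: ifP => // _ /eqP b'j /eqP bj _; apply: val_inj; rewrite /= b'j.
rewrite -(card_in_image phi_inj) -[X in (X ^ _)%N](card_ord a.+1).
rewrite -(card_pffun_on ord0 (mem u) (@predT 'I_a.+1)).
apply: subset_leq_card; apply/fintype.subsetP => _ /fintype.imageP[[v b] /andP[/= /fintype.subsetP vu /forallP d] ->].
apply/pffun_onP; split; last by move=> ?.
apply/fintype.subsetP => j; rewrite inE ffunE /=; apply: contraNT => ju.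
have := d j; rewrite (negbTE ju); case: ifP => [jv|_ /eqP bj]; first by rewrite vu in ju.
by apply/eqP/val_inj.
Qed.

Lemma componentE f u (x : T) :
  (forall beta, mu.-integrable [set: T] (EFin \o wderiv (fun j => beta j) f)) -> cube x ->
  component a f u x = \sum_(vb | index_pair u vb) (- 1) ^+ (a.+1 * #|vb.1|) *
    \int[mu]_y (wderiv (fun j => vb.2 j) f y * kernel u vb.1 vb.2 y x).
Proof.
move=> ig cx; rewrite /component; under eq_bigr do rewrite big_distrr /=.
rewrite pair_big_dep /=; apply: eq_bigr => -[v beta] /= /andP[vu duv]; congr (_ * _).
rewrite -RintegralZl//; last first.
  apply: (@integrable_mul_bounded _ _ 1) => // [|y].
    have -> : (fun y : T => \prod_(j in v) bern_per a (tnth y j - tnth x j)) =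
        (fun y => \prod_j (if j \in v then bern_per a (tnth y j - tnth x j) else 1)).
      by apply/funext => y; rewrite big_mkcond.
    apply: measurable_prod => j _; case: (j \in v) => //; apply: measurable_bern_per_comp.
    by apply: measurable_funB => //; exact: measurable_tnth.
  by apply: normr_prod_le1 => j _; exact: bern_per_le1.
apply: eq_Rintegral => y _; rewrite mulrCA; congr (_ * _).
rewrite /kernel [RHS](bigID (mem v))/= mulrC; congr (_ * _).
  by apply: eq_bigr => j jv; rewrite /kernel_factor jv.
rewrite big_mkcond [RHS]big_mkcond; apply: eq_bigr => j _; rewrite inE /kernel_factor.
by case: (j \in v) => //=; case: (j \in u).
Qed.

End Representation.

(** * Extrapolation as a finite combination of point evaluations *)

Section Evaluation.
Variables (R : realType) (s : nat).

Lemma integrable_Rsum d (X : measurableType d) (P : probability X R) (J : Type) (r : seq J)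
    (A : pred J) (F : J -> X -> R) :
  (forall i, A i -> P.-integrable [set: X] (EFin \o F i)) ->
  P.-integrable [set: X] (EFin \o (fun x => \sum_(i <- r | A i) F i x)).
Proof.
move=> iF; have -> : EFin \o (fun x => \sum_(i <- r | A i) F i x) =
    (fun x => \sum_(i <- r | A i) (EFin \o F i) x)%E.
  by apply/funext => x; rewrite /= sumEFin.
exact: integrable_sum.
Qed.

Lemma Rintegral_sum d (X : measurableType d) (P : probability X R) (J : Type) (r : seq J)
    (A : pred J) (F : J -> X -> R) :
  (forall i, A i -> P.-integrable [set: X] (EFin \o F i)) ->
  \int[P]_x (\sum_(i <- r | A i) F i x) = \sum_(i <- r | A i) \int[P]_x F i x.
Proof.
move=> iF; elim: r => [|i r IHr].
  by rewrite big_nil; under eq_Rintegral do rewrite big_nil; rewrite Rintegral_cst// mul0r.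
rewrite big_cons; under eq_Rintegral do rewrite big_cons.
case: (boolP (A i)) => // Ai; rewrite -IHr.
by apply: RintegralD => //; [exact: iF | exact: integrable_Rsum].
Qed.
Local Notation mu := (cube_measure R s).
Local Notation T := (cube_point R s).

(** All that the representation needs of the rule: it commutes with integrals and depends only on
    values in the cube. *)
Definition evaluation (L : (T -> R) -> R) : Prop :=
  exists (J : finType) (c : J -> R) (x : J -> T),
    (forall l, cube (x l)) /\ forall f, L f = \sum_l c l * f (x l).

Lemma evaluation_richardson p n m (C : 'I_s -> 'M['F_p]_(n, m)) tau i : prime p ->
  evaluation (fun f => richardson C f tau i).
Proof.
move=> p_prime; elim: tau i => [|tau IHtau] i.
  exists 'I_(p ^ m), (fun=> (p ^ m)%:R^-1), (fun h : 'I_(p ^ m) => net_point R (fun j => upper_rows (m + i) (C j)) h).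
  split=> [h j|f]; last by rewrite /= /net_average big_distrr.
  by rewrite net_pointE; exact: digits_point_itv.
have [J [c [x [cx E]]]] := IHtau i.+1; have [J' [c' [x' [cx' E']]]] := IHtau i.
pose b : R := (p%:R ^+ tau.+1 - 1)^-1.
exists (J + J')%type, (fun l => match l with inl l => p%:R ^+ tau.+1 * b * c l | inr l => - b * c' l end),
  (fun l => match l with inl l => x l | inr l => x' l end).
split=> [[]//|f]; rewrite /= E E' big_sumType /= mulrBl !big_distrr !big_distrl /=.
congr (_ + _); first by apply: eq_bigr => l _; rewrite /b; ring.
by rewrite -sumrN; apply: eq_bigr => l _; rewrite /b; ring.
Qed.

Lemma evaluation_sum L (J : Type) (r : seq J) (P : pred J) (F : J -> T -> R) : evaluation L ->
  L (fun x => \sum_(i <- r | P i) F i x) = \sum_(i <- r | P i) L (F i).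
Proof.
case=> [K [c [x [_ E]]]]; rewrite E; under [RHS]eq_bigr do rewrite E.
by rewrite exchange_big; apply: eq_bigr => l _; rewrite big_distrr.
Qed.

Lemma evaluationZ L (b : R) (F : T -> R) : evaluation L -> L (fun x => b * F x) = b * L F.
Proof.
by case=> [K [c [x [_ E]]]]; rewrite !E big_distrr; apply: eq_bigr => l _; rewrite mulrCA.
Qed.

Lemma eq_evaluation L (F G : T -> R) : evaluation L -> (forall x, cube x -> F x = G x) -> L F = L G.
Proof. by case=> [K [c [x [cx E]]]] FG; rewrite !E; apply: eq_bigr => l _; rewrite FG. Qed.

Lemma evaluation_measurable L (k : T -> T -> R) : evaluation L ->
  (forall x, cube x -> measurable_fun [set: T] (k^~ x)) -> measurable_fun [set: T] (fun y => L (k y)).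
Proof.
case=> [K [c [x [cx E]]]] mk; have -> : (fun y => L (k y)) = (fun y => \sum_l c l * k y (x l)).
  by apply/funext => y; rewrite E.
by apply: measurable_sum => l; apply: measurable_funM => //; exact: mk.
Qed.

Lemma evaluation_Rintegral L (g : T -> R) (k : T -> T -> R) : evaluation L ->
    (forall x, cube x -> mu.-integrable [set: T] (EFin \o (fun y => g y * k y x))) ->
  L (fun x => \int[mu]_y (g y * k y x)) = \int[mu]_y (g y * L (k y)).
Proof.
case=> [K [c [x [cx E]]]] ik; rewrite E.
under [RHS]eq_Rintegral do rewrite E big_distrr /=.
rewrite Rintegral_sum => [|l _].
  apply: eq_bigr => l _; rewrite -RintegralZl//; last exact: ik.
  by apply: eq_Rintegral => y _; rewrite mulrCA.
have -> : EFin \o (fun y => g y * (c l * k y (x l))) =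
    (fun y => (c l)%:E * (EFin \o (fun y => g y * k y (x l))%R) y)%E.
  by apply/funext => y; rewrite /= -EFinM mulrCA.
by apply: integrableZl => //; exact: ik.
Qed.

End Evaluation.

(** * The error bound *)

Section ErrorBound.
Variables (R : realType) (p s a m t : nat) (C : 'I_s -> 'M['F_p]_(a * m, m)).
Hypotheses (p_prime : prime p) (a_ge2 : (2 <= a)%N) (m_gt0 : (0 < m)%N).
Hypothesis C_net : order_digital_net a t C.

Local Notation mu := (cube_measure R s).
Local Notation T := (cube_point R s).
Local Notation J f := (richardson C f a.-1 0).
Local Notation pair := ({set 'I_s} * {ffun 'I_s -> 'I_a.+1})%type.

Definition error_bound (d : nat) : R :=
  (\sum_(0 <= l < a) `|richardson_weight R p a l|) *
  ((p%:R ^+ (a * m - t))^-1 * decay_base a m (Num.max 1 (p%:R * (p%:R - 1) / 4)) ^+ d +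
   (p%:R ^+ (a * m))^-1 * const_D R a ^+ d).

Lemma error_bound_ge0 d : 0 <= error_bound d.
Proof.
have x0 : 0 <= Num.max 1 (p%:R * (p%:R - 1) / 4) :> R by rewrite le_max ler01.
rewrite /error_bound mulr_ge0 ?sumr_ge0// addr_ge0// mulr_ge0 ?exprn_ge0 ?const_D_ge0 ?invr_ge0 ?exprn_ge0//.
by rewrite /decay_base !mulr_ge0 ?exprn_ge0 ?mulr_ge0 ?addr_ge0 ?invr_ge0.
Qed.

Lemma richardson_cst1 tau i : richardson C (fun=> 1 : R) tau i = 1.
Proof.
have -> : richardson C (fun=> 1 : R) tau i = extrapolate p (fun=> 1 : R) tau i.
  rewrite richardsonE; apply: eq_extrapolate => l; rewrite /net_average sumr_const card_ord mulVf//.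
  by rewrite pnatr_eq0 -lt0n expn_gt0 prime_gt0.
exact: extrapolate_cst.
Qed.

Lemma richardson_kernel_le u (vb : pair) (y : T) : index_pair u vb -> u != finset.set0 ->
  `|J (kernel u vb.1 vb.2 y)| <= error_bound #|u|.
Proof.
case/andP=> vu duv u0; apply: (kernel_error p_prime a_ge2 m_gt0 C_net vu duv y) => //.
  by rewrite le_max lexx.
by rewrite le_max mulrCA mulrA lexx orbT.
Qed.

Lemma kernel_splice u (vb : pair) (x y : T) : kernel u vb.1 vb.2 (splice vb.1 x y) = kernel u vb.1 vb.2 x.
Proof.
apply/funext => z; apply: eq_bigr => j _; rewrite /kernel_factor.
by case: ifP => // jv; rewrite tnth_mktuple jv.
Qed.

Section Function.
Variables (q r : \bar R) (gamma : {set 'I_s} -> R) (f : T -> R).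
Hypotheses (q_ge1 : (1 <= q)%E) (r_ge1 : (1 <= r)%E) (gamma_ge0 : forall u, 0 <= gamma u).
Hypotheses (f_W : in_W a q r gamma f) (f_le1 : (Wnorm a q r gamma f <= 1)%E).

Let g (beta : {ffun 'I_s -> 'I_a.+1}) := wderiv (fun j => beta j) f.

Lemma wderiv_integrable beta : mu.-integrable [set: T] (EFin \o g beta).
Proof.
have [/(_ beta) exg _ _] := f_W.
by have [] := xgetPex (fun=> 0) exg.
Qed.

Let a_gt0 : (0 < a)%N. Proof. exact: leq_trans a_ge2. Qed.

Let sg (vb : pair) : R := (- 1) ^+ (a.+1 * #|vb.1|).

Lemma pointwise_representation (x : T) : cube x -> f x =
  \sum_(u : {set 'I_s}) \sum_(vb | index_pair u vb) sg vb * \int[mu]_y (g vb.2 y * kernel u vb.1 vb.2 y x).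
Proof.
have [_ _ fE] := f_W; move=> cx; rewrite fE//; apply: eq_bigr => u _.
by rewrite componentE//; exact: wderiv_integrable.
Qed.

Lemma integral_representation : \int[mu]_(x in @cube R s) f x =
  \sum_(u : {set 'I_s}) \sum_(vb | index_pair u vb) sg vb * ((u == finset.set0)%:R * \int[mu]_y g vb.2 y).
Proof.
pose F u (vb : pair) x := \int[mu]_y (g vb.2 y * cube_kernel u vb.1 vb.2 y x).
have FP u vb : index_pair u vb -> mu.-integrable [set: T] (EFin \o F u vb) /\
    \int[mu]_x F u vb x = (u == finset.set0)%:R * \int[mu]_y g vb.2 y.
  case/andP => vu duv; exact: Rintegral_cube_kernel_mul vu duv a_gt0 (wderiv_integrable vb.2).
have iZ u vb : index_pair u vb -> mu.-integrable [set: T] (EFin \o (fun x => sg vb * F u vb x)).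
  move=> /FP[iF _]; have -> : EFin \o (fun x => sg vb * F u vb x) =
    (fun x => (sg vb)%:E * (EFin \o F u vb) x)%E by apply/funext.
  exact: integrableZl.
rewrite Rintegral_mkcond.
transitivity (\int[mu]_x \sum_(u : {set 'I_s}) \sum_(vb | index_pair u vb) sg vb * F u vb x).
  apply: eq_Rintegral => x _; rewrite patchE; case: ifPn => cx.
    rewrite pointwise_representation; last exact: set_mem.
    apply: eq_bigr => u _; apply: eq_bigr => vb _; congr (_ * _).
    by apply: eq_Rintegral => y _; rewrite cube_kernelE cx.
  rewrite big1// => u _; rewrite big1// => vb _.
  rewrite (_ : F u vb x = 0) ?mulr0//.
  rewrite /F; under eq_Rintegral do rewrite cube_kernelE (negbTE cx) mulr0.
  by rewrite Rintegral_cst// mul0r.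
rewrite Rintegral_sum => [|u _]; last by apply: integrable_Rsum => vb; exact: iZ.
apply: eq_bigr => u _; rewrite Rintegral_sum => [|vb]; last exact: iZ.
apply: eq_bigr => vb /FP[iF <-]; exact: RintegralZl.
Qed.

Lemma richardson_representation : J f =
  \sum_(u : {set 'I_s}) \sum_(vb | index_pair u vb)
    sg vb * \int[mu]_y (g vb.2 y * J (kernel u vb.1 vb.2 y)).
Proof.
have evJ := evaluation_richardson R C a.-1 0 p_prime.
rewrite (eq_evaluation evJ pointwise_representation) (evaluation_sum _ _ _ evJ).
apply: eq_bigr => u _; rewrite (evaluation_sum _ _ _ evJ); apply: eq_bigr => vb _.
rewrite (evaluationZ _ _ evJ); congr (_ * _).
apply: (evaluation_Rintegral (k := fun y x => kernel u vb.1 vb.2 y x) evJ) => x cx.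
apply: (integrable_mul_bounded (wderiv_integrable _) (M := 1)); last by move=> y; exact: kernel_le1.
by apply: measurable_kernel => //; exact: measurable_cst.
Qed.

(** On a probability space the L^1 norm is at most the L^q norm. That is one entry of the inner l^q
    norm, which divided by gamma_u is one entry of the outer l^r norm, itself at most 1. *)
Lemma integrate_out_le u (vb : pair) : index_pair u vb ->
  (\int[mu]_x `|(integrate_out vb.1 (g vb.2) x)%:E| <= (gamma u)%:E)%E.
Proof.
move=> uvb; have ig := wderiv_integrable vb.2.
have := @le_integral_Lnorm R _ _ mu _ q q_ge1 (integrate_out_measurable vb.1 ig).
move=> /le_trans; apply.
pose N (vb : pair) := Lnorm mu q (EFin \o integrate_out vb.1 (g vb.2)).
have N0 vb' : (0 <= N vb')%E by exact: Lnorm_ge0.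
apply: (@le_trans _ _ (lnorm q (index_pair u) N)).
  exact: (lnorm_ge_term (F := N) q_ge1 N0 uvb).
apply: ediv0_le1 => //; first exact: lnorm_ge0.
apply: le_trans f_le1.
pose M u := ediv0 (lnorm q (index_pair u) N) (gamma u).
by apply: (@lnorm_ge_term _ r _ xpredT M u r_ge1) => // u'; apply: ediv0_ge0 => //; exact: lnorm_ge0.
Qed.

Lemma term_le u (vb : pair) : index_pair u vb -> u != finset.set0 ->
  `|\int[mu]_y (g vb.2 y * J (kernel u vb.1 vb.2 y))| <= error_bound #|u| * gamma u.
Proof.
move=> uvb u0; rewrite -lee_fin.
have mK : measurable_fun [set: T] (fun y => J (kernel u vb.1 vb.2 y)).
  apply: (evaluation_measurable (evaluation_richardson R C a.-1 0 p_prime)) => x cx.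
  by apply: measurable_kernel => //; exact: measurable_cst.
have Kle y : `|J (kernel u vb.1 vb.2 y)| <= error_bound #|u| by exact: richardson_kernel_le.
apply: (le_trans (@Rintegral_mul_bound R s vb.1 _ _ _ (wderiv_integrable _) mK Kle _)).
  by move=> x y; rewrite kernel_splice.
move: (error_bound #|u|) Kle => B Kle; rewrite EFinM lee_wpmul2l ?integrate_out_le// lee_fin.
exact: le_trans (Kle [tuple of nseq s 0]).
Qed.

(** For empty u the kernel is constant and the rule is exact on constants, so these terms cancel.
    For nonempty u the integral contributes nothing, and each term of the rule is bounded by
    [term_le]. *)
Lemma extrapolation_error : `|\int[mu]_(x in @cube R s) f x - J f| <=
  \sum_(u : {set 'I_s} | u != finset.set0) (a.+1 ^ #|u|)%:R * (error_bound #|u| * gamma u).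
Proof.
rewrite integral_representation richardson_representation -sumrB.
rewrite (bigD1 finset.set0)//= [X in X + _](_ : _ = 0); last first.
  rewrite -sumrB big1// => vb uvb; apply/eqP; rewrite eqxx mul1r subr_eq0; apply/eqP; congr (_ * _).
  apply: eq_Rintegral => y _.
  have -> : kernel finset.set0 vb.1 vb.2 y = fun=> 1.
    apply/funext => x; rewrite /kernel big1// => j _; rewrite /kernel_factor.
    case/andP: uvb => /fintype.subsetP v0 _; case: ifP => [/v0|_]; last by rewrite inE.
    by rewrite inE.
  by rewrite richardson_cst1 mulr1.
rewrite add0r; apply: le_trans (ler_norm_sum _ _ _) _; apply: ler_sum => u u0.
rewrite -sumrB; apply: le_trans (ler_norm_sum _ _ _) _.
have E0 : 0 <= error_bound #|u| * gamma u.
  by rewrite mulr_ge0// error_bound_ge0.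
apply: (@le_trans _ _ (\sum_(vb : pair | index_pair u vb) error_bound #|u| * gamma u)).
  apply: ler_sum => vb uvb; rewrite (negbTE u0) mul0r mulr0 sub0r normrN normrM.
  by rewrite normrX normrN1 expr1n mul1r term_le.
rewrite sumr_const -[leLHS]mulr_natl ler_wpM2r// ler_nat.
exact: card_index_pair.
Qed.

End Function.
End ErrorBound.

Theorem theorem2 (R : realType) (p s alpha m t : nat) (q r : \bar R)
    (gamma : {set 'I_s} -> R) (C : 'I_s -> 'M['F_p]_(alpha * m, m))
    (p_prime : prime p) (s_gt0 : (0 < s)%N) (alpha_ge2 : (2 <= alpha)%N)
    (m_gt0 : (0 < m)%N) (q_ge1 : (1 <= q)%E) (r_ge1 : (1 <= r)%E)
    (gamma_ge0 : forall u, 0 <= gamma u)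
    (C_net : order_digital_net alpha t C) :
  let N : R := (alpha * p ^ m)%:R in
  (ereal_sup
     [set (`|(\int[cube_measure R s]_(x in @cube R s) f x)
             - richardson C f alpha.-1 0|)%:E
     | f in [set f |
              in_W alpha q r gamma f /\ (Wnorm alpha q r gamma f <= 1)%E]]
   <= (\sum_(u : {set 'I_s} | u != finset.set0)
         gamma u * const_V R p #|u| alpha t
         * (logb p N ^+ (alpha * #|u|) / N ^+ alpha))%:E)%E.
Proof.
cbv zeta; apply: ge_ereal_sup => _ [f [f_W f_le1] <-]; rewrite lee_fin.
apply: le_trans (extrapolation_error p_prime alpha_ge2 m_gt0 C_net q_ge1 r_ge1 gamma_ge0 f_W f_le1) _.
apply: ler_sum => u u0; rewrite mulrA [leLHS]mulrC -mulrA ler_wpM2l//.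
have cu : (0 < #|u|)%N by rewrite card_gt0.
have [t_le _] := C_net.
by rewrite natrX -natr1; exact: constants_comparison.
Qed.
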